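(* Let $A$ be a nondegenerate polarized Hopf algebra with a quasitriangular structure $\mathcal R\in A\,\hat\otimes\,A$, let $T=\mathrm{Spec}\,A_0$, and let $V,W,U$ be modules in the category $\mathcal O$. Then, for generic $\lambda\in T$, the following hold. I. The fusion matrices satisfy the 2-cocycle condition on $V\otimes W\otimes U$: $$J_{V\otimes W,U}(\lambda)\,\bigl(J_{V,W}(\lambda-h^{(3)})\otimes 1\bigr)=J_{V,W\otimes U}(\lambda)\,\bigl(1\otimes J_{W,U}(\lambda)\bigr).$$ II. The exchange matrices satisfy the quantum dynamical Yang-Baxter equation on $V\otimes W\otimes U$: $$R^{12}(\lambda-h^{(3)})\,R^{13}(\lambda)\,R^{23}(\lambda-h^{(1)})=R^{23}(\lambda)\,R^{13}(\lambda-h^{(2)})\,R^{12}(\lambda),$$ where $R^{12},R^{13},R^{23}$ denote $R_{V,W},R_{V,U},R_{W,U}$ acting in the indicated factors.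
   Context: All algebras are over $\mathbb C$. A polarized Hopf algebra is a Hopf algebra $A$ (coproduct $\Delta$, counit $\epsilon$, antipode $S$) such that: (I) $A=\oplus_{k\in\mathbb Z}A[k]$ is $\mathbb Z$-graded; (II) there are graded subalgebras $A_0,A_+,A_-$ such that the multiplication maps $A_+\otimes A_0\otimes A_-\to A$ and $A_-\otimes A_0\otimes A_+\to A$ are isomorphisms of vector spaces, and the graded components of $A_\pm$ are finite dimensional; (III) $\ker\epsilon\cap A_+$ has only elements of positive degree, $\ker\epsilon\cap A_-$ only of negative degree, $A_0$ only of degree zero; (IV) $A_0$ is a commutative cocommutative finitely generated Hopf algebra; (V) $A_0A_+$ and $A_0A_-$ are Hopf subalgebras. $T=\mathrm{Spec}\,A_0$ is a commutative affine algebraic group, written additively; its points are characters $\lambda:A_0\to\mathbb C$. For an $A_0$-module $V$, $V[\lambda]=\{v: a v=\lambda(a)v\ \forall a\in A_0\}$. For $\lambda\in T$ let $\chi^\pm_\lambda=\mathbb C v^\pm_\lambda$ be the one-dimensional $A_0A_\pm$-module on which $A_0$ acts by $\lambda$ and $A_\pm$ by $\epsilon$; the Verma modules are $M^\pm_\lambda=A\otimes_{A_0A_\pm}\chi^\pm_\lambda$, graded with $\deg v^\pm_\lambda=0$; $(v^\pm_\lambda)^*$ is the degree-zero element of the restricted (graded) dual with $\langle (v^\pm_\lambda)^*,v^\pm_\lambda\rangle=1$. $A$ is nondegenerate if $M^\pm_\lambda$ are irreducible for generic $\lambda$ (''generic'' = outside a countable union of algebraic sets of lower dimension). $\mathcal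 O$ is the category of $\mathbb Z$-graded $A$-modules whose grading is bounded from above and which are diagonalizable over $A_0$. For $V\in\mathcal O$, $v\in V[\lambda_v]$ and generic $\lambda$ there is a unique $A$-homomorphism $\Phi^v_\lambda:M^+_\lambda\to M^+_{\lambda-\lambda_v}\otimes V$ with $\langle (v^+_{\lambda-\lambda_v})^*\otimes 1,\Phi^v_\lambda v^+_\lambda\rangle=v$. For homogeneous $v\in V[\lambda_v]$, $w\in W[\lambda_w]$ put $\Phi^{w,v}_\lambda=(\Phi^w_{\lambda-\lambda_v}\otimes1)\Phi^v_\lambda:M^+_\lambda\to M^+_{\lambda-\lambda_v-\lambda_w}\otimes W\otimes V$. The fusion matrix $J_{W,V}(\lambda):W\otimes V\to W\otimes V$ is the linear operator with $J_{W,V}(\lambda)(w\otimes v)=u$, where $u\in (W\otimes V)[\lambda_v+\lambda_w]$ is determined by $\Phi^{w,v}_\lambda=\Phi^u_\lambda$; it is invertible. $A\hat\otimes A=\oplus_i(A\hat\otimes A)[i]$, with $(A\hat\otimes A)[i]$ the projective limit over $n$ of $(A/I_n\otimes A/I_n)[i]$, $I_n=A\cdot\oplus_{j\ge n}A[j]$; it is an algebra acting on $V\otimes W$ for $V,W\in\mathcal O$. A quasitriangular structure is an invertible $\mathcal R\in A\hat\otimes A$ with $\mathcal R\Delta(a)=\Delta^{op}(a)\mathcal R$ for all $a\in A$, $(\Delta\otimes1)\mathcal R=\mathcal R^{13}\mathcal R^{23}$, $(1\otimes\Delta)\mathcal R=\mathcal R^{13}\mathcal R^{12}$. The exchange matrix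 is $R_{V,W}(\lambda)=J_{V,W}^{-1}(\lambda)\,\mathcal R^{21}|_{V\otimes W}\,J^{21}_{W,V}(\lambda):V\otimes W\to V\otimes W$, where $J^{21}_{W,V}=PJ_{W,V}P$ with $P$ the permutation of factors. Dynamical notation: $R^{12}(\lambda-h^{(3)})(v\otimes w\otimes u)=(R(\lambda-\lambda_u)(v\otimes w))\otimes u$ for $u\in U[\lambda_u]$, and similarly for the other symbols: $h^{(i)}$ is replaced by the weight of the $i$-th tensor component.
   Formalization: If V, W, U have uncountably many weights, J(λ) may be undefined for every λ; the identities are proved, for each countable set P of weights and generic λ, on the span of V[a]⊗W[b]⊗U[c] with a,b,c in P (all of V⊗W⊗U when the weights are countable). *)

(* Defs.v *)
From HB Require Import structures.
From mathcomp Require Import all_boot all_order all_algebra.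
From mathcomp Require Import generic_quotient.
From mathcomp Require Import boolp classical_sets functions cardinality.
From mathcomp.multinomials Require Import freeg.

Set Implicit Arguments.
Unset Strict Implicit.
Unset Printing Implicit Defensive.

Import GRing.Theory.
Local Open Scope ring_scope.
Local Open Scope classical_set_scope.
Local Open Scope quotient_scope.

Section Linear.
Variable K : fieldType.

Definition submod (V : lmodType K) (X : set V) : Prop :=
  X 0 /\ forall (a : K) x y, X x -> X y -> X (a *: x + y).

Definition span (V : lmodType K) (S : set V) : set V := smallest (@submod V) S.

Lemma span_submod (V : lmodType K) (S : set V) : submod (span S).
Proof.
split=> [X [[]]//|a x y Sx Sy X [Xs SX]].
by apply: Xs.2; [apply: Sx|apply: Sy].
Qed.

Lemma span_gen (V : lmodType K) (S : set V) : S `<=` span S.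
Proof. by move=> x Sx X [_]; apply. Qed.

Lemma span_min (V : lmodType K) (S X : set V) :
  submod X -> S `<=` X -> span S `<=` X.
Proof. by move=> Xs SX x; apply. Qed.

Lemma span0 (V : lmodType K) (S : set V) : span S 0.
Proof. exact: (span_submod S).1. Qed.

Lemma spanZ (V : lmodType K) (S : set V) a x : span S x -> span S (a *: x).
Proof.
by move=> Sx; rewrite -[_ *: _]addr0; apply: (span_submod S).2=> //; exact: span0.
Qed.

Lemma spanD (V : lmodType K) (S : set V) x y :
  span S x -> span S y -> span S (x + y).
Proof. by move=> Sx Sy; rewrite -[x]scale1r; exact: (span_submod S).2. Qed.

Lemma spanN (V : lmodType K) (S : set V) x : span S x -> span S (- x).
Proof. by rewrite -scaleN1r; exact: spanZ. Qed.

Definition mklin (V W : lmodType K) (f : V -> W) (lf : linear f) : {linear V -> W} :=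
  HB.pack_for {linear V -> W} f (GRing.isLinear.Build _ _ _ _ f lf).

Lemma span_map (V W : lmodType K) (S : set V) (S' : set W) (f : V -> W) :
  linear f -> (forall x, S x -> span S' (f x)) ->
  forall x, span S x -> span S' (f x).
Proof.
move=> lf fS; apply: (@span_min _ S (f @^-1` span S')); last exact: fS.
split=> [|a x y /= Sx Sy]; first by have /= -> := linear0 (mklin lf); exact: span0.
by rewrite lf; exact: (span_submod S').2.
Qed.

(* The quotient of V by the span of S. *)
Section Quotient.
Variables (V : lmodType K) (S : set V).

Definition quot_rel (x y : V) : bool := `[< span S (x - y) >].

Lemma quot_rel_refl : reflexive quot_rel.
Proof. by move=> x; apply/asboolP; rewrite subrr; exact: span0. Qed.

Lemma quot_rel_sym : symmetric quot_rel.
Proof.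
by move=> x y; apply/idP/idP=> /asboolP h; apply/asboolP; rewrite -opprB; exact: spanN.
Qed.

Lemma quot_rel_trans : transitive quot_rel.
Proof.
move=> y x z /asboolP h1 /asboolP h2; apply/asboolP.
by rewrite -[x](subrK y) -addrA; exact: spanD.
Qed.

Canonical quot_equiv := EquivRel quot_rel quot_rel_refl quot_rel_sym quot_rel_trans.

Definition quot := {eq_quot quot_rel}.
HB.instance Definition _ := Choice.on quot.
HB.instance Definition _ : EqQuotient _ quot_rel quot := EqQuotient.on quot.

Definition qproj (x : V) : quot := \pi_quot x.

Lemma qprojP x y : qproj x = qproj y <-> span S (x - y).
Proof.
by split=> [/eqmodP /asboolP //|h]; apply/eqmodP; apply/asboolP.
Qed.

Lemma qrepr x : span S (repr (qproj x) - x).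
Proof. by apply/qprojP; rewrite /qproj reprK. Qed.

Lemma qproj_surj (q : quot) : exists x, q = qproj x.
Proof. by exists (repr q); rewrite /qproj reprK. Qed.

Definition qzero : quot := qproj 0.
Definition qadd (p q : quot) : quot := qproj (repr p + repr q).
Definition qopp (p : quot) : quot := qproj (- repr p).
Definition qscale (a : K) (p : quot) : quot := qproj (a *: repr p).

Lemma qaddE x y : qadd (qproj x) (qproj y) = qproj (x + y).
Proof. by apply/qprojP; rewrite opprD addrACA; apply: spanD; exact: qrepr. Qed.

Lemma qoppE x : qopp (qproj x) = qproj (- x).
Proof. by apply/qprojP; rewrite -opprD; apply: spanN; exact: qrepr. Qed.

Lemma qscaleE a x : qscale a (qproj x) = qproj (a *: x).
Proof. by apply/qprojP; rewrite -scalerBr; apply: spanZ; exact: qrepr. Qed.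

Lemma qaddA : associative qadd.
Proof.
move=> p q r; have [x ->] := qproj_surj p; have [y ->] := qproj_surj q; have [z ->] := qproj_surj r.
by rewrite !qaddE addrA.
Qed.

Lemma qaddC : commutative qadd.
Proof.
by move=> p q; have [x ->] := qproj_surj p; have [y ->] := qproj_surj q; rewrite !qaddE addrC.
Qed.

Lemma qadd0 : left_id qzero qadd.
Proof. by move=> p; have [x ->] := qproj_surj p; rewrite qaddE add0r. Qed.

Lemma qaddN : left_inverse qzero qopp qadd.
Proof. by move=> p; have [x ->] := qproj_surj p; rewrite qoppE qaddE addNr. Qed.

HB.instance Definition _ := GRing.isZmodule.Build quot qaddA qaddC qadd0 qaddN.

Lemma qscaleA a b p : qscale a (qscale b p) = qscale (a * b) p.
Proof. by have [x ->] := qproj_surj p; rewrite !qscaleE scalerA. Qed.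

Lemma qscale1 : left_id 1 qscale.
Proof. by move=> p; have [x ->] := qproj_surj p; rewrite qscaleE scale1r. Qed.

Lemma qscaleDr : right_distributive qscale +%R.
Proof.
move=> a p q; have [x ->] := qproj_surj p; have [y ->] := qproj_surj q.
have D u v : qproj u + qproj v = qproj (u + v) := qaddE u v.
by rewrite D !qscaleE D scalerDr.
Qed.

Lemma qscaleDl p : {morph qscale^~ p : a b / a + b}.
Proof.
move=> a b; have [x ->] := qproj_surj p.
have D u v : qproj u + qproj v = qproj (u + v) := qaddE u v.
by rewrite !qscaleE D scalerDl.
Qed.

HB.instance Definition _ :=
  GRing.Zmodule_isLmodule.Build K quot qscaleA qscale1 qscaleDr qscaleDl.

Lemma qproj_is_linear : linear qproj.
Proof. by move=> a x y; rewrite -qaddE -qscaleE. Qed.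

HB.instance Definition _ := GRing.isLinear.Build K V quot _ qproj qproj_is_linear.

Lemma qproj0P x : qproj x = 0 <-> span S x.
Proof. by rewrite -[x in span _ x]subr0; exact: qprojP. Qed.

(* The map induced on the quotient by a linear map vanishing on S. *)
Definition qlift (W : lmodType K) (f : V -> W) (q : quot) : W := f (repr q).

Lemma qliftE (W : lmodType K) (f : {linear V -> W}) :
  (forall x, S x -> f x = 0) -> forall x, qlift f (qproj x) = f x.
Proof.
move=> fS x; apply/eqP; rewrite -subr_eq0 -linearB; apply/eqP.
suff sub : span S `<=` [set y | f y = 0] by exact: sub (qrepr x).
apply: span_min => [|y /fS//].
by split=> [|a y z /= fy fz]; [exact: linear0|rewrite linearP fy fz scaler0 addr0].
Qed.

Lemma qlift_linear (W : lmodType K) (f : {linear V -> W}) :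
  (forall x, S x -> f x = 0) -> linear (qlift f).
Proof.
move=> fS a p q; have [x ->] := qproj_surj p; have [y ->] := qproj_surj q.
by rewrite -linearP !qliftE // linearP.
Qed.

End Quotient.

Definition bilinear2 (V W X : lmodType K) (f : V -> W -> X) : Prop :=
  (forall w, linear (f^~ w)) /\ (forall v, linear (f v)).

(* The tensor product over K: the free module on V * W modulo bilinearity. *)
Section Tensor.
Variables V W : lmodType K.

Definition fpair (v : V) (w : W) : {freeg (V * W)%type / K} := << (v, w) >>.

Definition tens_rel : set {freeg (V * W)%type / K} :=
  [set r | (exists a v v' w,
              r = fpair (a *: v + v') w - (a *: fpair v w + fpair v' w))
        \/ (exists a v w w',
              r = fpair v (a *: w + w') - (a *: fpair v w + fpair v w'))].

Definition tens := quot tens_rel.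
HB.instance Definition _ := GRing.Lmodule.on tens.

Definition pure (v : V) (w : W) : tens := qproj tens_rel (fpair v w).

Lemma pure_bilinear : bilinear2 pure.
Proof.
split=> [w|v] a x y; rewrite /pure -linearP; apply/qprojP; apply: span_gen.
- by left; exists a, x, y, w.
- by right; exists a, v, x, y.
Qed.

Lemma fglift_is_linear (X : lmodType K) (f : (V * W)%type -> X) :
  linear (fglift f : {freeg (V * W)%type / K} -> X).
Proof.
move=> a x y.
pose F := HB.pack_for {additive {freeg (V * W)%type / K} -> X} (fglift f)
  (GRing.isZmodMorphism.Build _ _ _ (@lift_is_additive K (V * W)%type X f)).
have FD u v : fglift f (u + v) = fglift f u + fglift f v := raddfD F u v.
have Fs I r (G : I -> _) : fglift f (\sum_(i <- r) G i) = \sum_(i <- r) fglift f (G i)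
  by exact: (raddf_sum F).
rewrite FD; congr (_ + _).
rewrite -{2}(freeg_sumE x) {1}/GRing.scale /= /fgscale !Fs scaler_sumr.
by apply: eq_bigr => z _; rewrite !liftU scalerA.
Qed.

(* The linear map V (x) W -> X induced by a bilinear map f (for other f the
   value is irrelevant). *)
Definition tlift (X : lmodType K) (f : V -> W -> X) : tens -> X :=
  qlift (fglift (fun p => f p.1 p.2)).

Section Lift.
Variables (X : lmodType K) (f : V -> W -> X) (fB : bilinear2 f).

Let F := mklin (fglift_is_linear (fun p : V * W => f p.1 p.2)).

Let FU v w : F (fpair v w) = f v w.
Proof. by rewrite /= liftU scale1r. Qed.

Let F0 x : tens_rel x -> F x = 0.
Proof.
case=> -[a [v [v' [w ->]]]]; rewrite linearB linearP !FU.
- by rewrite fB.1 subrr.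
- by rewrite fB.2 subrr.
Qed.

Lemma tliftE v w : tlift f (pure v w) = f v w.
Proof. by rewrite -FU; exact: (qliftE F0). Qed.

Lemma tlift_linear : linear (tlift f).
Proof. exact: (qlift_linear F0). Qed.
End Lift.

Lemma tens_span (x : tens) : span [set pure p.1 p.2 | p in [set: V * W]] x.
Proof.
have [y ->] := qproj_surj x.
rewrite -(freeg_sumE y) linear_sum /=.
elim: (dom y) => [|[v w] s IH]; rewrite ?big_nil ?big_cons; first exact: span0.
apply: spanD => //.
suff -> : << coeff (v, w) y *g (v, w) >> = coeff (v, w) y *: fpair v w.
  by rewrite linearZ; apply: spanZ; apply: span_gen; exists (v, w).
apply/eqP/freeg_eqP => z.
by rewrite coeffZ !coeffU mul1r.
Qed.

Lemma tens_ext (X : lmodType K) (f g : tens -> X) : linear f -> linear g ->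
  (forall v w, f (pure v w) = g (pure v w)) -> f =1 g.
Proof.
move=> lf lg fg x.
suff sub : span [set pure p.1 p.2 | p in [set: V * W]] `<=` [set x | f x = g x].
  exact: sub (tens_span x).
apply: span_min.
- split=> [|a y z /= e1 e2]; last by rewrite lf lg e1 e2.
  by have /= -> := linear0 (mklin lf); have /= -> := linear0 (mklin lg).
- by move=> _ [p _ <-]; exact: fg.
Qed.

End Tensor.

Local Notation "v \ox w" := (pure v w) (at level 40, left associativity).

Lemma comp_linear (U V W : lmodType K) (g : V -> W) (f : U -> V) :
  linear g -> linear f -> linear (g \o f).
Proof. by move=> lg lf a x y /=; rewrite lf lg. Qed.

Definition tmap (V W V' W' : lmodType K) (f : V -> V') (g : W -> W') :
  tens V W -> tens V' W' := tlift (fun v w => f v \ox g w).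

Definition tswap (V W : lmodType K) : tens V W -> tens W V :=
  tlift (fun v w => w \ox v).

Definition tassoc (U V W : lmodType K) :
  tens (tens U V) W -> tens U (tens V W) :=
  tlift (fun x w => tlift (fun u v => u \ox (v \ox w)) x).

Definition tassocV (U V W : lmodType K) :
  tens U (tens V W) -> tens (tens U V) W :=
  tlift (fun u y => tlift (fun v w => u \ox v \ox w) y).

(* (x \ox y) (x' \ox y') = (x x') \ox (y y'), for given bilinear products. *)
Definition tmulg (V W : lmodType K) (mV : V -> V -> V) (mW : W -> W -> W)
    (x y : tens V W) : tens V W :=
  tlift (fun v w => tlift (fun v' w' => mV v v' \ox mW w w') y) x.

Definition tmul (A B : algType K) : tens A B -> tens A B -> tens A B :=
  tmulg *%R *%R.

Definition tmul3 (A B C : algType K) :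
    tens A (tens B C) -> tens A (tens B C) -> tens A (tens B C) :=
  tmulg *%R (@tmul B C).

Section TensorFacts.
Variables V W V' W' : lmodType K.

Lemma tmap_bilinear (f : V -> V') (g : W -> W') :
  linear f -> linear g -> bilinear2 (fun v w => f v \ox g w).
Proof.
have [p1 p2] := pure_bilinear V' W'.
by move=> lf lg; split=> [w|v] a x y; rewrite ?lf ?lg ?p1 ?p2.
Qed.

Lemma tmapE (f : V -> V') (g : W -> W') v w :
  linear f -> linear g -> tmap f g (v \ox w) = f v \ox g w.
Proof. by move=> lf lg; rewrite /tmap tliftE //; exact: tmap_bilinear. Qed.

Lemma tmap_linear (f : V -> V') (g : W -> W') :
  linear f -> linear g -> linear (tmap f g).
Proof. by move=> lf lg; apply: tlift_linear; exact: tmap_bilinear. Qed.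

Lemma tswapE (v : V) (w : W) : tswap (v \ox w) = w \ox v.
Proof.
rewrite /tswap tliftE //; have [p1 p2] := pure_bilinear W V.
by split=> [z|z] a x y; rewrite ?p1 ?p2.
Qed.

End TensorFacts.

End Linear.

Notation "v \ox w" := (pure v w) (at level 40, left associativity).

Record amod (K : fieldType) (A : algType K) := AMod {
  acar :> lmodType K;
  act : A -> acar -> acar;
  act_bilinear : bilinear2 act;
  act1 : forall v, act 1 v = v;
  actM : forall a b v, act (a * b) v = act a (act b v)
}.

Section Modules.
Variables (K : fieldType) (A : algType K).

Definition is_hom (M N : amod A) (f : M -> N) : Prop :=
  linear f /\ forall a m, f (act a m) = act a (f m).

Definition irreducible (M : amod A) : Prop :=
  (exists m : M, m <> 0) /\
  forall X : set M, submod X -> (forall a m, X m -> X (act a m)) ->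
    X = [set 0] \/ X = setT.

Definition act2 (V W : amod A) (d : tens A A) (x : tens V W) : tens V W :=
  tlift (fun a b => tmap (@act _ _ V a) (@act _ _ W b) x) d.

Section Act2.
Variables V W : amod A.

Let actl (M : amod A) (a : A) : linear (@act _ _ M a) := (act_bilinear M).2 a.

Lemma act2_arg_bilinear (x : tens V W) :
  bilinear2 (fun a b => tmap (@act _ _ V a) (@act _ _ W b) x).
Proof.
have [p1 p2] := pure_bilinear V W.
have sl (c : K) (f g : tens V W -> tens V W) : linear f -> linear g ->
  linear (fun y => c *: f y + g y).
  by move=> lf lg a y z; rewrite lf lg !scalerDr !scalerA addrACA mulrC.
split=> [b|a] c u u'.
- move: x; apply: tens_ext; [exact: tmap_linear|by apply: sl; exact: tmap_linear|].
  by move=> v w; rewrite !tmapE // (act_bilinear V).1 p1.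
- move: x; apply: tens_ext; [exact: tmap_linear|by apply: sl; exact: tmap_linear|].
  by move=> v w; rewrite !tmapE // (act_bilinear W).1 p2.
Qed.

Lemma act2E a b v w : act2 (a \ox b) (v \ox w) = act a v \ox act b w :> tens V W.
Proof. by rewrite /act2 tliftE ?tmapE //; exact: act2_arg_bilinear. Qed.

Lemma act2_bilinear : bilinear2 (@act2 V W).
Proof.
split=> [x|d]; first by apply: tlift_linear; exact: act2_arg_bilinear.
move=> c x y; move: d; apply: tens_ext.
- by apply: tlift_linear; exact: act2_arg_bilinear.
- move=> a d e; rewrite /act2 !(tlift_linear (act2_arg_bilinear _)).
  by rewrite !scalerDr !scalerA addrACA mulrC.
move=> a b; rewrite /act2 !tliftE; try exact: act2_arg_bilinear.
exact: (tmap_linear (@actl V a) (@actl W b)).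
Qed.

Lemma act2_1 (x : tens V W) : act2 (1 \ox 1) x = x.
Proof.
move: x; apply: tens_ext => [||v w]; [exact: act2_bilinear.2|by []|].
by rewrite act2E !act1.
Qed.

Lemma tmul_arg_bilinear (a b : A) :
  bilinear2 (fun a' b' : A => (a * a') \ox (b * b')).
Proof.
have [p1 p2] := pure_bilinear A A.
by split=> [y|y] c u u'; rewrite mulrDr -scalerAr ?p1 ?p2.
Qed.

Lemma tmul_bilinear : bilinear2 (@tmul K A A).
Proof.
have B (e : tens A A) : bilinear2 (fun v w : A =>
  tlift (fun v' w' => (v * v') \ox (w * w')) e).
  have [p1 p2] := pure_bilinear A A.
  have sl (c : K) (f g : tens A A -> tens A A) : linear f -> linear g ->
    linear (fun y => c *: f y + g y).
    by move=> lf lg a y z; rewrite lf lg !scalerDr !scalerA addrACA mulrC.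
  have L a b := tlift_linear (tmul_arg_bilinear a b).
  split=> [y|y] c u u'; move: e; apply: tens_ext=> [||v w]; try exact: L;
    try (by apply: sl; exact: L);
    by rewrite !tliftE; try exact: tmul_arg_bilinear;
       rewrite mulrDl -scalerAl ?p1 ?p2.
split=> [e|d]; first exact: tlift_linear (B e).
move=> c x y; move: d; apply: tens_ext.
- exact: tlift_linear.
- move=> a d e; rewrite /tmul /tmulg !(tlift_linear (B _)).
  by rewrite !scalerDr !scalerA addrACA mulrC.
move=> a b; rewrite /tmul /tmulg !tliftE //.
exact: (tlift_linear (tmul_arg_bilinear a b)).
Qed.

Lemma tmulE (a b a' b' : A) : tmul (a \ox b) (a' \ox b') = (a * a') \ox (b * b').
Proof.
have [t1 t2] := tmul_bilinear.
rewrite /tmul /tmulg tliftE; first by rewrite tliftE //; exact: tmul_arg_bilinear.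
have [p1 p2] := pure_bilinear A A.
split=> [y|y] c u u'; rewrite !tliftE; try exact: tmul_arg_bilinear;
  by rewrite mulrDl -scalerAl ?p1 ?p2.
Qed.

Lemma act2M d e (x : tens V W) : act2 (tmul d e) x = act2 d (act2 e x).
Proof.
have [t1 t2] := tmul_bilinear; have [a1 a2] := act2_bilinear.
move: d; apply: tens_ext => [c u v|c u v|a b]; rewrite ?t1 ?a1 //.
move: e; apply: tens_ext => [c u v|c u v|a' b']; rewrite ?t2 ?a1 ?a2 //.
move: x; apply: tens_ext => [c u v|c u v|v w]; rewrite ?a2 //.
by rewrite tmulE !act2E !actM.
Qed.
End Act2.
End Modules.

(* tlift (fun x y => ...) (hD a) is the Sweedler sum of ... over a_(1) = x and
   a_(2) = y. *)
Record hopf (K : fieldType) := Hopf {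
  hcar :> algType K;
  hD : {linear hcar -> tens hcar hcar};
  he : {linear hcar -> K^o};
  hS : {linear hcar -> hcar};
  hDM : forall a b, hD (a * b) = tmul (hD a) (hD b);
  hD1 : hD 1 = 1 \ox 1;
  heM : forall a b, he (a * b) = he a * he b;
  he1 : he 1 = 1;
  hDA : forall a, tassoc (tmap hD idfun (hD a)) = tmap idfun hD (hD a);
  hel : forall a, tlift (fun x y => he x *: y) (hD a) = a;
  her : forall a, tlift (fun x y => he y *: x) (hD a) = a;
  hSl : forall a, tlift (fun x y => hS x * y) (hD a) = he a *: 1;
  hSr : forall a, tlift (fun x y => x * hS y) (hD a) = he a *: 1
}.

Definition hDop (K : fieldType) (A : hopf K) (a : A) : tens A A := tswap (hD A a).

Section TensorModule.
Variables (K : fieldType) (A : hopf K) (V W : amod A).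

Definition tact (a : A) (x : tens V W) : tens V W := act2 (hD A a) x.

Lemma tact_bilinear : bilinear2 tact.
Proof.
have [a1 a2] := act2_bilinear V W.
by split=> [x|a] c u v; rewrite /tact ?linearP ?a1 ?a2.
Qed.

Lemma tact1 x : tact 1 x = x.
Proof. by rewrite /tact hD1 act2_1. Qed.

Lemma tactM a b x : tact (a * b) x = tact a (tact b x).
Proof. by rewrite /tact hDM act2M. Qed.

Definition tensm : amod A := AMod tact_bilinear tact1 tactM.
End TensorModule.

Section Gradings.
Variable K : fieldType.

Definition gsum (V : lmodType K) (g : int -> set V) (D : set int) : set V :=
  span [set x | exists2 k, D k & g k x].

Definition is_grading (V : lmodType K) (g : int -> set V) : Prop :=
  [/\ forall k, submod (g k),
      forall x, gsum g setT x
    & forall (s : seq int) (f : int -> V), uniq s -> (forall k, g k (f k)) ->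
        \sum_(k <- s) f k = 0 -> forall k, k \in s -> f k = 0].

Definition tgr (V W : lmodType K) (g : int -> set V) (h : int -> set W)
    (k : int) : set (tens V W) :=
  span [set x | exists i j v w, [/\ g i v, h j w, i + j = k & x = v \ox w]].

Definition prodsub (A : algType K) (B C : Type) (f : B -> A) (g : C -> A) : set A :=
  span [set x | exists b c, x = f b * g c].

Definition hopf_sub (A : hopf K) (B : set A) : Prop :=
  [/\ submod B, B 1, forall a b, B a -> B b -> B (a * b),
      forall a, B a -> span [set x | exists b c, [/\ B b, B c & x = b \ox c]] (hD A a)
    & forall a, B a -> B (hS A a)].

Definition graded_sub (A : lmodType K) (g : int -> set A) (B : set A) : Prop :=
  forall (s : seq int) (f : int -> A), uniq s -> (forall k, g k (f k)) ->
    B (\sum_(k <- s) f k) -> forall k, k \in s -> B (f k).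

Definition fin_dim (V : lmodType K) (X : set V) : Prop :=
  exists s : seq V, X `<=` span [set v | v \in s].

Definition fin_gen_alg (A : algType K) : Prop :=
  exists s : seq A, forall X : set A,
    submod X -> X 1 -> (forall a b, X a -> X b -> X (a * b)) ->
    (forall a, a \in s -> X a) -> X = setT.

End Gradings.

(* The subalgebras A_0, A_+, A_- are given by injective algebra morphisms into
   A; A_0 carries its own Hopf structure, for which the inclusion is a Hopf
   morphism. *)
Record polarized (K : fieldType) := Polarized {
  pA :> hopf K;
  pgr : int -> set pA;
  p0 : hopf K;
  pp : algType K;
  pm : algType K;
  i0 : {lrmorphism p0 -> pA};
  ip : {lrmorphism pp -> pA};
  im : {lrmorphism pm -> pA};
  i0_inj : injective i0;
  ip_inj : injective ip;
  im_inj : injective im;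
  pgr_grading : is_grading pgr;
  pgr1 : pgr 0 1;
  pgrM : forall k l a b, pgr k a -> pgr l b -> pgr (k + l) (a * b);
  pgrD : forall k a, pgr k a -> tgr pgr pgr k (hD pA a);
  pgre : forall k a, pgr k a -> k <> 0 -> he pA a = 0;
  pgrS : forall k a, pgr k a -> pgr k (hS pA a);
  i0_graded : graded_sub pgr (range i0);
  ip_graded : graded_sub pgr (range ip);
  im_graded : graded_sub pgr (range im);
  mul_p0m : bijective
    (tlift (fun x t => tlift (fun h y => ip x * i0 h * im y) t)
       : tens pp (tens p0 pm) -> pA);
  mul_m0p : bijective
    (tlift (fun y t => tlift (fun h x => im y * i0 h * ip x) t)
       : tens pm (tens p0 pp) -> pA);
  ip_fin : forall k, fin_dim [set x | pgr k (ip x)];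
  im_fin : forall k, fin_dim [set x | pgr k (im x)];
  i0_deg : forall h, pgr 0 (i0 h);
  ip_deg : forall x, he pA (ip x) = 0 -> gsum pgr [set k | (0 < k)%R] (ip x);
  im_deg : forall y, he pA (im y) = 0 -> gsum pgr [set k | (k < 0)%R] (im y);
  i0_D : forall h, hD pA (i0 h) = tmap i0 i0 (hD p0 h);
  i0_e : forall h, he pA (i0 h) = he p0 h;
  i0_S : forall h, hS pA (i0 h) = i0 (hS p0 h);
  p0_comm : forall g h : p0, g * h = h * g;
  p0_cocomm : forall h, hDop h = hD p0 h;
  p0_fin_gen : fin_gen_alg p0;
  p0p_hopf : hopf_sub (prodsub i0 ip);
  p0m_hopf : hopf_sub (prodsub i0 im)
}.

(* The group T = Spec A_0 sits inside the functions A_0 -> K; its additive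
   structure is convolution. *)
Section Torus.
Variables (K : fieldType) (A : polarized K).

Definition wfun := p0 A -> K.

Definition torus : set wfun :=
  [set l | [/\ linear (l : p0 A -> K^o), l 1 = 1
             & forall g h, l (g * h) = l g * l h]].

Definition wadd (l m : wfun) : wfun :=
  fun h => tlift (fun x y => (l x * m y : K^o)) (hD (p0 A) h).

Definition wopp (l : wfun) : wfun := fun h => l (hS (p0 A) h).

Definition wsub (l m : wfun) : wfun := wadd l (wopp m).

Definition zclosed (Z : set wfun) : Prop :=
  exists I : set (p0 A), Z = [set l | torus l /\ forall h, I h -> l h = 0].

Definition zirreducible (Z : set wfun) : Prop :=
  [/\ zclosed Z, Z !=set0
    & forall X Y, zclosed X -> zclosed Y -> Z = X `|` Y -> Z = X \/ Z = Y].

(* Krull dimension of Z at least n. *)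
Definition dim_ge (Z : set wfun) (n : nat) : Prop :=
  exists F : nat -> set wfun,
    (forall i, (i <= n)%N -> zirreducible (F i) /\ F i `<=` Z) /\
    (forall i, (i < n)%N -> F i `<` F i.+1).

Definition lower_dim (Z : set wfun) : Prop :=
  exists n, dim_ge torus n /\ ~ dim_ge Z n.

Definition generic (P : wfun -> Prop) : Prop :=
  exists Z : nat -> set wfun,
    (forall n, zclosed (Z n) /\ lower_dim (Z n)) /\
    (forall l, torus l -> (forall n, ~ Z n l) -> P l).

Definition wspace (V : amod A) (l : wfun) : set V :=
  [set v | forall h, act (i0 A h) v = l h *: v].

End Torus.

Arguments wspace {K A} V l.

(* Verma modules A (x)_{A_0 X} chi, for X = A_+ or A_-. The algebra A_0 X is
   spanned by the products h x, which act on chi = K by l(h) e(x). *)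
Section Verma.
Variables (K : fieldType) (A : polarized K) (X : algType K) (iX : X -> A).
Variable l : wfun A.

Definition verma_rel : set (tens A K^o) :=
  [set r | exists a h x (c : K^o),
     r = (a * (i0 A h * iX x)) \ox c - a \ox (l h * he A (iX x) * c : K^o)].

Definition verma_car := quot verma_rel.
HB.instance Definition _ := GRing.Lmodule.on verma_car.

Definition verma_act (a : A) : verma_car -> verma_car :=
  qlift (fun t => qproj verma_rel (tmap (fun b : A => a * b) idfun t)).

Definition verma_vec : verma_car := qproj verma_rel (1 \ox 1).

Definition verma_gr (k : int) : set verma_car :=
  [set m | exists a (c : K^o), pgr k a /\ m = qproj verma_rel (a \ox c)].

Lemma lmul_linear (a : A) : linear (fun b : A => a * b).
Proof. by move=> c u v; rewrite mulrDr scalerAr. Qed.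

Lemma id_linear (V : lmodType K) : linear (idfun : V -> V).
Proof. by []. Qed.

Lemma vmap_linear a :
  linear (fun t => qproj verma_rel (tmap (fun b : A => a * b) idfun t)).
Proof.
move=> c u v.
by rewrite (tmap_linear (@lmul_linear a) (@id_linear _)) linearP.
Qed.

Lemma vmap_rel a t : verma_rel t -> mklin (vmap_linear a) t = 0.
Proof.
have L := linearB (mklin (tmap_linear (lmul_linear a) (@id_linear K^o))).
move=> [b [h [x [c ->]]]]; apply/qproj0P; apply: span_gen.
exists (a * b), h, x, c.
by rewrite [LHS]L /= !tmapE ?mulrA //; exact: lmul_linear.
Qed.

Lemma verma_actE a t :
  verma_act a (qproj verma_rel t) = qproj verma_rel (tmap (fun b : A => a * b) idfun t).
Proof. exact: (qliftE (@vmap_rel a)). Qed.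

Lemma verma_act_bilinear : bilinear2 verma_act.
Proof.
split=> [m|a]; last exact: (qlift_linear (@vmap_rel a)).
move=> c a b; have [t ->] := qproj_surj m; rewrite !verma_actE -linearP.
congr (qproj _ _); move: t; have L a := tmap_linear (lmul_linear a) (@id_linear K^o).
apply: tens_ext; [exact: L| |].
  by move=> d u v; rewrite !L !scalerDr !scalerA addrACA mulrC.
move=> v w; rewrite !tmapE; try exact: lmul_linear; try exact: id_linear.
by rewrite mulrDl -scalerAl (pure_bilinear _ _).1.
Qed.

Lemma verma_act1 m : verma_act 1 m = m.
Proof.
have [t ->] := qproj_surj m; rewrite verma_actE; congr (qproj _ _).
move: t; apply: tens_ext => //.
  exact: tmap_linear (lmul_linear 1) (@id_linear K^o).
by move=> v w; rewrite tmapE ?mul1r //; exact: lmul_linear.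
Qed.

Lemma verma_actM a b m : verma_act (a * b) m = verma_act a (verma_act b m).
Proof.
have [t ->] := qproj_surj m; rewrite !verma_actE; congr (qproj _ _).
have L c := tmap_linear (lmul_linear c) (@id_linear K^o).
move: t; apply: tens_ext; [exact: L|exact: comp_linear (L a) (L b)|].
move=> v w; rewrite !tmapE; try exact: lmul_linear; try exact: id_linear.
by rewrite mulrA.
Qed.

Definition verma : amod A := AMod verma_act_bilinear verma_act1 verma_actM.

End Verma.

Arguments verma_gr {K A X} iX l k.
Arguments verma_vec {K A X} iX l.

Definition nondegenerate_polarized (K : fieldType) (A : polarized K) : Prop :=
  generic (fun l : wfun A =>
    irreducible (verma (@ip K A) l) /\ irreducible (verma (@im K A) l)).

Record catO (K : fieldType) (A : polarized K) := CatO {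
  omod :> amod A;
  ogr : int -> set omod;
  ogr_grading : is_grading ogr;
  ogr_act : forall k l a v, pgr k a -> ogr l v -> ogr (k + l) (act a v);
  ogr_bounded : exists N : int, forall (k : int) v, (N < k)%R -> ogr k v -> v = 0;
  o_diag : forall v, span [set u | exists2 l, torus l & wspace omod l u] v
}.

Section Fusion.
Variables (K : fieldType) (A : polarized K).
Implicit Types (V W U : amod A) (l m : wfun A).

Definition Mp l : amod A := verma (@ip K A) l.

Definition vp l : Mp l := verma_vec (@ip K A) l.

(* The functional (v^+_l)^* of the restricted dual, of degree zero. *)
Definition vpdual l : Mp l -> K :=
  xget (fun _ => 0) [set f | [/\ linear (f : Mp l -> K^o), f (vp l) = 1
    & forall k x, k <> 0 -> verma_gr (@ip K A) l k x -> f x = 0]].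

(* <(v^+_m)^* (x) 1, x>. *)
Definition vp_coef m V (x : tens (Mp m) V) : V :=
  tlift (fun y v => vpdual y *: v) x.

Definition is_intertwiner l m V (v : V) (f : Mp l -> tensm (Mp m) V) : Prop :=
  is_hom f /\ vp_coef (f (vp l)) = v.

(* Phi^v_l : M^+_l -> M^+_m (x) V, where m = l - l_v. The target weight is kept
   as a separate argument since M^+_(l-a-b) and M^+_(l-(a+b)) are equal but not
   convertible. *)
Definition Phi l m V (v : V) : Mp l -> tensm (Mp m) V :=
  xget (fun _ => 0) [set f | is_intertwiner v f].

Arguments Phi l m {V} v.

Definition Phi_defined l m V (a : wfun A) : Prop :=
  forall v, wspace V a v -> exists! f : Mp l -> tensm (Mp m) V, is_intertwiner v f.

Arguments Phi_defined l m V a : clear implicits.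

(* Phi^{w,v}_l : M^+_l -> M^+_n (x) (W (x) V), with m = l - l_v and
   n = m - l_w. *)
Definition Phi2 l m n W V (w : W) (v : V) : Mp l -> tensm (Mp n) (tensm W V) :=
  fun x => tassoc (tmap (Phi m n w) idfun (Phi l m v x)).

Arguments Phi2 l m n {W V} w v.

(* All the intertwiners entering the definition of J_{W,V}(l) on
   W[b] (x) V[a] exist and are unique. *)
Definition fusion_defined W V l (b a : wfun A) : Prop :=
  let m := wsub l a in let n := wsub m b in
  [/\ Phi_defined l m V a, Phi_defined m n W b
    & Phi_defined l n (tensm W V) (wadd a b)].

Arguments fusion_defined W V l b a : clear implicits.

(* The fusion matrix J_{W,V}(l). It is determined on W[b] (x) V[a] when l is
   generic with respect to a and b; on the remaining W[b] (x) V[a], where the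
   intertwiners are not defined, it is the identity by convention. *)
Definition is_fusion W V l (J : tens W V -> tens W V) : Prop :=
  linear J /\
  forall (b a : wfun A) (w : W) (v : V), torus b -> torus a ->
    wspace W b w -> wspace V a v ->
    let m := wsub l a in let n := wsub m b in
    (fusion_defined W V l b a ->
       wspace (tensm W V) (wadd a b) (J (w \ox v)) /\
       Phi2 l m n w v = Phi l n (J (w \ox v) : tensm W V)) /\
    (~ fusion_defined W V l b a -> J (w \ox v) = w \ox v).

Arguments is_fusion W V l J : clear implicits.

Definition fusion W V l : tensm W V -> tensm W V :=
  xget (fun x : tens W V => x) [set J | is_fusion W V l J].

(* F(h) acting on the factor X, with h replaced by the weight of U. *)
Definition dyn (X : lmodType K) U (F : wfun A -> X -> X) : tens X U -> tens X U :=
  xget (fun x : tens X U => x) [set G | linear G /\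
    forall c x u, torus c -> wspace U c u -> G (x \ox u) = F c x \ox u].

End Fusion.

Arguments Phi {K A} l m {V} v.
Arguments Phi_defined {K A} l m V a.
Arguments Phi2 {K A} l m n {W V} w v.
Arguments fusion_defined {K A} W V l b a.
Arguments is_fusion {K A} W V l J.
Arguments fusion {K A} W V l x : rename.
Arguments dyn {K A X} U F x : rename.

Section Completion.
Variables (K : fieldType) (A : polarized K).

(* A / I_n, where I_n is spanned by A . A[j], j >= n. *)
Definition igen (n : nat) : set A :=
  [set x | exists a b (j : int), [/\ (n%:Z <= j)%R, pgr j b & x = a * b]].

Definition AI (n : nat) := quot (igen n).
HB.instance Definition _ n := GRing.Lmodule.on (AI n).

Definition AIproj n (a : A) : AI n := qproj (igen n) a.

Definition AItrans m n : AI m -> AI n := qlift (AIproj n).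

Definition proj2 n : tens A A -> tens (AI n) (AI n) := tmap (AIproj n) (AIproj n).

Definition proj3 n : tens A (tens A A) -> tens (AI n) (tens (AI n) (AI n)) :=
  tmap (AIproj n) (proj2 n).

(* Elements of A \hat\otimes A: compatible families in the A/I_n (x) A/I_n, with
   components in finitely many degrees. *)
Record ctens := CTens {
  cfam :> forall n, tens (AI n) (AI n);
  cfam_compat : forall n m, (n <= m)%N ->
    tmap (AItrans n) (AItrans n) (cfam m) = cfam n;
  cfam_degrees : exists D : seq int, forall n,
    exists2 x, gsum (tgr (@pgr K A) (@pgr K A)) [set k | k \in D] x
             & proj2 n x = cfam n
}.

(* Calculations in A \hat\otimes A and A \hat\otimes A \hat\otimes A are done on
   representatives: R is the limit of the lifts crep R n in A (x) A, for the
   linear topology defined by the kernels of proj2 n. As these are left ideals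
   and (ker (proj2 m)) y is contained in ker (proj2 n) for m large, products
   (and images under Delta (x) 1 and 1 (x) Delta) are limits of the products
   (images) of the lifts; lim_eq2 and lim_eq3 express equality of limits. *)
Definition crep (R : ctens) (n : nat) : tens A A :=
  xget 0 [set x | proj2 n x = R n].

Definition lim_eq2 (x y : nat -> tens A A) : Prop :=
  forall n, exists M, forall m, (M <= m)%N -> proj2 n (x m) = proj2 n (y m).

Definition lim_eq3 (x y : nat -> tens A (tens A A)) : Prop :=
  forall n, exists M, forall m, (M <= m)%N -> proj3 n (x m) = proj3 n (y m).

Definition leg12 : tens A A -> tens A (tens A A) :=
  tlift (fun a b => a \ox (b \ox 1)).
Definition leg13 : tens A A -> tens A (tens A A) :=
  tlift (fun a b => a \ox (1 \ox b)).
Definition leg23 : tens A A -> tens A (tens A A) := fun x => 1 \ox x.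

Definition quasitriangular (R : ctens) : Prop :=
  [/\ exists Q : ctens,
        lim_eq2 (fun n => tmul (crep R n) (crep Q n)) (fun=> 1 \ox 1) /\
        lim_eq2 (fun n => tmul (crep Q n) (crep R n)) (fun=> 1 \ox 1),
      forall a : A,
        lim_eq2 (fun n => tmul (crep R n) (hD A a))
                (fun n => tmul (hDop a) (crep R n)),
      lim_eq3 (fun n => tassoc (tmap (hD A) idfun (crep R n)))
              (fun n => tmul3 (leg13 (crep R n)) (leg23 (crep R n)))
    & lim_eq3 (fun n => tmap idfun (hD A) (crep R n))
              (fun n => tmul3 (leg13 (crep R n)) (leg12 (crep R n)))].

(* The action of R on V (x) W for V, W in O: since the gradings are bounded
   above, act2 (crep R n) x does not depend on n for n large. *)
Definition cact (R : ctens) (V W : amod A) (x : tens V W) : tens V W :=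
  xget 0 [set y | exists M, forall n, (M <= n)%N -> act2 (crep R n) x = y].

Arguments cact R V W x : clear implicits.

(* R_{V,W}(l) = J_{V,W}(l)^-1 R^{21} J^{21}_{W,V}(l). *)
Definition exchange (R : ctens) (V W : amod A) (l : wfun A) (x : tensm V W) :
    tensm V W :=
  let J21 (y : tens V W) : tens V W := tswap (fusion W V l (tswap y)) in
  let R21 (y : tens V W) : tens V W := tswap (cact R W V (tswap y)) in
  xget 0 [set z : tensm V W | fusion V W l z = R21 (J21 x)].

End Completion.

Arguments cact {K A} R V W x.
Arguments exchange {K A} R V W l x.

(* All threefold products are identified with (V (x) W) (x) U. *)
Section Legs.
Variables (K : fieldType) (V W U : lmodType K).

Definition perm132 (V W U : lmodType K) (x : tens (tens V W) U) :
    tens (tens V U) W :=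
  tassocV (tmap idfun (@tswap _ W U) (tassoc x)).

Definition op13 (F : tens (tens V U) W -> tens (tens V U) W)
    (x : tens (tens V W) U) : tens (tens V W) U :=
  perm132 (F (perm132 x)).

Definition op23 (F : tens (tens W U) V -> tens (tens W U) V)
    (x : tens (tens V W) U) : tens (tens V W) U :=
  tassocV (tswap (F (tswap (tassoc x)))).

End Legs.

(* When P contains all the weights of V, W and U this is the whole of
   V (x) W (x) U (wtens3_full below). If V, W or U has uncountably many weights,
   there may be no l at which J(l) is defined on the whole tensor product, and
   "generic l" only makes sense for countable sets P of weights. *)
Definition wtens3 (K : fieldType) (A : polarized K) (P : set (wfun A))
    (V W U : amod A) : set (tens (tens V W) U) :=
  span [set x | exists a b c v w u,
    [/\ P a, P b, P c & [/\ wspace V a v, wspace W b w, wspace U c u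
                          & x = v \ox w \ox u]]].

Arguments wtens3 {K A} P V W U x : rename.

Lemma wtens3_full (K : fieldType) (A : polarized K) (P : set (wfun A))
    (V W U : catO A) :
  (forall l, torus l ->
     [\/ exists2 v, wspace V l v & v <> 0, exists2 w, wspace W l w & w <> 0
       | exists2 u, wspace U l u & u <> 0] -> P l) ->
  wtens3 P V W U = setT.
Proof.
move=> hP; apply/seteqP; split=> // x _.
pose S (M : amod A) := [set m : M | exists2 l, P l & wspace M l m].
have sub (M N : lmodType K) (X : set M) (Y : set (tens M N)) (n : N) :
  (forall m, X m -> span Y (m \ox n)) -> forall m, span X m -> span Y (m \ox n).
  by move=> h; apply: span_map h => a u v; exact: (pure_bilinear M N).1.
have sub' (M N : lmodType K) (X : set N) (Y : set (tens M N)) (m : M) :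
  (forall n, X n -> span Y (m \ox n)) -> forall n, span X n -> span Y (m \ox n).
  by move=> h; apply: span_map h => a u v; exact: (pure_bilinear M N).2.
have full (M : catO A) :
    (forall l, torus l -> (exists2 v, wspace M l v & v <> 0) -> P l) ->
    forall m, span (S M) m.
  move=> hM m; apply: (span_min (span_submod (S M)) _ (o_diag m)) => u [l tl lu].
  have [->|/eqP u0] := eqVneq u 0; first exact: span0.
  by apply: span_gen; exists l => //; apply: hM => //; exists u.
have fV : forall m, span (S V) m by apply: full => l tl h; apply: hP => //; constructor 1.
have fW : forall m, span (S W) m by apply: full => l tl h; apply: hP => //; constructor 2.
have fU : forall m, span (S U) m by apply: full => l tl h; apply: hP => //; constructor 3.
have T (M N : lmodType K) (Y : set (tens M N)) :
    (forall m n, span Y (m \ox n)) -> forall t, span Y t.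
  move=> h t; apply: (span_min (span_submod Y) _ (tens_span t)).
  by move=> _ [p _ <-].
apply: T => y u; apply: (sub' _ _ _ _ _ _ u (fU u)) => {}u [c Pc cu].
move: y (tens_span y); apply: sub => _ [[v w] _ <-] /=.
move: w (fW w) => w.
have F : linear (fun w : W => v \ox w \ox u).
  move=> a w1 w2; rewrite (pure_bilinear _ _).2; exact: (pure_bilinear _ _).1.
apply: (span_map F) => {}w [b Pb bw].
have G : linear (fun v : V => v \ox w \ox u).
  move=> a v1 v2; rewrite (pure_bilinear V W).1; exact: (pure_bilinear _ _).1.
move: v {F} (fV v); apply: (span_map G) => v [a Pa av].
by apply: span_gen; exists a, b, c, v, w, u.
Qed.

(* Main.v *)
(* By a duality argument, singular vectors of weight l in M_m (x) V correspond to
   vectors of V[l - m] as soon as M^+_m and M^-_(-m) are irreducible: a singular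
   vector is reconstructed from its coefficient at the highest weight vector by means of
   dual bases of A_+ and M_m with respect to the form v^*(S(a) x). Hence the intertwiners
   exist, are unique, are natural in V, and the two ways of composing three of them agree:
   this is the cocycle condition. The fusion matrix is unipotent for the degree filtration,
   hence invertible.
   For the Yang-Baxter equation let beta = P R be the braiding, a natural A-homomorphism
   satisfying the hexagon identity, and let J(l) on V (x) W (x) U be either side of the
   cocycle condition. By definition J R_dyn = beta J^21, so J(l) carries an exchange matrix
   in two adjacent factors (with l shifted when these are the first two) to the
   corresponding braiding; both sides of the equation become the two sides of the braid relation, which
   follows from the hexagon and naturality, and J(l) is injective. *)

Require Import Defs.
From mathcomp Require Import all_boot all_order all_algebra.
From mathcomp Require Import boolp classical_sets cardinality reals.
From mathcomp Require Import complex zify.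
Import Defs.

Set Implicit Arguments.
Unset Strict Implicit.
Unset Printing Implicit Defensive.

Import Order.TTheory GRing.Theory Num.Theory.
Local Open Scope ring_scope.
Local Open Scope classical_set_scope.

(** * Linear algebra *)

(** The antipode preserves A_0 A_+ but not necessarily A_+, and this shapes the duality argument.
    Under right multiplication of a by A_0 and A_- the form v^*(S(a) x) behaves like a functional on
    M^-_(-m), which is why that module must be irreducible; this controls the form on the side of
    A_+ only. On the side of M_m the plain form v^*(a x) is used, controlled by M^+_m, and a
    dimension count in each degree combines the two. Moreover dual bases test A_+, while singularity
    concerns all of A_0 A_+; the gap is closed by showing that A_+ also spans A_0 A_+ modulo right
    multiples of the kernel of a character of A_0. The other obstacle is the exceptional parameters.
    The shifts l - c run over all weights c of a module, so J must be bijective at every point of T.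
    The identities, however, are proved only where the weights that occur satisfy the irreducibility
    conditions, and both J and the universal R-matrix leave given weight spaces. Since genericity
    absorbs countably many conditions only, the given weights are enlarged to a countable set whose
    weight vectors span a submodule. *)

Section LinearCalculus.
Variable K : fieldType.
Implicit Types U V W X Y Z : lmodType K.

Lemma lin_id V : linear (fun x : V => x).
Proof. by []. Qed.

Lemma lin_comp U V W (g : V -> W) (f : U -> V) :
  linear g -> linear f -> linear (fun x => g (f x)).
Proof. by move=> lg lf a x y; rewrite lf lg. Qed.

Lemma bil_l U V W X (g : V -> W -> X) (f : U -> V) w :
  bilinear2 g -> linear f -> linear (fun x => g (f x) w).
Proof. by move=> [h _] lf a x y; rewrite lf h. Qed.

Lemma bil_r U V W X (g : V -> W -> X) (f : U -> W) v :
  bilinear2 g -> linear f -> linear (fun x => g v (f x)).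
Proof. by move=> [_ h] lf a x y; rewrite lf h. Qed.

Lemma fam_l (T : Type) U V W (g : V -> T -> W) (f : U -> V) t :
  (forall t, linear (fun x => g x t)) -> linear f -> linear (fun x => g (f x) t).
Proof. by move=> h lf a x y; rewrite lf h. Qed.

Lemma fam_r (T : Type) U V W (g : T -> V -> W) (f : U -> V) t :
  (forall t, linear (g t)) -> linear f -> linear (fun x => g t (f x)).
Proof. by move=> h lf a x y; rewrite lf h. Qed.

Lemma fam1 (S T : Type) U V W (g : V -> S -> T -> W) (f : U -> V) s t :
  (forall s t, linear (fun x => g x s t)) -> linear f -> linear (fun x => g (f x) s t).
Proof. by move=> h lf a x y; rewrite lf h. Qed.

Lemma fam2 (S T : Type) U V W (g : S -> V -> T -> W) (f : U -> V) s t :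
  (forall s t, linear (fun x => g s x t)) -> linear f -> linear (fun x => g s (f x) t).
Proof. by move=> h lf a x y; rewrite lf h. Qed.

Lemma fam3 (S T : Type) U V W (g : S -> T -> V -> W) (f : U -> V) s t :
  (forall s t, linear (fun x => g s t x)) -> linear f -> linear (fun x => g s t (f x)).
Proof. by move=> h lf a x y; rewrite lf h. Qed.

Lemma lin_bundled U V W (g : {linear V -> W}) (f : U -> V) :
  linear f -> linear (fun x => g (f x)).
Proof. by move=> lf a x y; rewrite lf linearP. Qed.

Lemma lin0 V W : linear (fun _ : V => 0 : W).
Proof. by move=> a x y; rewrite scaler0 addr0. Qed.

Lemma lin_add V W (f g : V -> W) :
  linear f -> linear g -> linear (fun x => f x + g x).
Proof. by move=> lf lg a x y; rewrite lf lg scalerDr addrACA. Qed.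

Lemma lin_opp V W (f : V -> W) : linear f -> linear (fun x => - f x).
Proof. by move=> lf a x y; rewrite lf opprD scalerN. Qed.

Lemma lin_sum V W (I : Type) (r : seq I) (P : pred I) (F : I -> V -> W) :
  (forall i, linear (F i)) -> linear (fun x => \sum_(i <- r | P i) F i x).
Proof.
move=> lF a x y; rewrite scaler_sumr -big_split /=.
by apply: eq_bigr => i _; rewrite lF.
Qed.

Lemma lin_scaler V W (c : K) (f : V -> W) :
  linear f -> linear (fun x => c *: f x).
Proof. by move=> lf a x y; rewrite lf scalerDr !scalerA mulrC. Qed.

Lemma lin_scalel V W (f : V -> K) (w : W) :
  linear (f : V -> K^o) -> linear (fun x => f x *: w).
Proof. by move=> lf a x y; rewrite lf scalerDl -scalerA. Qed.

Lemma lin_mulK V (c : K) (f : V -> K) :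
  linear (f : V -> K^o) -> linear (fun x => f x * c : K^o).
Proof. by move=> lf a x y; rewrite lf mulrDl -mulrA. Qed.

Lemma lin_mulKr V (c : K) (f : V -> K) :
  linear (f : V -> K^o) -> linear (fun x => c * f x : K^o).
Proof. by move=> lf a x y; rewrite lf mulrDr mulrCA. Qed.

Lemma lin_mull V (A : algType K) (c : A) (f : V -> A) :
  linear f -> linear (fun x => f x * c).
Proof. by move=> lf a x y; rewrite lf mulrDl -scalerAl. Qed.

Lemma lin_mulr V (A : algType K) (c : A) (f : V -> A) :
  linear f -> linear (fun x => c * f x).
Proof. by move=> lf a x y; rewrite lf mulrDr -scalerAr. Qed.

Lemma lin_purel V W X (w : W) (f : X -> V) :
  linear f -> linear (fun x => f x \ox w).
Proof. by move=> lf a x y; rewrite lf (pure_bilinear V W).1. Qed.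

Lemma lin_purer V W X (v : V) (f : X -> W) :
  linear f -> linear (fun x => v \ox f x).
Proof. by move=> lf a x y; rewrite lf (pure_bilinear V W).2. Qed.

Lemma lin_tlift V W X Y (F : V -> W -> X) (f : Y -> tens V W) :
  bilinear2 F -> linear f -> linear (fun x => tlift F (f x)).
Proof. by move=> bF lf; apply: lin_comp => //; exact: tlift_linear. Qed.

Lemma lin_tlift_fun V W X Y (F : Y -> V -> W -> X) (t : tens V W) :
  (forall v w, linear (fun y => F y v w)) -> (forall y, bilinear2 (F y)) ->
  linear (fun y => tlift (F y) t).
Proof.
move=> lF bF a x y; move: t; apply: tens_ext.
- exact: tlift_linear.
- by apply: lin_add; [apply: lin_scaler|]; exact: tlift_linear.
- by move=> v w; rewrite !tliftE // lF.
Qed.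

Lemma lin_tmap V W V' W' X (f : V -> V') (g : W -> W') (h : X -> tens V W) :
  linear f -> linear g -> linear h -> linear (fun x => tmap f g (h x)).
Proof. by move=> lf lg; apply: lin_comp; exact: tmap_linear. Qed.

Lemma bil_mk V W X (f : V -> W -> X) :
  (forall w, linear (fun v => f v w)) -> (forall v, linear (fun w => f v w)) ->
  bilinear2 f.
Proof. by move=> h1 h2; split. Qed.

Lemma tswap_linear V W : linear (@tswap K V W).
Proof.
apply: tlift_linear; apply: bil_mk => w; first exact: lin_purer.
exact: lin_purel.
Qed.

Lemma lin_tswap V W X (h : X -> tens V W) :
  linear h -> linear (fun x => tswap (h x)).
Proof. by apply: lin_comp; exact: tswap_linear. Qed.

Lemma bil_assoc U V W : bilinear2 (fun (x : tens U V) (w : W) =>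
  tlift (fun u v => u \ox (v \ox w)) x).
Proof.
have b w : bilinear2 (fun (u : U) (v : V) => u \ox (v \ox w)).
  by apply: bil_mk => ?; [apply: lin_purel|apply: lin_purer; apply: lin_purel].
apply: bil_mk => w; first exact: tlift_linear.
apply: lin_tlift_fun => // u v; do 2 apply: lin_purer; exact: lin_id.
Qed.

Lemma tassoc_linear U V W : linear (@tassoc K U V W).
Proof. exact: tlift_linear (bil_assoc U V W). Qed.

Lemma tassocE U V W (u : U) (v : V) (w : W) :
  tassoc (u \ox v \ox w) = u \ox (v \ox w).
Proof.
rewrite /tassoc tliftE ?tliftE //; last exact: bil_assoc.
by apply: bil_mk => ?; [apply: lin_purel|apply: lin_purer; apply: lin_purel].
Qed.

Lemma bil_assocV U V W : bilinear2 (fun (u : U) (y : tens V W) =>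
  tlift (fun v w => u \ox v \ox w) y).
Proof.
have b u : bilinear2 (fun (v : V) (w : W) => u \ox v \ox w).
  by apply: bil_mk => ?; [apply: lin_purel; apply: lin_purer|apply: lin_purer].
apply: bil_mk => w; last exact: tlift_linear.
apply: lin_tlift_fun => // u v; do 2 apply: lin_purel; exact: lin_id.
Qed.

Lemma tassocV_linear U V W : linear (@tassocV K U V W).
Proof. exact: tlift_linear (bil_assocV U V W). Qed.

Lemma tassocVE U V W (u : U) (v : V) (w : W) :
  tassocV (u \ox (v \ox w)) = u \ox v \ox w.
Proof.
rewrite /tassocV tliftE ?tliftE //; last exact: bil_assocV.
by apply: bil_mk => ?; [apply: lin_purel; apply: lin_purer|apply: lin_purer].
Qed.

Lemma lin_tassoc U V W X (h : X -> tens (tens U V) W) :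
  linear h -> linear (fun x => tassoc (h x)).
Proof. by apply: lin_comp; exact: tassoc_linear. Qed.

Lemma lin_tassocV U V W X (h : X -> tens U (tens V W)) :
  linear h -> linear (fun x => tassocV (h x)).
Proof. by apply: lin_comp; exact: tassocV_linear. Qed.

Lemma lin_actl (A : algType K) (M : amod A) X (m : M) (f : X -> A) :
  linear f -> linear (fun x => act (f x) m).
Proof. exact: (lin_comp ((act_bilinear M).1 m)). Qed.

Lemma lin_actr (A : algType K) (M : amod A) X (a : A) (f : X -> M) :
  linear f -> linear (fun x => act a (f x)).
Proof. exact: (lin_comp ((act_bilinear M).2 a)). Qed.

Lemma lin_act2l (A : algType K) (M N : amod A) X (m : tens M N)
    (f : X -> tens A A) :
  linear f -> linear (fun x => act2 (f x) m).
Proof. exact: (lin_comp ((act2_bilinear M N).1 m)). Qed.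

Lemma lin_act2r (A : algType K) (M N : amod A) X (a : tens A A)
    (f : X -> tens M N) :
  linear f -> linear (fun x => act2 a (f x)).
Proof. exact: (lin_comp ((act2_bilinear M N).2 a)). Qed.

Lemma linear_mk0 V W (f : V -> W) : linear f -> f 0 = 0.
Proof. by move=> lf; exact: linear0 (mklin lf). Qed.

Lemma linear_mkZ V W (f : V -> W) a x : linear f -> f (a *: x) = a *: f x.
Proof. by move=> lf; exact: linearZ_LR (mklin lf) _ _. Qed.

Lemma linear_mkD V W (f : V -> W) x y : linear f -> f (x + y) = f x + f y.
Proof. by move=> lf; exact: linearD (mklin lf) _ _. Qed.

Lemma linear_mkB V W (f : V -> W) x y : linear f -> f (x - y) = f x - f y.
Proof. by move=> lf; exact: linearB (mklin lf) _ _. Qed.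

Lemma linear_mksum V W (f : V -> W) (I : Type) (r : seq I) (P : pred I) F :
  linear f -> f (\sum_(i <- r | P i) F i) = \sum_(i <- r | P i) f (F i).
Proof. by move=> lf; exact: linear_sum (mklin lf) _ _ _ _. Qed.

Lemma tlift_ext V W X (F G : V -> W -> X) t :
  bilinear2 F -> bilinear2 G -> (forall v w, F v w = G v w) -> tlift F t = tlift G t.
Proof.
move=> bF bG FG; move: t; apply: tens_ext; [exact: tlift_linear..|].
by move=> v w; rewrite !tliftE.
Qed.

Lemma tlift_comp V W X Y (g : X -> Y) (F : V -> W -> X) t :
  linear g -> bilinear2 F -> g (tlift F t) = tlift (fun v w => g (F v w)) t.
Proof.
move=> lg bF; have bG : bilinear2 (fun v w => g (F v w)).
  by split=> [w|v] a x y; rewrite ?bF.1 ?bF.2 lg.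
move: t; apply: tens_ext; [|exact: tlift_linear|by move=> v w; rewrite !tliftE].
by apply: lin_comp => //; exact: tlift_linear.
Qed.

Lemma tlift_pure V W (t : tens V W) : tlift (fun v w => v \ox w) t = t.
Proof.
move: t; apply: tens_ext => //; first by apply: tlift_linear; exact: pure_bilinear.
by move=> v w; rewrite tliftE //; exact: pure_bilinear.
Qed.

Lemma span_sub V (S : set V) (X : set V) :
  submod X -> (forall x, S x -> X x) -> forall x, span S x -> X x.
Proof. by move=> sX SX x; apply: span_min. Qed.

Lemma span_mono V (S S' : set V) :
  (forall x, S x -> span S' x) -> forall x, span S x -> span S' x.
Proof. by move=> h; apply: span_sub => //; exact: span_submod. Qed.

Lemma submod_eq V W (f g : V -> W) : linear f -> linear g -> submod [set x | f x = g x].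
Proof.
move=> lf lg; split=> [|a x y /= e1 e2]; first by rewrite /= !linear_mk0.
by rewrite lf lg e1 e2.
Qed.

Lemma submod_pre V W (f : V -> W) (X : set W) :
  linear f -> submod X -> submod [set x | X (f x)].
Proof.
move=> lf sX; split=> [|a x y /= e1 e2]; first by rewrite /= linear_mk0 //; exact: sX.1.
by rewrite /= lf; exact: sX.2.
Qed.

Lemma span_eq V W (S : set V) (f g : V -> W) : linear f -> linear g ->
  (forall x, S x -> f x = g x) -> forall x, span S x -> f x = g x.
Proof. by move=> lf lg h; apply: span_sub h; exact: submod_eq. Qed.

Lemma submod_sum V (X : set V) (I : Type) (r : seq I) (P : pred I) F :
  submod X -> (forall i, P i -> X (F i)) -> X (\sum_(i <- r | P i) F i).
Proof.
move=> sX h; elim/big_rec: _ => [|i x Pi Xx]; first exact: sX.1.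
by rewrite -[F i]scale1r; apply: sX.2 => //; exact: h.
Qed.

Lemma submod_sum_seq V (X : set V) (I : eqType) (r : seq I) F :
  submod X -> (forall i, i \in r -> X (F i)) -> X (\sum_(i <- r) F i).
Proof.
by move=> sX h; rewrite big_seq; apply: submod_sum.
Qed.

Lemma submodZ V (X : set V) a x : submod X -> X x -> X (a *: x).
Proof. by move=> sX Xx; rewrite -[_ *: _]addr0; apply: sX.2 => //; exact: sX.1. Qed.

Lemma submodD V (X : set V) x y : submod X -> X x -> X y -> X (x + y).
Proof. by move=> sX Xx; rewrite -[x]scale1r; exact: sX.2. Qed.

Lemma submodN V (X : set V) x : submod X -> X x -> X (- x).
Proof. by move=> sX; rewrite -scaleN1r; exact: submodZ. Qed.

Lemma submodB V (X : set V) x y : submod X -> X x -> X y -> X (x - y).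
Proof. by move=> sX Xx Xy; apply: submodD => //; exact: submodN. Qed.

Lemma submod0 V : submod [set 0 : V].
Proof. by split=> // a x y /= -> ->; rewrite scaler0 addr0. Qed.

Lemma span_pure2 V W (S : set V) (S' : set W) (X : set (tens V W)) :
  submod X -> (forall v w, S v -> S' w -> X (v \ox w)) ->
  forall v w, span S v -> span S' w -> X (v \ox w).
Proof.
move=> sX h v w Sv Sw; move: v Sv; apply: span_sub => [|v Sv].
  by apply: submod_pre => //; apply: lin_purel.
by move: w Sw; apply: span_sub => [|w]; [apply: submod_pre => //; apply: lin_purer|apply: h].
Qed.

Lemma tens_ind V W (X : set (tens V W)) :
  submod X -> (forall v w, X (v \ox w)) -> forall t, X t.
Proof.
move=> sX h t; move: (tens_span t); apply: span_sub => // _ [p _ <-].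
exact: h.
Qed.

Lemma tlift_span V W X (F G : V -> W -> X) (S : set V) (S' : set W) t :
  bilinear2 F -> bilinear2 G ->
  span [set x | exists v w, [/\ S v, S' w & x = v \ox w]] t ->
  (forall v w, S v -> S' w -> F v w = G v w) -> tlift F t = tlift G t.
Proof.
move=> bF bG St FG; move: t St; apply: span_eq; [exact: tlift_linear..|].
by move=> _ [v [w [Sv Sw ->]]]; rewrite !tliftE // FG.
Qed.

Lemma tlift_swap V W X (F : V -> W -> X) t : bilinear2 F ->
  tlift F (tswap t) = tlift (fun w v => F v w) t.
Proof.
move=> bF; have bG : bilinear2 (fun w v => F v w) by split; [exact: bF.2|exact: bF.1].
move: t; apply: tens_ext; [|exact: tlift_linear|by move=> w v; rewrite tswapE !tliftE].
by apply: lin_comp; [exact: tlift_linear|exact: tswap_linear].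
Qed.

Lemma tlift_tmap V W V' W' X (F : V' -> W' -> X) (f : V -> V') (g : W -> W') t :
  bilinear2 F -> linear f -> linear g ->
  tlift F (tmap f g t) = tlift (fun v w => F (f v) (g w)) t.
Proof.
move=> bF lf lg; have bG : bilinear2 (fun v w => F (f v) (g w)).
  by split=> [w|v] a x y; rewrite ?lf ?lg ?bF.1 ?bF.2.
move: t; apply: tens_ext; [|exact: tlift_linear|by move=> w v; rewrite tmapE // !tliftE].
by apply: lin_comp; [exact: tlift_linear|exact: tmap_linear].
Qed.

End LinearCalculus.

Definition eps (K : fieldType) (A : hopf K) (a : A) : K := he A a.

Lemma eps_linear (K : fieldType) (A : hopf K) : linear (@eps K A : A -> K^o).
Proof. exact: (linearP (he A)). Qed.

Lemma epsM (K : fieldType) (A : hopf K) (a b : A) : eps (a * b) = eps a * eps b.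
Proof. exact: heM. Qed.

Lemma eps1 (K : fieldType) (A : hopf K) : eps (1 : A) = 1.
Proof. exact: he1. Qed.

Lemma lrmorph_linear (K : fieldType) (A B : algType K) (f : {lrmorphism A -> B}) :
  linear f.
Proof. exact: linearP. Qed.

(** A bilinear operation applied to two functions of x is linear in x when one of them is constant;
    this selects the other one. *)
Ltac lin_side l cst dep :=
  lazymatch l with
  | fun _ => ?c => cst tt
  | _ => dep tt
  end.

Ltac lin1 :=
  lazymatch goal with
  | |- forall _, _ => intro
  | |- bilinear2 (fun _ _ => _) => apply: bil_mk
  | |- bilinear2 _ => first [assumption | apply: bil_mk]
  | |- @GRing.linear_for ?R ?U ?V ?s ?f =>
    first [ assumption |
    lazymatch f with
    | fun x => x => exact: lin_id
    | fun _ => @Algebra.zero _ => exact: lin0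
    | idfun => exact: lin_id
    | fun x => @GRing.add _ _ _ => apply: lin_add
    | fun x => @GRing.opp _ _ => apply: lin_opp
    | fun x => @GRing.scale _ _ (@?l x) (@?r x) =>
      lin_side l ltac:(fun _ => apply: lin_scaler) ltac:(fun _ => apply: lin_scalel)
    | fun x => @GRing.mul _ (@?l x) (@?r x) =>
      lin_side l ltac:(fun _ => first [apply: lin_mulr | apply: lin_mulKr])
                 ltac:(fun _ => first [apply: lin_mull | apply: lin_mulK])
    | fun x => @pure _ _ _ (@?l x) (@?r x) =>
      lin_side l ltac:(fun _ => apply: lin_purer) ltac:(fun _ => apply: lin_purel)
    | fun x => @act _ _ ?M x ?w => exact: ((act_bilinear M).1 w)
    | fun x => @act _ _ ?M ?w x => exact: ((act_bilinear M).2 w)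
    | fun x => @act _ _ ?M (@?l x) (@?r x) =>
      lin_side l ltac:(fun _ => apply: (lin_actr (M := M)))
                 ltac:(fun _ => apply: (lin_actl (M := M)))
    | fun x => @act2 _ _ _ _ (@?l x) (@?r x) =>
      lin_side l ltac:(fun _ => apply: lin_act2r) ltac:(fun _ => apply: lin_act2l)
    | fun x => @GRing.Linear.sort _ _ _ _ ?g x => exact: (linearP g)
    | fun x => @GRing.Linear.sort _ _ _ _ ?g _ => apply: (lin_comp (linearP g))
    | fun x => @GRing.LRMorphism.sort _ _ _ _ ?g x => exact: (lrmorph_linear g)
    | fun x => @GRing.LRMorphism.sort _ _ _ _ ?g _ => apply: (lin_comp (lrmorph_linear g))
    | @GRing.LRMorphism.sort _ _ _ _ ?g => exact: (lrmorph_linear g)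
    | fun x => @eps _ _ x => exact: eps_linear
    | fun x => @eps _ ?A _ => apply: (lin_comp (eps_linear A))
    | @eps _ _ => exact: eps_linear
    | @GRing.Linear.sort _ _ _ _ ?g => exact: (linearP g)
    | fun x => @tlift _ _ _ _ _ x => apply: tlift_linear
    | fun x => @tmap _ _ _ _ _ _ _ x => apply: tmap_linear
    | fun x => @tassoc _ _ _ _ x => exact: tassoc_linear
    | fun x => @tassocV _ _ _ _ x => exact: tassocV_linear
    | fun x => @tswap _ _ _ x => exact: tswap_linear
    | fun x => @tlift _ _ _ _ (@?l x) (@?r x) =>
      lin_side l ltac:(fun _ => apply: lin_tlift) ltac:(fun _ => apply: lin_tlift_fun)
    | fun x => @tassoc _ _ _ _ _ => apply: lin_tassoc
    | fun x => @tassocV _ _ _ _ _ => apply: lin_tassocV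
    | fun x => @tswap _ _ _ _ => apply: lin_tswap
    | fun x => @tmap _ _ _ _ _ _ _ _ => apply: lin_tmap
    | @pure _ _ _ _ => exact: (pure_bilinear _ _).2
    | @GRing.mul _ ?c => first [exact: (lin_mulr c (@lin_id _ _)) | exact: (lin_mulKr c (@lin_id _ _))]
    | @GRing.scale _ _ ?c => exact: (lin_scaler c (@lin_id _ _))
    | @act _ _ ?M ?w => exact: ((act_bilinear M).2 w)
    | @act2 _ _ _ _ _ => exact: (act2_bilinear _ _).2
    | @tassoc _ _ _ _ => exact: tassoc_linear
    | @tassocV _ _ _ _ => exact: tassocV_linear
    | @tswap _ _ _ => exact: tswap_linear
    | @tmap _ _ _ _ _ _ _ => apply: tmap_linear
    | @tlift _ _ _ _ _ => apply: tlift_linear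
    end
    | match goal with
      | H : bilinear2 ?g |- _ => solve
         [ exact: H.1 | exact: H.2 | apply: (bil_l _ H); repeat lin1
         | apply: (bil_r _ H); repeat lin1]
      | H : @GRing.linear_for _ _ _ _ ?g |- _ => solve [exact: H | apply: (lin_comp H); repeat lin1]
      | H : forall _, @GRing.linear_for _ _ _ _ _ |- _ =>
         solve [exact: H | apply: (fam_l _ H); repeat lin1 | apply: (fam_r _ H); repeat lin1]
      | H : forall _ _, @GRing.linear_for _ _ _ _ _ |- _ =>
         solve [exact: H | apply: (fam1 _ _ H); repeat lin1
               | apply: (fam2 _ _ H); repeat lin1| apply: (fam3 _ _ H); repeat lin1]
      | H : forall _, bilinear2 _ |- _ => solve [exact: (H _).1 | exact: (H _).2
         | apply: (bil_l _ (H _)); repeat lin1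
         | apply: (bil_r _ (H _)); repeat lin1]
      end
    | apply: lin_bundled | apply: lin_sum ]
  end.
Ltac lin := solve [repeat lin1].

(** * Direct sum decompositions *)

Section DirectSums.
Variable K : fieldType.

(** Decompositions carry their projections, so that they can be tensored and coarsened without
    arguing about independence. The index set is infinite in both applications: degrees, and all
    functions on A_0 for weights. *)
Definition dsum_proj (I : eqType) (V : lmodType K) (g : I -> set V)
    (pr : I -> V -> V) : Prop :=
  [/\ forall i, submod (g i), forall x, span [set v | exists i, g i v] x,
      forall i, linear (pr i), forall i v, g i v -> pr i v = v
    & forall i j v, i <> j -> g j v -> pr i v = 0].

Definition dsum (I : eqType) (V : lmodType K) (g : I -> set V) : Prop :=
  exists pr, dsum_proj g pr.

Lemma dsum_prP (I : eqType) (V : lmodType K) (g : I -> set V) pr i v :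
  dsum_proj g pr -> g i (pr i v).
Proof.
move=> [sg sp lp p1 p0]; move: v (sp v); apply: span_sub.
  by apply: (submod_pre (f := pr i)).
move=> x [j gx] /=; have [->|/eqP ij] := eqVneq i j; first by rewrite p1.
by rewrite (p0 _ _ _ ij gx); exact: (sg i).1.
Qed.

Lemma dsum_supp (I : eqType) (V : lmodType K) (g : I -> set V) pr v :
  dsum_proj g pr -> exists s : seq I, uniq s /\ forall i, i \notin s -> pr i v = 0.
Proof.
move=> [sg sp lp p1 p0]; move: v (sp v); apply: span_sub.
  split=> [|a x y [s [us hs]] [t [ut ht]]].
    by exists [::]; split=> // i _; exact: (linear_mk0 (lp i)).
  exists (undup (s ++ t)); split=> [|i]; first exact: undup_uniq.
  rewrite mem_undup mem_cat negb_or => /andP[/hs e1 /ht e2].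
  by rewrite lp e1 e2 scaler0 addr0.
move=> x [j gx]; exists [:: j]; split=> // i; rewrite inE => /eqP ij.
exact: p0 gx.
Qed.

Lemma sum_supp (I : eqType) (V : lmodType K) (f : I -> V) (s t : seq I) :
  uniq s -> uniq t -> (forall i, i \notin s -> f i = 0) ->
  (forall i, i \notin t -> f i = 0) -> \sum_(i <- s) f i = \sum_(i <- t) f i.
Proof.
have sub s' t' : uniq s' -> uniq t' -> {subset s' <= t'} ->
    (forall i, i \notin s' -> f i = 0) -> \sum_(i <- s') f i = \sum_(i <- t') f i.
  move=> us ut st hs.
  rewrite [RHS](bigID (mem s')) /= [X in _ + X]big1 ?addr0; last by move=> i /hs.
  rewrite -[RHS]big_filter; apply: perm_big; apply: uniq_perm => //.
    exact: filter_uniq.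
  move=> i; rewrite mem_filter andb_idr //; exact: st.
move=> us ut hs ht; transitivity (\sum_(i <- undup (s ++ t)) f i).
  apply: sub => //; first exact: undup_uniq.
  by move=> i si; rewrite mem_undup mem_cat si.
symmetry; apply: sub => //; first exact: undup_uniq.
by move=> i ti; rewrite mem_undup mem_cat ti orbT.
Qed.

Lemma dsum_sum (I : eqType) (V : lmodType K) (g : I -> set V) pr v s :
  dsum_proj g pr -> uniq s -> (forall i, i \notin s -> pr i v = 0) ->
  v = \sum_(i <- s) pr i v.
Proof.
move=> H; have [sg sp lp p1 p0] := H; move=> us hs.
suff E : exists t, uniq t /\ (forall i, i \notin t -> pr i v = 0) /\
    v = \sum_(i <- t) pr i v.
  have [t [ut [ht e]]] := E; rewrite {1}e; exact: sum_supp.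
move: {us hs} v (sp v); apply: span_sub.
  split=> [|a x y [s1 [us1 [hs1 e1]]] [s2 [us2 [hs2 e2]]]].
    exists [::]; split=> //; rewrite big_nil; split=> // i _; exact: (linear_mk0 (lp i)).
  have hx i : i \notin undup (s1 ++ s2) -> pr i x = 0 /\ pr i y = 0.
    by rewrite mem_undup mem_cat negb_or => /andP[/hs1 -> /hs2 ->].
  exists (undup (s1 ++ s2)); split; first exact: undup_uniq.
  split=> [i /hx[ex ey]|]; first by rewrite lp ex ey scaler0 addr0.
  rewrite (eq_bigr (fun i => a *: pr i x + pr i y)); last by move=> i _; rewrite lp.
  rewrite big_split -scaler_sumr /=; congr (_ *: _ + _).
    by rewrite {1}e1; apply: sum_supp => //; [exact: undup_uniq|move=> i /hx[]].
  by rewrite {1}e2; apply: sum_supp => //; [exact: undup_uniq|move=> i /hx[]].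
move=> x [j gx]; exists [:: j]; split=> //; split=> [i|].
  by rewrite inE => /eqP ij; exact: p0 gx.
by rewrite big_seq1 p1.
Qed.

(** Each vector has only finitely many nonzero components, so the sum of the f i over the components
    makes sense; additivity is checked on a common finite support. *)
Lemma dsum_ext (I : eqType) (V W : lmodType K) (g : I -> set V) (f : I -> V -> W) :
  dsum g -> (forall i, linear (f i)) ->
  exists2 F : V -> W, linear F & forall i v, g i v -> F v = f i v.
Proof.
move=> [pr H] lf; have [sg sp lp p1 p0] := H.
have /choice [s hs] v := dsum_supp v H.
have f0 i x : pr i x = 0 -> f i (pr i x) = 0 by move=> ->; exact: (linear_mk0 (lf i)).
exists (fun v => \sum_(i <- s v) f i (pr i v)) => [a x y|j v gv].
  pose t := undup (s (a *: x + y) ++ s x ++ s y).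
  have ut : uniq t by exact: undup_uniq.
  have ht i : i \notin t ->
      [/\ pr i (a *: x + y) = 0, pr i x = 0 & pr i y = 0].
    rewrite mem_undup !mem_cat !negb_or => /and3P[h1 h2 h3].
    by split; apply: (hs _).2.
  rewrite scaler_sumr !(@sum_supp _ _ _ (s _) t) ?(hs _).1 //;
    try (by move=> i /ht[h1 h2 h3]; rewrite f0 // scaler0);
    try (by move=> i /(hs _).2 h1; rewrite f0 // scaler0).
  by rewrite -big_split; apply: eq_bigr => i _; rewrite /= lp lf.
rewrite (@sum_supp _ _ _ _ [:: j]) ?(hs _).1 ?big_seq1 ?p1 //.
- by move=> i /(hs _).2 h; rewrite f0.
- by move=> i; rewrite inE => /eqP ij; rewrite f0 // (p0 _ _ _ ij gv).
Qed.

Lemma dsum_indep (I : eqType) (V : lmodType K) (g : I -> set V) (s : seq I) f :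
  dsum g -> uniq s -> (forall i, g i (f i)) -> \sum_(i <- s) f i = 0 ->
  forall i, i \in s -> f i = 0.
Proof.
move=> [pr [sg sp lp p1 p0]] us gf e i si.
have := congr1 (pr i) e; rewrite (linear_mksum _ _ _ (lp i)) (linear_mk0 (lp i)) /= (bigD1_seq i) //=.
rewrite p1 // big1 ?addr0 // => j ji; apply: p0 (gf j).
by apply/eqP; rewrite eq_sym.
Qed.

Lemma dsum_of_indep (I : eqType) (V : lmodType K) (g : I -> set V) :
  (forall i, submod (g i)) -> (forall x, span [set v | exists i, g i v] x) ->
  (forall (s : seq I) f, uniq s -> (forall i, g i (f i)) ->
     \sum_(i <- s) f i = 0 -> forall i, i \in s -> f i = 0) -> dsum g.
Proof.
move=> sg sp ind.
(* [dec v F] says that F is a finitely supported family of components with sum v. The relation is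
   linear and, by independence, single valued, so choosing F for each v yields linear
   projections. *)
pose dec v F := (forall i, g i (F i)) /\ exists s : seq I,
  [/\ uniq s, forall i, i \notin s -> F i = 0 & v = \sum_(i <- s) F i].
have dec_lin a x y F G : dec x F -> dec y G ->
    dec (a *: x + y) (fun i => a *: F i + G i).
  move=> [gF [s [us hs es]]] [gG [t [ut ht et]]]; split=> [i|]; first exact: (sg i).2.
  have u' : uniq (undup (s ++ t)) := undup_uniq _.
  have h' i : i \notin undup (s ++ t) -> F i = 0 /\ G i = 0.
    by rewrite mem_undup mem_cat negb_or => /andP[/hs -> /ht ->].
  exists (undup (s ++ t)); split=> // [i /h'[-> ->]|]; first by rewrite scaler0 addr0.
  rewrite big_split -scaler_sumr /= es et; congr (_ *: _ + _).
    by apply: sum_supp => // i /h'[].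
  by apply: sum_supp => // i /h'[].
have dec0 F : dec 0 F -> forall i, F i = 0.
  move=> [gF [s [us hs /esym es]]] i; have [si|/hs//] := boolP (i \in s).
  exact: (ind s).
have decg j v : g j v -> dec v (fun i => if i == j then v else 0).
  move=> gv; split=> [i|]; first by case: eqP => [->//|_]; exact: (sg i).1.
  exists [:: j]; split=> // [i|]; first by rewrite inE; case: eqP.
  by rewrite big_seq1 eqxx.
have decE x : exists F, dec x F.
  move: x (sp x); apply: span_sub => [|v [j gv]]; last first.
    by exists (fun i => if i == j then v else 0); exact: decg.
  split=> [|a y z [F dF] [G dG]]; last by eexists; exact: dec_lin dF dG.
  exists (fun=> 0); split=> [i|]; first exact: (sg i).1.
  by exists [::]; split=> //; rewrite big_nil.
have decU x F G : dec x F -> dec x G -> F = G.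
  move=> dF dG; apply: funext => i; apply/eqP; rewrite -subr_eq0 addrC -scaleN1r.
  apply/eqP; apply: (dec0 (fun i => -1 *: G i + F i)).
  by rewrite -[0](addNr x) -scaleN1r; exact: dec_lin.
have /choice [C hC] := decE.
exists (fun i v => C v i); split=> //.
- by move=> i a x y; rewrite (decU _ _ _ (hC _) (dec_lin a _ _ _ _ (hC x) (hC y))).
- by move=> i v gv; rewrite (decU _ _ _ (hC _) (decg _ _ gv)) eqxx.
- by move=> i j v /eqP/negPf ij gv; rewrite (decU _ _ _ (hC _) (decg _ _ gv)) ij.
Qed.

Lemma dsum_tens (I J : eqType) (V W : lmodType K) (g : I -> set V) (h : J -> set W) :
  dsum g -> dsum h ->
  dsum (fun p : I * J => span [set x | exists v w, [/\ g p.1 v, h p.2 w & x = v \ox w]]).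
Proof.
move=> [pg [sg spg lg g1 g0]] [ph [sh sph lh h1 h0]].
exists (fun p => tmap (pg p.1) (ph p.2)); split.
- by move=> p; exact: span_submod.
- apply: tens_ind => [|v w]; first exact: span_submod.
  apply: (span_pure2 (span_submod _) _ (spg v) (sph w)) => {}v {}w [i gv] [j hw].
  by apply: span_gen; exists (i, j); apply: span_gen; exists v, w.
- by move=> p; exact: tmap_linear.
- move=> p; apply: span_sub => [|_ [v [w [gv hw ->]]]].
    by apply: submod_eq; [exact: tmap_linear|].
  by rewrite /= tmapE // g1 // h1.
- move=> [i j] [i' j'] x ne; move: x; apply: span_sub.
    exact: (submod_eq (tmap_linear (lg _) (lh _)) (@lin0 _ _ _)).
  move=> _ [v [w [/= gv hw ->]]] /=; rewrite tmapE //.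
  have [e|/eqP ne'] := eqVneq i i'.
    rewrite (h0 _ _ _ _ hw); last by move=> e'; apply: ne; rewrite e e'.
    by rewrite linear_mk0 //; lin.
  by rewrite (g0 _ _ _ ne' gv) (linear_mk0 (f := fun v => v \ox _)) //; lin.
Qed.

(** With s the addition of degrees, this turns the bigrading of a tensor product into its total
    grading. *)
Lemma dsum_coarsen (I J : eqType) (V : lmodType K) (g : I -> set V) (s : I -> J) :
  dsum g -> dsum (fun j => span [set v | exists2 i, s i = j & g i v]).
Proof.
move=> dg; have [pr [sg sp lp g1 g0]] := dg.
have E j : exists F : V -> V, linear F /\
    forall i v, g i v -> F v = if s i == j then v else 0.
  have [|F lF FE] := @dsum_ext _ _ _ _ (fun i v => if s i == j then v else 0) dg.
    by move=> i; case: eqP => _; lin || exact: lin0.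
  by exists F.
have /choice [F hF] := E; exists F; split.
- by move=> j; exact: span_submod.
- move=> x; move: x (sp x); apply: span_mono => v [i gv]; apply: span_gen.
  by exists (s i); apply: span_gen; exists i.
- by move=> j; exact: (hF j).1.
- move=> j; apply: (span_eq (hF j).1 (@lin_id _ _)) => v [i <- gv].
  by rewrite ((hF _).2 i) // eqxx.
- move=> i j v ne; move: v; apply: (span_eq (hF i).1 (@lin0 _ _ _)) => v [k sk gv].
  by rewrite ((hF _).2 k) //; case: eqP => // e; case: ne; rewrite -e.
Qed.

Lemma dsum_equiv (I : eqType) (V : lmodType K) (g h : I -> set V) :
  (forall i v, g i v <-> h i v) -> dsum g -> dsum h.
Proof.
move=> gh; suff -> : g = h by [].
by apply: funext => i; apply: funext => v; apply: propext.
Qed.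

Lemma grading_dsum (V : lmodType K) (g : int -> set V) : is_grading g -> dsum g.
Proof.
move=> [sg sp ind]; apply: dsum_of_indep => // x.
by move: x (sp x); apply: span_mono => v [k _ gv]; apply: span_gen; exists k.
Qed.

Lemma dsum_grading (V : lmodType K) (g : int -> set V) : dsum g -> is_grading g.
Proof.
move=> dg; have [pr [sg sp _ _ _]] := dg; split=> //.
- by move=> x; move: x (sp x); apply: span_mono => v [k gv]; apply: span_gen; exists k.
- by move=> s f us gf e; exact: (dsum_indep dg us gf e).
Qed.

End DirectSums.

(** * Finite-dimensional duality *)

Section FiniteDimension.
Variable K : fieldType.
Implicit Types V W : lmodType K.

Definition indep V n (p : 'I_n -> V) : Prop :=
  forall c : 'I_n -> K, \sum_i c i *: p i = 0 -> forall i, c i = 0.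

Lemma wide_kernel m n (M : 'M[K]_(m, n)) : (n < m)%N ->
  exists2 c : 'I_m -> K, (exists i, c i != 0) & forall j, \sum_i c i * M i j = 0.
Proof.
move=> nm; have : kermx M != 0.
  rewrite -mxrank_eq0 mxrank_ker subn_eq0 -ltnNge.
  exact: leq_ltn_trans (rank_leq_col M) nm.
move=> /matrix0Pn [k [j kj]]; exists (fun i => kermx M k i); first by exists j.
move=> l; have /matrixP/(_ k l) := mulmx_ker M; rewrite !mxE => e.
by rewrite -[RHS]e.
Qed.

Lemma span_seqP V (s : seq V) x :
  span [set v | v \in s] x <-> exists c : 'I_(size s) -> K, x = \sum_i c i *: s`_i.
Proof.
split=> [|[c ->]]; last first.
  apply: submod_sum => [|i _]; first exact: span_submod.
  by apply: spanZ; apply: span_gen; exact: mem_nth.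
move: x; apply: span_sub => [|v /= vs].
  split=> [|a y z [c ->] [d ->]].
    by exists (fun=> 0); rewrite big1 // => i _; rewrite scale0r.
  exists (fun i => a * c i + d i); rewrite scaler_sumr -big_split.
  by apply: eq_bigr => i _; rewrite scalerDl scalerA.
have iv : (index v s < size s)%N by rewrite index_mem.
exists (fun i => (i == Ordinal iv)%:R); rewrite (bigD1 (Ordinal iv)) //= eqxx scale1r.
rewrite nth_index // big1 ?addr0 // => i /negPf ->; exact: scale0r.
Qed.

Lemma indep_size V n (p : 'I_n -> V) (s : seq V) : indep p ->
  (forall i, span [set v | v \in s] (p i)) -> (n <= size s)%N.
Proof.
move=> ip sp; rewrite leqNgt; apply/negP => lt.
have /choice [C hC] i : exists c : 'I_(size s) -> K, p i = \sum_j c j *: s`_j.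
  by apply/span_seqP.
have [c [i ci] h] := wide_kernel (\matrix_(i, j) C i j) lt.
have : c i = 0; last by move=> e; rewrite e eqxx in ci.
apply: ip; under eq_bigr do rewrite hC scaler_sumr.
rewrite exchange_big big1 // => j _ /=.
under eq_bigr do rewrite scalerA.
rewrite -scaler_suml; have := h j; under eq_bigr do rewrite mxE.
by move=> ->; rewrite scale0r.
Qed.

Definition snoc T n (p : 'I_n -> T) (v : T) : 'I_n.+1 -> T :=
  fun i => if unlift ord_max i is Some j then p j else v.

Lemma sum_snoc V n (F : 'I_n.+1 -> V) :
  \sum_i F i = \sum_(j < n) F (lift ord_max j) + F ord_max.
Proof.
rewrite big_ord_recr /=; congr (_ + _); apply: eq_bigr => j _; congr F.
by apply: val_inj; rewrite /= /bump leqNgt ltn_ord.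
Qed.

Lemma snoc_lift T n (p : 'I_n -> T) v j : snoc p v (lift ord_max j) = p j.
Proof. by rewrite /snoc liftK. Qed.

Lemma snoc_max T n (p : 'I_n -> T) v : snoc p v ord_max = v.
Proof. by rewrite /snoc unlift_none. Qed.

Lemma snocP T n (P : T -> Prop) (p : 'I_n -> T) v :
  (forall i, P (p i)) -> P v -> forall i, P (snoc p v i).
Proof. by move=> hp hv i; rewrite /snoc; case: unlift => [j|]. Qed.

Lemma ord_max_ind n (P : 'I_n.+1 -> Prop) :
  (forall j : 'I_n, P (lift ord_max j)) -> P ord_max -> forall i, P i.
Proof. by move=> h1 h2 i; case: (unliftP ord_max i) => [j|] ->. Qed.

(** An independent family of maximal size in X has an independent image. Adding y to that image
    creates a relation, in which the coefficient of y cannot vanish. *)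
Lemma inj_onto V (X : set V) (f : V -> V) : submod X -> fin_dim X -> linear f ->
  (forall x, X x -> X (f x)) -> (forall x, X x -> f x = 0 -> x = 0) ->
  forall y, X y -> exists2 x, X x & f x = y.
Proof.
move=> sX [s Xs] lf fX finj.
pose Q n := `[< exists2 p : 'I_n -> V, indep p & forall i, X (p i) >].
have Q0 : exists n, Q n.
  exists 0%N; apply/asboolP; exists (fun=> 0) => [c _ []//|[]//].
have Qle n : Q n -> (n <= size s)%N.
  by move=> /asboolP[p ip Xp]; apply: (indep_size ip) => i; apply: Xs.
have [n /asboolP[p ip Xp] nmax] := ex_maxnP Q0 Qle.
have ifp : indep (fun i => f (p i)).
  move=> c; under eq_bigr do rewrite -(linear_mkZ _ _ lf).
  rewrite -linear_mksum // => /finj e; apply: ip; apply: e.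
  by apply: submod_sum => // i _; exact: submodZ.
move=> y Xy; have nQ : ~ indep (snoc (fun i => f (p i)) y).
  move=> h; have /nmax : Q n.+1; last by rewrite ltnn.
  by apply/asboolP; exists (snoc (fun i => f (p i)) y) => //; apply: snocP => // i; exact: fX.
have [c [e [i /eqP ci]]] : exists c : 'I_n.+1 -> K,
    \sum_i c i *: snoc (fun i => f (p i)) y i = 0 /\ exists i, c i <> 0.
  apply: contrapT => h; apply: nQ => c e i; apply: contrapT => ci.
  by apply: h; exists c; split=> //; exists i.
move: e; rewrite sum_snoc snoc_max; under eq_bigr do rewrite snoc_lift.
have [c0|c0] := eqVneq (c ord_max) 0.
  rewrite c0 scale0r addr0 => /ifp h; move: ci; suff -> : c i = 0 by rewrite eqxx.
  by move: i; apply: ord_max_ind.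
move=> /eqP; rewrite addrC addr_eq0 => /eqP e.
exists (\sum_i - (c ord_max)^-1 * c (lift ord_max i) *: p i).
  by apply: submod_sum => // j _; exact: submodZ.
rewrite linear_mksum //; apply: (scalerI c0); rewrite e -sumrN scaler_sumr.
apply: eq_bigr => j _; rewrite linear_mkZ // !scalerA mulrA mulrN divff //.
by rewrite mulN1r scaleNr.
Qed.

(** Each form is nondegenerate on one side. On the side of X this makes a maximal biorthogonal
    system for [b2] span X, so its size is the dimension of X. On the side of Y, [b1] bounds the
    dimension of Y by that of X, which forces the same system to span Y. *)
Lemma dual_bases (P Q : lmodType K) (X : set P) (Y : set Q) (b1 b2 : P -> Q -> K) :
  submod X -> submod Y -> fin_dim X ->
  (forall q, linear (fun p => b1 p q : K^o)) -> (forall p, linear (b1 p : Q -> K^o)) ->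
  (forall q, linear (fun p => b2 p q : K^o)) -> (forall p, linear (b2 p : Q -> K^o)) ->
  (forall q, Y q -> (forall p, X p -> b1 p q = 0) -> q = 0) ->
  (forall p, X p -> (forall q, Y q -> b2 p q = 0) -> p = 0) ->
  exists n (p : 'I_n -> P) (q : 'I_n -> Q),
    [/\ forall i, X (p i), forall i, Y (q i),
        forall x, X x -> x = \sum_i b2 x (q i) *: p i
      & forall y, Y y -> y = \sum_i b2 (p i) y *: q i].
Proof.
move=> sX sY [s Xs] l1 r1 l2 r2 nd1 nd2.
pose D n (pq : ('I_n -> P) * ('I_n -> Q)) := [/\ forall i, X (pq.1 i),
  forall i, Y (pq.2 i) & forall i j, b2 (pq.1 i) (pq.2 j) = (i == j)%:R].
have Dindep n pq : D n pq -> indep pq.1 /\ indep pq.2.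
  move=> [Xp Yq pq']; split=> c e i.
    have := congr1 (fun x => b2 x (pq.2 i) : K^o) e.
    rewrite (linear_mk0 (l2 _)) (linear_mksum _ _ _ (l2 _)) /= (bigD1 i) //=.
    rewrite (linear_mkZ _ _ (l2 _)) pq' eqxx big1 ?addr0 => [|j /negPf ji].
      by rewrite /GRing.scale /= mulr1.
    by rewrite (linear_mkZ _ _ (l2 _)) pq' ji scaler0.
  have := congr1 (b2 (pq.1 i) : Q -> K^o) e.
  rewrite (linear_mk0 (r2 _)) (linear_mksum _ _ _ (r2 _)) /= (bigD1 i) //=.
  rewrite (linear_mkZ _ _ (r2 _)) pq' eqxx big1 ?addr0 => [|j /negPf ji].
    by rewrite /GRing.scale /= mulr1.
  by rewrite (linear_mkZ _ _ (r2 _)) pq' eq_sym ji scaler0.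
pose Dn n := `[< exists pq, D n pq >].
have D0 : exists n, Dn n.
  exists 0%N; apply/asboolP; exists (fun=> 0, fun=> 0); split; by case.
have Dle n : Dn n -> (n <= size s)%N.
  move=> /asboolP[pq dpq]; apply: (indep_size (Dindep _ _ dpq).1) => i.
  by apply: Xs; case: dpq.
have [n /asboolP[[p q] dpq] nmax] := ex_maxnP D0 Dle.
have [/= Xp Yq pq] := dpq; exists n, p, q.
have pE i y : b2 (p i) (\sum_j b2 (p j) y *: q j) = b2 (p i) y.
  have -> := linear_mksum (index_enum _) xpredT (fun j => b2 (p j) y *: q j) (r2 (p i)).
  rewrite (bigD1 i) //= (linear_mkZ _ _ (r2 _)) pq eqxx big1 ?addr0 => [|j /negPf ji].
    by rewrite /GRing.scale /= mulr1.
  by rewrite (linear_mkZ _ _ (r2 _)) pq eq_sym ji scaler0.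
have xE x : X x -> x = \sum_i b2 x (q i) *: p i.
  move=> Xx; apply/eqP; rewrite -subr_eq0; apply/eqP.
  set x' := x - _; have Xx' : X x'.
    by apply: submodB => //; apply: submod_sum => // i _; exact: submodZ.
  have x'q j : b2 x' (q j) = 0.
    have -> := linear_mkB x (\sum_i b2 x (q i) *: p i) (l2 (q j)).
    have -> := linear_mksum (index_enum _) xpredT (fun i => b2 x (q i) *: p i) (l2 (q j)).
    rewrite (bigD1 j) //= (linear_mkZ _ _ (l2 _)) pq eqxx big1 ?addr0 => [|i /negPf ij].
      by rewrite /GRing.scale /= mulr1 subrr.
    by rewrite (linear_mkZ _ _ (l2 _)) pq ij scaler0.
  apply: nd2 => // y Yy; apply/eqP; apply: contrapT => /negP ne.
  pose y0 := y - \sum_j b2 (p j) y *: q j.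
  have Yy0 : Y y0 by apply: submodB => //; apply: submod_sum => // i _; exact: submodZ.
  have e0 : b2 x' y0 = b2 x' y.
    have -> := linear_mkB y (\sum_j b2 (p j) y *: q j) (r2 x').
    have -> := linear_mksum (index_enum _) xpredT (fun j => b2 (p j) y *: q j) (r2 x').
    by rewrite big1 ?subr0 // => j _; rewrite (linear_mkZ _ _ (r2 _)) x'q scaler0.
  have pe i : b2 (p i) y0 = 0.
    have -> := linear_mkB y (\sum_j b2 (p j) y *: q j) (r2 (p i)).
    by rewrite pE subrr.
  (* x' is orthogonal to all q j, and y0 to all p i, while x' and y0 pair to a nonzero scalar:
     together they would enlarge the maximal system. *)
  have /nmax : Dn n.+1; last by rewrite ltnn.
  apply/asboolP; exists (snoc p ((b2 x' y)^-1 *: x'), snoc q y0); split=> /=.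
  - by apply: snocP => //; exact: submodZ.
  - exact: snocP.
  - apply: ord_max_ind => [i|]; apply: ord_max_ind => [j|];
      rewrite ?snoc_lift ?snoc_max.
    + by rewrite pq (inj_eq (@lift_inj _ _)).
    + by rewrite pe eq_sym (negPf (neq_lift _ _)).
    + by rewrite (linear_mkZ _ _ (l2 _)) x'q scaler0 (negPf (neq_lift _ _)).
    + by rewrite (linear_mkZ _ _ (l2 _)) e0 /GRing.scale /= mulVf // eqxx.
split=> // y Yy; apply/eqP; rewrite -subr_eq0; apply/eqP.
set y' := y - _; have Yy' : Y y'.
  by apply: submodB => //; apply: submod_sum => // i _; exact: submodZ.
have py' i : b2 (p i) y' = 0.
  have -> := linear_mkB y (\sum_j b2 (p j) y *: q j) (r2 (p i)).
  by rewrite pE subrr.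
(* These are n+1 vectors of Y against the n vectors p j spanning X, so some nontrivial combination
   is orthogonal to X for [b1] and hence zero. Pairing it with the p j by [b2] kills every
   coefficient except that of y'. *)
pose Q' := snoc q y'.
have YQ' : forall i, Y (Q' i) by apply: snocP.
have [c [i /eqP ci] h] := wide_kernel (\matrix_(i < n.+1, j < n) b1 (p j) (Q' i)) (ltnSn n).
have e : \sum_i c i *: Q' i = 0.
  apply: nd1 => [|x Xx]; first by apply: submod_sum => // j _; exact: submodZ.
  rewrite (xE _ Xx); set Z := \sum_i c i *: _.
  have -> := linear_mksum (index_enum _) xpredT (fun i => b2 x (q i) *: p i) (l1 Z).
  rewrite big1 // => j _; rewrite (linear_mkZ _ _ (l1 _)).
  suff -> : b1 (p j) Z = 0 by rewrite scaler0.
  have -> := linear_mksum (index_enum _) xpredT (fun i => c i *: Q' i) (r1 (p j)).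
  have := h j; under eq_bigr do rewrite mxE; move=> e; rewrite -[RHS]e.
  by apply: eq_bigr => k _; rewrite (linear_mkZ _ _ (r1 _)).
move: e; rewrite sum_snoc /Q' snoc_max; under eq_bigr do rewrite snoc_lift.
move=> e; have cl j : c (lift ord_max j) = 0.
  have := congr1 (b2 (p j) : Q -> K^o) e.
  rewrite (linear_mk0 (r2 _)) (linear_mkD _ _ (r2 _)) (linear_mksum _ _ _ (r2 _)).
  rewrite (linear_mkZ _ _ (r2 _)) py' scaler0 addr0 (bigD1 j) //=.
  rewrite (linear_mkZ _ _ (r2 _)) pq eqxx big1 ?addr0 => [|k /negPf kj].
    by rewrite /GRing.scale /= mulr1.
  by rewrite (linear_mkZ _ _ (r2 _)) pq eq_sym kj scaler0.
move: e; rewrite big1 ?add0r => [/eqP|j _]; last by rewrite cl scale0r.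
rewrite scaler_eq0 => /orP[/eqP cm|/eqP//].
by case: ci; move: i; apply: ord_max_ind.
Qed.

End FiniteDimension.

(** * Hopf algebras and weights *)

Section HopfCalculus.
Variables (K : fieldType) (A : hopf K).
Implicit Types (a b : A) (X Y Z : lmodType K).

Lemma sw_assoc Z (f : A -> A -> A -> Z) a :
  (forall y z, linear (fun x => f x y z)) -> (forall x z, linear (fun y => f x y z)) ->
  (forall x y, linear (fun z => f x y z)) ->
  tlift (fun x y => tlift (fun x1 x2 => f x1 x2 y) (hD A x)) (hD A a) =
  tlift (fun x y => tlift (fun y1 y2 => f x y1 y2) (hD A y)) (hD A a).
Proof.
move=> f1 f2 f3; pose G x := tlift (fun y z => f x y z).
pose G' z := tlift (fun x y => f x y z).
have bG : bilinear2 G by rewrite /G; lin.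
have bG' : bilinear2 (fun u z => G' z u) by rewrite /G'; lin.
have E t : tlift G (tassoc t) = tlift (fun u z => G' z u) t.
  move: t; apply: tens_ext => [||u z]; try lin.
  rewrite tliftE; last lin; move: u; apply: tens_ext => [||x y]; try lin.
  by rewrite tassocE tliftE // /G /G' !tliftE //; lin.
rewrite -[RHS](tlift_tmap (F := G)); try lin.
by rewrite -hDA E tlift_tmap //; lin.
Qed.

Lemma sw1 Z (f : A -> A -> Z) : bilinear2 f -> tlift f (hD A 1) = f 1 1.
Proof. by move=> bf; rewrite hD1 tliftE. Qed.

Lemma swM Z (f : A -> A -> Z) a b : bilinear2 f ->
  tlift f (hD A (a * b)) =
  tlift (fun x y => tlift (fun x' y' => f (x * x') (y * y')) (hD A b)) (hD A a).
Proof.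
move=> bf; rewrite hDM; move: (hD A a) (hD A b) => s t.
have [t1 t2] := tmul_bilinear A.
move: s; apply: tens_ext => [||x y]; try lin.
rewrite tliftE; last lin; move: t; apply: tens_ext => [||x' y']; try lin.
by rewrite tmulE !tliftE //; lin.
Qed.

Lemma sw_el Z (g : A -> Z) a : linear g ->
  tlift (fun x y => eps x *: g y) (hD A a) = g a.
Proof.
move=> lg; rewrite -{2}(hel a) tlift_comp //; last lin.
by apply: tlift_ext => [||x y]; try lin; rewrite linear_mkZ.
Qed.

Lemma sw_er Z (g : A -> Z) a : linear g ->
  tlift (fun x y => eps y *: g x) (hD A a) = g a.
Proof.
move=> lg; rewrite -{2}(her a) tlift_comp //; last lin.
by apply: tlift_ext => [||x y]; try lin; rewrite linear_mkZ.
Qed.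

Lemma sw_Sl Z (g : A -> Z) a : linear g ->
  tlift (fun x y => g (hS A x * y)) (hD A a) = eps a *: g 1.
Proof. by move=> lg; rewrite -linear_mkZ // -hSl tlift_comp //; lin. Qed.

Lemma sw_Sr Z (g : A -> Z) a : linear g ->
  tlift (fun x y => g (x * hS A y)) (hD A a) = eps a *: g 1.
Proof. by move=> lg; rewrite -linear_mkZ // -hSr tlift_comp //; lin. Qed.

Lemma hS1 : hS A 1 = 1.
Proof.
have := sw_Sl 1 (@lin_id _ _); rewrite sw1; last lin.
by rewrite mulr1 eps1 scale1r.
Qed.

(** The maps S(a b) and S(b) S(a) are both convolution inverses of the multiplication A (x) A -> A.
    Q is the convolution product of S(a b), the multiplication and S(b) S(a); its two bracketings
    collapse it to either end. *)
Lemma hS_anti a b : hS A (a * b) = hS A b * hS A a.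
Proof.
pose F (x y1 y2 u v1 v2 : A) := hS A (x * u) * (y1 * v1) * (hS A v2 * hS A y2).
pose Q := tlift (fun x y : A => tlift (fun y1 y2 : A => tlift (fun u v : A =>
  tlift (fun v1 v2 : A => F x y1 y2 u v1 v2) (hD A v)) (hD A b)) (hD A y)) (hD A a).
transitivity Q; rewrite /Q.
- transitivity (tlift (fun x y => eps y *: hS A (x * b)) (hD A a)).
    by rewrite (sw_er (g := fun x => hS A (x * b))) //; lin.
  apply: tlift_ext => [||x y]; rewrite /F; try lin.
  transitivity (tlift (fun y1 y2 => hS A (x * b) * (y1 * hS A y2)) (hD A y)).
    by rewrite (sw_Sr (g := fun z => hS A (x * b) * z)) ?mulr1 //; lin.
  apply: tlift_ext => [||y1 y2]; try lin.
  rewrite -(sw_er (g := fun u => hS A (x * u) * (y1 * hS A y2))); last lin.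
  apply: tlift_ext => [||u v]; try lin.
  rewrite -[y1 in LHS]mulr1.
  rewrite -(sw_Sr (g := fun z => hS A (x * u) * (y1 * z * hS A y2))); last lin.
  by apply: tlift_ext => [||v1 v2]; try lin; rewrite !mulrA.
- rewrite -(@sw_assoc _ (fun x y1 y2 => tlift (fun u v =>
    tlift (fun v1 v2 : A => F x y1 y2 u v1 v2) (hD A v)) (hD A b))) /F; try lin.
  rewrite -[RHS](sw_el (g := fun y => hS A b * hS A y)); last lin.
  apply: tlift_ext => [||x y]; try lin.
  transitivity (tlift (fun x1 x2 => tlift (fun u v =>
     tlift (fun u1 u2 => hS A (x1 * u1) * (x2 * u2) * (hS A v * hS A y)) (hD A u))
     (hD A b)) (hD A x)).
    apply: tlift_ext => [||x1 x2]; try lin.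
    by rewrite (@sw_assoc _ (fun u1 u2 v => hS A (x1 * u1) * (x2 * u2) * (hS A v * hS A y))) //; lin.
  transitivity (tlift (fun u v => tlift (fun x1 x2 =>
     tlift (fun u1 u2 => hS A (x1 * u1) * (x2 * u2) * (hS A v * hS A y)) (hD A u))
     (hD A x)) (hD A b)).
    move: (hD A x) (hD A b) => s t.
    move: s; apply: tens_ext => [||x1 x2]; try lin.
    rewrite tliftE; last lin.
    by apply: tlift_ext => [||u v]; try lin; rewrite tliftE //; lin.
  have -> : eps x *: (hS A b * hS A y) =
      tlift (fun u v => eps (x * u) *: (hS A v * hS A y)) (hD A b).
    rewrite -(sw_el (g := fun z => eps x *: (hS A z * hS A y))); last lin.
    by apply: tlift_ext => [||u v]; try lin; rewrite epsM scalerA mulrC.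
  apply: tlift_ext => [||u v]; try lin.
  rewrite -(swM (f := fun z z' => hS A z * z' * (hS A v * hS A y))); last lin.
  by rewrite (sw_Sl (g := fun z => z * _)) ?mul1r //; lin.
Qed.

End HopfCalculus.

Section TensorExchange.
Variable K : fieldType.

Lemma eqKo (x y : K) : x = y :> K^o -> x = y.
Proof. by []. Qed.

Lemma tlift_exch (V W V' W' Z : lmodType K) (f : V -> W -> V' -> W' -> Z) s t :
  (forall y u v, linear (fun x => f x y u v)) ->
  (forall x u v, linear (fun y => f x y u v)) ->
  (forall x y, bilinear2 (f x y)) ->
  tlift (fun x y => tlift (f x y) t) s = tlift (fun u v => tlift (fun x y => f x y u v) s) t.
Proof.
move=> f1 f2 f3.
have f4 u v : bilinear2 (fun x y => f x y u v) by split=> ?; [exact: f1|exact: f2].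
have f5 x y v : linear (fun u => f x y u v) := (f3 x y).1 v.
have f6 x y u : linear (fun v => f x y u v) := (f3 x y).2 u.
have b1 : bilinear2 (fun x y => tlift (f x y) t).
  by split=> z; apply: lin_tlift_fun => // ? ?; first [exact: f1|exact: f2].
have b2 s' : bilinear2 (fun u v => tlift (fun x y => f x y u v) s').
  by split=> z; apply: lin_tlift_fun => // ? ?; first [exact: f5|exact: f6].
move: s; apply: tens_ext => [||x y]; first exact: tlift_linear.
  by apply: lin_tlift_fun => // u v; exact: tlift_linear.
by rewrite tliftE //; apply: tlift_ext => // u v; rewrite tliftE.
Qed.

Lemma tlift0 (V W Z : lmodType K) (t : tens V W) : tlift (fun _ _ => 0 : Z) t = 0.
Proof.
have b0 : bilinear2 (fun (_ : V) (_ : W) => 0 : Z) by split=> ?; exact: lin0.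
by move: t; apply: tens_ext => [||v w]; [exact: tlift_linear|exact: lin0|rewrite tliftE].
Qed.

End TensorExchange.

Section TorusGroup.
Variables (K : fieldType) (A : polarized K).
Implicit Types l m n a b c : wfun A.

Definition wlin l : Prop := linear (l : p0 A -> K^o).
Definition w0 : wfun A := @eps K (p0 A).

Lemma torus_lin l : torus l -> wlin l.
Proof. by case. Qed.

Lemma wadd_lin l m : wlin l -> wlin m -> wlin (wadd l m).
Proof. by rewrite /wlin /wadd => ll lm; lin. Qed.

Lemma wopp_lin l : wlin l -> wlin (wopp l).
Proof. by rewrite /wlin /wopp => ll; lin. Qed.

Lemma w0_lin : wlin w0.
Proof. exact: eps_linear. Qed.

Lemma waddA l m n : wlin l -> wlin m -> wlin n ->
  wadd (wadd l m) n = wadd l (wadd m n).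
Proof.
rewrite /wlin => ll lm ln; apply: funext => h; apply: (@eqKo K); rewrite /wadd.
transitivity (tlift (fun x y => tlift (fun x1 x2 => (l x1 * m x2 * n y : K^o))
    (hD _ x)) (hD _ h)).
  by apply: tlift_ext => [||x y]; try lin; rewrite (tlift_comp (g := fun z : K^o => z * n y : K^o)) //; lin.
rewrite (sw_assoc (f := fun x y z => (l x * m y * n z : K^o))); try lin.
apply: tlift_ext => [||x y]; try lin.
rewrite (tlift_comp (g := fun z : K^o => l x * z : K^o)) //; try lin.
by apply: tlift_ext => [||u v]; try lin; rewrite mulrA.
Qed.

Lemma waddC l m : wlin l -> wlin m -> wadd l m = wadd m l.
Proof.
rewrite /wlin => ll lm; apply: funext => h; apply: (@eqKo K); rewrite /wadd.
rewrite -{1}(p0_cocomm h) /hDop tlift_swap; last lin.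
by apply: tlift_ext => [||x y]; try lin; rewrite mulrC.
Qed.

Lemma wadd0 l : wlin l -> wadd l w0 = l.
Proof.
rewrite /wlin => ll; apply: funext => h; apply: (@eqKo K); rewrite /wadd -[RHS](sw_er h ll).
by apply: tlift_ext => [||x y]; try lin; rewrite mulrC.
Qed.

Lemma torusD l m : torus l -> torus m -> torus (wadd l m).
Proof.
move=> [ll l1 lM] [lm m1 mM]; split; first exact: wadd_lin.
  by rewrite /wadd sw1 ?l1 ?m1 ?mulr1 //; lin.
move=> g h; apply: (@eqKo K); rewrite /wadd swM; last lin.
set T := tlift _ (hD _ h).
rewrite (tlift_comp (g := fun z : K^o => z * T : K^o)); try lin.
apply: tlift_ext => [||x y]; try lin; rewrite /T.
rewrite (tlift_comp (g := fun z : K^o => l x * m y * z : K^o)); try lin.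
by apply: tlift_ext => [||u v]; try lin; rewrite lM mM mulrACA.
Qed.

Lemma torusN l : torus l -> torus (wopp l).
Proof.
move=> [ll l1 lM]; split; first exact: wopp_lin.
  by rewrite /wopp hS1.
by move=> g h; rewrite /wopp hS_anti lM mulrC.
Qed.

Lemma torusB l m : torus l -> torus m -> torus (wsub l m).
Proof. by move=> tl tm; apply: torusD => //; exact: torusN. Qed.

Lemma waddN l : torus l -> wadd l (wopp l) = w0.
Proof.
move=> [ll l1 lM]; apply: funext => h; apply: (@eqKo K); rewrite /wadd /w0.
transitivity (tlift (fun x y => (l (x * hS _ y) : K^o)) (hD _ h)).
  by apply: tlift_ext => [||x y]; rewrite /wopp ?lM //; lin.
rewrite (sw_Sr (g := l : p0 A -> K^o)) // l1.
exact: mulr1.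
Qed.

Lemma wadd0l l : wlin l -> wadd w0 l = l.
Proof. by move=> ll; rewrite waddC ?wadd0 //; exact: w0_lin. Qed.

Lemma waddNl l : torus l -> wadd (wopp l) l = w0.
Proof. by move=> tl; rewrite waddC ?waddN //; apply: torus_lin => //; exact: torusN. Qed.

Lemma wopp_uniq l m : torus l -> wlin m -> wadd l m = w0 -> m = wopp l.
Proof.
move=> tl lm e; have tN := torusN tl.
rewrite -[m]wadd0l // -(waddNl tl) waddA ?e ?wadd0 //; exact: torus_lin.
Qed.

Lemma woppK l : torus l -> wopp (wopp l) = l.
Proof.
move=> tl; apply/esym/wopp_uniq; [exact: torusN|exact: torus_lin|exact: waddNl].
Qed.

Lemma woppD l m : torus l -> torus m -> wopp (wadd l m) = wadd (wopp l) (wopp m).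
Proof.
move=> tl tm; have [tl' tm'] := (torusN tl, torusN tm).
have [ll lm ll' lm'] : [/\ wlin l, wlin m, wlin (wopp l) & wlin (wopp m)].
  by split; exact: torus_lin.
apply/esym/wopp_uniq; [exact: torusD|exact: wadd_lin|].
rewrite (waddC ll) // waddA //; last exact: wadd_lin.
by rewrite -(waddA ll) // waddN // wadd0l // waddN.
Qed.

Lemma waddK l a : torus l -> torus a -> wsub (wadd l a) a = l.
Proof.
move=> tl ta; rewrite /wsub waddA ?waddN ?wadd0 //; apply: torus_lin => //.
exact: torusN.
Qed.

Lemma wsubKK l a : torus l -> torus a -> wsub l (wsub l a) = a.
Proof.
move=> tl ta; have ta' := torusN ta.
rewrite {1}/wsub /wsub woppD // woppK // -waddA ?waddN ?wadd0l //;
  exact: torus_lin || (apply: torus_lin; exact: torusN).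
Qed.

Lemma wsubDA l a b : torus l -> torus a -> torus b ->
  wsub l (wadd a b) = wsub (wsub l a) b.
Proof.
move=> tl ta tb; rewrite /wsub woppD // -waddA //;
  exact: torus_lin || (apply: torus_lin; exact: torusN).
Qed.

(** Characters are multiplicative, so the product over b in s of elements g - b(g) 1, each
    normalised to take the value 1 at a, separates a from all of s. *)
Lemma torus_interp a (s : seq (wfun A)) : torus a ->
  (forall b, b \in s -> torus b /\ b <> a) ->
  exists h : p0 A, a h = 1 /\ forall b, b \in s -> b h = 0.
Proof.
move=> ta; elim: s => [|b s IH] hs.
  by exists 1; split=> //; case: ta.
have [h [ah hh]] := IH (fun c cs => hs c (@mem_behead _ (b :: s) c cs)).
have [tb ba] := hs b (mem_head _ _).
have [g bg] : exists g, b g <> a g.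
  by apply: contrapT => e; apply: ba; apply: funext => g; apply: contrapT => ne; apply: e; exists g.
have [la a1 aM] := ta; have [lb b1 bM] := tb.
have E c : torus c -> forall x, c (x - b g *: 1) = c x - b g.
  move=> [lc c1 _] x; have -> : c (x - b g *: 1) = c x - (b g *: (c 1 : K^o)).
    by rewrite -(linear_mkZ _ _ lc) -(linear_mkB _ _ lc).
  by rewrite c1 /GRing.scale /= mulr1.
have ne : a g - b g != 0 by rewrite subr_eq0; apply/eqP => e; apply: bg.
exists ((a g - b g)^-1 *: (g - b g *: 1) * h); split.
  rewrite aM ah mulr1; have -> := linear_mkZ (a g - b g)^-1 (g - b g *: 1) la.
  by rewrite E // /GRing.scale /= mulVf.
move=> c; rewrite inE => /orP[/eqP ->|cs].
  rewrite bM; have -> := linear_mkZ (a g - b g)^-1 (g - b g *: 1) lb.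
  by rewrite E // subrr scaler0 mul0r.
by have [[_ _ ->] _] := hs c (@mem_behead _ (b :: s) c cs); rewrite hh // mulr0.
Qed.

End TorusGroup.

(** * Generic characters *)

Section Generic.
Variables (K : fieldType) (A : polarized K).
Implicit Types Z : set (wfun A).

Definition tpre (s : wfun A -> wfun A) Z : set (wfun A) :=
  [set l | torus l /\ Z (s l)].

Definition torus_auto (s r : wfun A -> wfun A) : Prop :=
  [/\ forall l, torus l -> torus (s l), forall l, torus l -> r (s l) = l
    & forall Z, zclosed Z -> zclosed (tpre s Z)].

Lemma zclosed_sub Z l : zclosed Z -> Z l -> torus l.
Proof. by move=> [I ->] []. Qed.

Lemma tpreK s r Z : torus_auto s r -> torus_auto r s -> zclosed Z ->
  tpre r (tpre s Z) = Z.
Proof.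
move=> [ts rs cs] [tr sr cr] cZ; apply/seteqP; split=> l /=.
  by move=> [tl [_]]; rewrite sr.
by move=> Zl; have tl := zclosed_sub cZ Zl; split=> //; split; [exact: tr|rewrite sr].
Qed.

Lemma tpre_irr s r Z : torus_auto s r -> torus_auto r s -> zirreducible Z ->
  zirreducible (tpre s Z).
Proof.
move=> Hs Hr; have [ts rs cs] := Hs; have [tr sr cr] := Hr.
move=> [cZ [z Zz] iZ]; have tz := zclosed_sub cZ Zz; split; first exact: cs.
  by exists (r z); split; [exact: tr|rewrite /= sr].
move=> X Y cX cY e.
have eZ : Z = tpre r X `|` tpre r Y.
  rewrite -(tpreK Hs Hr cZ) e; apply/seteqP; split=> l /=.
    by move=> [tl [Xl|Yl]]; [left|right].
  by move=> [[tl Xl]|[tl Yl]]; split=> //; [left|right].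
by case: (iZ _ _ (cr _ cX) (cr _ cY) eZ) => ->; [left|right]; exact: tpreK.
Qed.

Lemma tpre_dim s r Z n : torus_auto s r -> torus_auto r s ->
  dim_ge Z n -> dim_ge (tpre s Z) n.
Proof.
move=> Hs Hr; have [ts rs cs] := Hs; have [tr sr cr] := Hr.
move=> [F [F1 F2]]; exists (fun i => tpre s (F i)); split=> [i /F1[iF FZ]|i ni].
  by split; [exact: tpre_irr Hs Hr iF|move=> l [tl Fl]; split=> //; exact: FZ].
have [sub nsub] := F2 i ni; split; first by move=> l [tl Fl]; split=> //; exact: sub.
move=> h; apply: nsub => l Fl; have [[cF _ _] _] := F1 _ ni.
have tl := zclosed_sub cF Fl; rewrite -(sr l) //.
by apply: (h (r l) _).2; split; [exact: tr|rewrite /= sr].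
Qed.

(** An automorphism of T carries chains of irreducible closed sets to such chains in both
    directions, so preimages of the exceptional sets are still of lower dimension. *)
Lemma generic_pre s r (Q : wfun A -> Prop) : torus_auto s r -> torus_auto r s ->
  generic Q -> generic (fun l => Q (s l)).
Proof.
move=> Hs Hr; have [ts rs cs] := Hs; have [tr sr cr] := Hr.
move=> [Z [cZ hZ]]; exists (fun n => tpre s (Z n)); split=> [n|l tl nZ].
  have [cZn [d [d1 d2]]] := cZ n; split; first exact: cs.
  exists d; split=> // h; apply: d2; rewrite -(tpreK Hs Hr cZn).
  exact: tpre_dim Hr Hs h.
by apply: hZ => [|n Zn]; [exact: ts|apply: (nZ n)].
Qed.

Lemma generic_forall (Q : nat -> wfun A -> Prop) :
  (forall n, generic (Q n)) -> generic (fun l => forall n, Q n l).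
Proof.
move=> /choice[Z hZ].
(* The exceptional sets of all the Q n are enumerated by coding pairs; a number which codes no pair
   repeats the set of index (0, 0). *)
exists (fun k => let p : nat * nat := odflt (0%N, 0%N) (unpickle k) in Z p.1 p.2).
split=> [k|l tl nZ n]; first exact: (hZ _).1.
by apply: (hZ n).2 => // m Zl; apply: (nZ (pickle (n, m))); rewrite pickleK.
Qed.

Lemma generic_imp (Q Q' : wfun A -> Prop) :
  (forall l, torus l -> Q l -> Q' l) -> generic Q -> generic Q'.
Proof.
by move=> QQ' [Z [cZ hZ]]; exists Z; split=> // l tl nZ; apply: QQ' => //; exact: hZ.
Qed.

Lemma torus_auto_add c : torus c -> torus_auto (fun l => wadd l c) (fun l => wadd l (wopp c)).
Proof.
move=> tc; split=> [l tl|l tl|Z [I ->]]; [exact: torusD|exact: waddK|].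
(* The comorphism of the translation by c: the value of l at t h is that of l + c at h. Equations of
   a closed set are therefore pulled back by t. *)
pose t (h : p0 A) := tlift (fun x y => c y *: x) (hD _ h).
exists [set h | exists2 g, I g & h = t g]; have lc : linear (c : _ -> K^o) := torus_lin tc.
have E l g : torus l -> l (t g) = wadd l c g.
  move=> [ll _ _]; apply: (@eqKo K); rewrite /t (tlift_comp (g := l : p0 A -> K^o)) //; last lin.
  rewrite /wadd; apply: tlift_ext => [||x y]; try lin.
  by rewrite (linear_mkZ _ _ ll) /GRing.scale /= mulrC.
apply/seteqP; split=> l /= [tl].
  by move=> [_ hl]; split=> // _ [g Ig ->]; rewrite E // hl.
move=> hl; split=> //; split=> [|g Ig]; first exact: torusD.
by rewrite -E //; apply: hl; exists g.
Qed.

Lemma torus_auto_opp : torus_auto (@wopp K A) (@wopp K A).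
Proof.
split=> [l tl|l tl|Z [I ->]]; [exact: torusN|exact: woppK|].
exists [set h | exists2 g, I g & h = hS _ g].
apply/seteqP; split=> l /= [tl].
  by move=> [_ hl]; split=> // _ [g Ig ->]; exact: hl.
move=> hl; split=> //; split=> [|g Ig]; first exact: torusN.
by apply: hl; exists g.
Qed.

Lemma generic_opp (Q : wfun A -> Prop) : generic Q -> generic (fun l => Q (wopp l)).
Proof. by apply: generic_pre torus_auto_opp torus_auto_opp. Qed.

Lemma generic_sub c (Q : wfun A -> Prop) : torus c ->
  generic Q -> generic (fun l => Q (wsub l c)).
Proof.
move=> tc; have tN := torusN tc.
apply: (generic_pre (r := fun l => wadd l c)); first rewrite -{2}(woppK tc).
  exact: torus_auto_add.
exact: torus_auto_add.
Qed.

End Generic.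

(** * Verma modules *)

(* The two triangular decompositions A = A_- A_0 A_+ and A = A_+ A_0 A_- are treated
   together: X kills highest weight vectors modulo its counit, Y generates Verma
   modules, and DX, DY are the signs of their degrees. *)
Record half (K : fieldType) (A : polarized K) (X Y : algType K)
    (iX : {lrmorphism X -> A}) (iY : {lrmorphism Y -> A}) (DX DY : int -> Prop) :
    Prop := Half {
  half_inj : injective iX;
  half_injY : injective iY;
  half_gX : graded_sub (@pgr K A) (range iX);
  half_gY : graded_sub (@pgr K A) (range iY);
  half_mul : bijective
    (tlift (fun y t => tlift (fun h x => iY y * i0 A h * iX x) t)
       : tens Y (tens (p0 A) X) -> A);
  half_fin : forall k, fin_dim [set x | pgr k (iX x)];
  half_degX : forall x, eps (iX x) = 0 -> gsum (@pgr K A) DX (iX x);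
  half_degY : forall y, eps (iY y) = 0 -> gsum (@pgr K A) DY (iY y);
  half_DX0 : ~ DX 0;
  half_DY0 : ~ DY 0;
  half_DXD : forall i j, DX i -> DX j -> DX (i + j);
  half_DYD : forall i j, DY i -> DY j -> DY (i + j);
  half_hopf : hopf_sub (prodsub (i0 A) iX)
}.

Lemma half_pos (K : fieldType) (A : polarized K) :
  half (ip A) (im A) (fun k => 0 < k)%R (fun k => k < 0)%R.
Proof.
split; try by [].
- exact: ip_inj. - exact: im_inj. - exact: ip_graded. - exact: im_graded.
- exact: mul_m0p. - exact: ip_fin. - exact: ip_deg. - exact: im_deg.
- by move=> i j; exact: addr_gt0.
- by move=> i j hi hj; rewrite -oppr_gt0 opprD addr_gt0 ?oppr_gt0.
- exact: p0p_hopf.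
Qed.

Lemma half_neg (K : fieldType) (A : polarized K) :
  half (im A) (ip A) (fun k => k < 0)%R (fun k => 0 < k)%R.
Proof.
split; try by [].
- exact: im_inj. - exact: ip_inj. - exact: im_graded. - exact: ip_graded.
- exact: mul_p0m. - exact: im_fin. - exact: im_deg. - exact: ip_deg.
- by move=> i j hi hj; rewrite -oppr_gt0 opprD addr_gt0 ?oppr_gt0.
- by move=> i j; exact: addr_gt0.
- exact: p0m_hopf.
Qed.

Section GradedHopf.
Variables (K : fieldType) (A : polarized K).

Definition apr : int -> A -> A := projT1 (cid (grading_dsum (@pgr_grading K A))).

Lemma aprP : dsum_proj (@pgr K A) apr.
Proof. exact: projT2 (cid _). Qed.

Lemma apr_lin k : linear (apr k).
Proof. by case: aprP => _ _. Qed.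

Lemma apr_id k (a : A) : pgr k a -> apr k a = a.
Proof. by case: aprP => _ _ _ h _; exact: h. Qed.

Lemma apr_ne j k (a : A) : pgr k a -> j <> k -> apr j a = 0.
Proof. by case: aprP => _ _ _ _ h gk ne; exact: h gk. Qed.

Lemma pgr_submod k : submod (@pgr K A k).
Proof. by case: aprP. Qed.

Lemma apr_gsum (D : int -> Prop) k (a : A) : gsum (@pgr K A) D a -> ~ D k -> apr k a = 0.
Proof.
move=> ga nD; move: a ga; apply: span_eq; [exact: apr_lin|exact: lin0|].
by move=> a [j Dj gj]; apply: (apr_ne gj) => kj; apply: nD; rewrite kj.
Qed.

Lemma pgre_eps k (a : A) : pgr k a -> k <> 0 -> eps a = 0.
Proof. exact: pgre. Qed.

Lemma sw_i0 (Z : lmodType K) (f : A -> A -> Z) h : bilinear2 f ->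
  tlift f (hD A (i0 A h)) = tlift (fun x y => f (i0 A x) (i0 A y)) (hD (p0 A) h).
Proof. by move=> bf; rewrite i0_D tlift_tmap //; exact: lrmorph_linear. Qed.

Lemma eps_i0 h : eps (i0 A h) = eps h.
Proof. exact: i0_e. Qed.

Lemma sw_deg (Z : lmodType K) (f g : A -> A -> Z) k (a : A) : bilinear2 f -> bilinear2 g ->
  pgr k a -> (forall i j x y, i + j = k -> pgr i x -> pgr j y -> f x y = g x y) ->
  tlift f (hD A a) = tlift g (hD A a).
Proof.
move=> bf bg /pgrD; rewrite /tgr => ga fg; move: ga.
apply: (span_eq (tlift_linear bf) (tlift_linear bg)) => _ [i [j [x [y [gi gj e ->]]]]].
by rewrite !tliftE //; exact: fg gi gj.
Qed.

End GradedHopf.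

(** * Triangular decomposition and Harish-Chandra projection *)

Section Triangular.
Variables (K : fieldType) (A : polarized K) (X Y : algType K).
Variables (iX : {lrmorphism X -> A}) (iY : {lrmorphism Y -> A}) (DX DY : int -> Prop).
Hypothesis H : half iX iY DX DY.

Local Notation B := (prodsub (i0 A) iX).

Lemma hom_span (Z : algType K) (iZ : {lrmorphism Z -> A}) :
  injective iZ -> graded_sub (@pgr K A) (range iZ) ->
  forall z, span [set z | exists k, pgr k (iZ z)] z.
Proof.
move=> inj gZ z; have [s [us hs]] := dsum_supp (iZ z) (aprP A).
have e := dsum_sum (aprP A) us hs.
have /choice [f hf] k : exists z', k \in s -> iZ z' = apr k (iZ z).
  have [ks|_] := boolP (k \in s); last by exists 0.
  have [|z' _ e'] := gZ s (fun k => apr k (iZ z)) us (fun k => dsum_prP _ _ (aprP A)) _ k ks.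
    by rewrite -e; exists z.
  by exists z'.
have -> : z = \sum_(k <- s) f k.
  apply: inj; rewrite e linear_sum big_seq [RHS]big_seq; apply: eq_bigr => k ks.
  by rewrite /= hf.
apply: submod_sum_seq => [|k ks]; first exact: span_submod.
by apply: span_gen; exists k; rewrite hf //; exact: dsum_prP (aprP A).
Qed.

(** The sign condition concerns the kernel of the counit only. In degree 0, subtracting the counit
    leaves an element of that kernel, which has no component in degree 0 and so vanishes; in the
    other degrees the counit is zero already. *)
Lemma hom_cases (Z : algType K) (iZ : {lrmorphism Z -> A}) (D : int -> Prop) k z :
  injective iZ -> (forall z, eps (iZ z) = 0 -> gsum (@pgr K A) D (iZ z)) -> ~ D 0 ->
  pgr k (iZ z) -> [\/ z = 0, D k /\ eps (iZ z) = 0 | k = 0 /\ z = eps (iZ z) *: 1].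
Proof.
move=> inj dZ D0 gz; have [k0|/eqP k0] := eqVneq k 0.
  constructor 3; split=> //; apply/eqP; rewrite -subr_eq0; apply/eqP; apply: inj.
  rewrite [RHS]raddf0; set z' := z - _.
  have g' : pgr 0 (iZ z').
    rewrite k0 in gz; rewrite (linear_mkB _ _ (lrmorph_linear iZ)) (linear_mkZ _ _ (lrmorph_linear iZ)) rmorph1.
    by apply: submodB => //; [exact: pgr_submod|apply: submodZ; [exact: pgr_submod|exact: pgr1]].
  rewrite -(apr_id g'); apply: (apr_gsum (D := D)) => //; apply: dZ.
  rewrite (linear_mkB _ _ (lrmorph_linear iZ)) (linear_mkZ _ _ (lrmorph_linear iZ)) rmorph1; have -> := linear_mkB (iZ z) (eps (iZ z) *: 1) (@eps_linear K A).
  by rewrite (linear_mkZ _ _ (@eps_linear K A)) eps1 /GRing.scale /= mulr1 subrr.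
have e0 := pgre_eps gz k0.
have [Dk|nD] := pselect (D k); first by constructor 2.
constructor 1; apply: inj; rewrite [RHS]raddf0 -(apr_id gz).
exact: (apr_gsum (dZ _ e0)).
Qed.

Lemma X_ind (P : set X) : submod P -> P 1 ->
  (forall k x, DX k -> pgr k (iX x) -> eps (iX x) = 0 -> P x) -> forall x, P x.
Proof.
move=> sP P1 PD x; move: (hom_span (half_inj H) (half_gX H) x); apply: span_sub => // {}x [k gx].
have [->|[Dk e0]|[_ ->]] := hom_cases (half_inj H) (half_degX H) (half_DX0 H) gx.
- exact: sP.1.
- exact: PD gx e0.
- exact: submodZ.
Qed.

Lemma Y_ind (P : set Y) : submod P -> P 1 ->
  (forall k x, DY k -> pgr k (iY x) -> eps (iY x) = 0 -> P x) -> forall x, P x.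
Proof.
move=> sP P1 PD x; move: (hom_span (half_injY H) (half_gY H) x); apply: span_sub => // {}x [k gx].
have [->|[Dk e0]|[_ ->]] := hom_cases (half_injY H) (half_degY H) (half_DY0 H) gx.
- exact: sP.1.
- exact: PD gx e0.
- exact: submodZ.
Qed.

Let mulA := (tlift (fun y t => tlift (fun h x => iY y * i0 A h * iX x) t)
       : tens Y (tens (p0 A) X) -> A).

Let mulA_bil : bilinear2 (fun y t => tlift (fun h x => iY y * i0 A h * iX x) t).
Proof. lin. Qed.

Let mulAE y h x : mulA (y \ox (h \ox x)) = iY y * i0 A h * iX x.
Proof. by rewrite /mulA tliftE // tliftE //; lin. Qed.

Lemma A_ind (P : set A) : submod P ->
  (forall y h x, P (iY y * i0 A h * iX x)) -> forall a, P a.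
Proof.
move=> sP hP a; have [g gK Kg] := half_mul H; rewrite -(Kg a) -/mulA; move: (g a).
have lm : linear mulA by exact: tlift_linear.
apply: tens_ind => [|y t]; first exact: submod_pre.
move: t; apply: tens_ind => [|h x]; last by rewrite mulAE.
by apply: (submod_pre (f := fun t => mulA (y \ox t))) => //; lin.
Qed.

Lemma A_lift (Z : lmodType K) (f : Y -> p0 A -> X -> Z) :
  (forall h x, linear (fun y => f y h x)) -> (forall y x, linear (fun h => f y h x)) ->
  (forall y h, linear (fun x => f y h x)) ->
  exists2 F : A -> Z, linear F & forall y h x, F (iY y * i0 A h * iX x) = f y h x.
Proof.
move=> f1 f2 f3; have [g gK Kg] := half_mul H.
have lm : linear mulA by exact: tlift_linear.
have bF : bilinear2 (fun y t => tlift (fun h x => f y h x) t) by lin.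
exists (fun a => tlift (fun y t => tlift (fun h x => f y h x) t) (g a)).
  apply: lin_comp; first exact: tlift_linear.
  move=> c a b; apply: (can_inj gK); rewrite Kg -/mulA lm /mulA !Kg //.
by move=> y h x; rewrite -mulAE /mulA gK tliftE // tliftE //; lin.
Qed.

Lemma hc_exists : exists2 F : A -> p0 A, linear F &
  forall y h x, F (iY y * i0 A h * iX x) = (eps (iY y) * eps (iX x)) *: h.
Proof. by apply: A_lift; lin. Qed.

(* The Harish-Chandra projection along the triangular decomposition. *)
Definition hc : A -> p0 A := s2val (cid2 hc_exists).

Lemma hc_lin : linear hc.
Proof. exact: s2valP (cid2 hc_exists). Qed.

Lemma hcE y h x : hc (iY y * i0 A h * iX x) = (eps (iY y) * eps (iX x)) *: h.
Proof. exact: (s2valP' (cid2 hc_exists)). Qed.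

Lemma hcB h x : hc (i0 A h * iX x) = eps (iX x) *: h.
Proof. by rewrite -[i0 A h]mul1r -[1](rmorph1 iY) hcE rmorph1 eps1 mul1r. Qed.

Lemma hc_i0 h : hc (i0 A h) = h.
Proof. by rewrite -[i0 A h]mulr1 -[1](rmorph1 iX) hcB rmorph1 eps1 scale1r. Qed.

Lemma hc1 : hc 1 = 1.
Proof. by rewrite -[1 in LHS](rmorph1 (i0 A)) hc_i0. Qed.

Lemma hcX x : hc (iX x) = eps (iX x) *: 1.
Proof. by rewrite -[iX x in LHS]mul1r -[1 in LHS](rmorph1 (i0 A)) hcB. Qed.

Lemma pgr_i0 h k (a : A) : pgr k a -> pgr k (i0 A h * a).
Proof. by move=> ga; rewrite -[k]add0r; apply: pgrM => //; exact: i0_deg. Qed.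

(** If a product y h x has nonzero degree then y or x has nonzero degree, and its counit
    vanishes. *)
Lemma hc_deg k (a : A) : pgr k a -> k <> 0 -> hc a = 0.
Proof.
have lh := hc_lin; have la := apr_lin (A := A).
suff E : hc (apr 0 a) = hc a.
  by move=> ga k0; rewrite -E (apr_ne ga) ?linear_mk0 //; exact: nesym.
move: a; apply: A_ind => [|y h x]; first by apply: submod_eq; lin.
move: y (hom_span (half_injY H) (half_gY H) y); apply: span_sub => [|y [j gy]].
  by apply: submod_eq; lin.
move: x (hom_span (half_inj H) (half_gX H) x); apply: span_sub => [|x [i gx]].
  by apply: submod_eq; lin.
have g : pgr (j + i) (iY y * i0 A h * iX x).
  by apply: pgrM => //; rewrite -[j]addr0; apply: pgrM => //; exact: i0_deg.
have [e0|/eqP ne] := eqVneq (j + i) 0; first by rewrite apr_id // -e0.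
rewrite (apr_ne g) ?linear_mk0 //; last exact: nesym.
rewrite hcE; have [j0|/eqP j0] := eqVneq j 0.
  have i0' : i <> 0 by move=> i0'; apply: ne; rewrite j0 i0'.
  by rewrite (pgre_eps gx i0') mulr0 scale0r.
by rewrite (pgre_eps gy j0) mul0r scale0r.
Qed.

Lemma B_submod : submod B. Proof. exact: span_submod. Qed.

Lemma B_mul a b : B a -> B b -> B (a * b).
Proof. by case: (half_hopf H) => _ _ h _ _; exact: h. Qed.

Lemma B_S a : B a -> B (hS A a).
Proof. by case: (half_hopf H) => _ _ _ _; apply. Qed.

Lemma B_gen h x : B (i0 A h * iX x).
Proof. by apply: span_gen; exists h, x. Qed.

Lemma B_i0 h : B (i0 A h).
Proof. by rewrite -[i0 A h]mulr1 -[1](rmorph1 iX); exact: B_gen. Qed.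

Lemma B_X x : B (iX x).
Proof. by rewrite -[iX x]mul1r -[1](rmorph1 (i0 A)); exact: B_gen. Qed.

Lemma sw_B (Z : lmodType K) (f g : A -> A -> Z) b : bilinear2 f -> bilinear2 g ->
  B b -> (forall x y, B x -> B y -> f x y = g x y) -> tlift f (hD A b) = tlift g (hD A b).
Proof.
move=> bf bg Bb fg; case: (half_hopf H) => _ _ _ /(_ b Bb) h _.
exact: (tlift_span (S := B) (S' := B)).
Qed.

Lemma B_ind (P : set A) : submod P -> (forall h, P (i0 A h)) ->
  (forall h k x, DX k -> pgr k (iX x) -> eps (iX x) = 0 -> P (i0 A h * iX x)) ->
  forall b, B b -> P b.
Proof.
move=> sP P0 PX b; move: b; apply: span_sub => // _ [h [x ->]].
move: x; apply: X_ind => [|| k x]; first by apply: submod_pre => //; lin.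
  by rewrite /= rmorph1 mulr1.
exact: PX.
Qed.

Lemma hc_mulBB a b : B a -> B b -> hc (a * b) = hc a * hc b.
Proof.
have lh := hc_lin; move=> Ba; move: b; apply: span_sub => [|_ [h' [x' ->]]].
  by apply: submod_eq; lin.
move: a Ba; apply: B_ind => [|h|h k x Dk gx e0].
- by apply: submod_eq; lin.
- by rewrite mulrA -rmorphM !hcB hc_i0 scalerAr.
rewrite [X in _ = X * _]hcB e0 scale0r mul0r.
move: x'; apply: X_ind => [||k' x' Dk' gx' e0']; first by apply: submod_eq; lin.
  rewrite rmorph1 mulr1; apply: (hc_deg (k := k)).
    by rewrite -[k]addr0; apply: pgrM; [exact: pgr_i0|exact: i0_deg].
  by move=> k0; apply: (half_DX0 H); rewrite -k0.
apply: (hc_deg (k := k + k')); first by apply: pgrM; exact: pgr_i0.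
by move=> k0; apply: (half_DX0 H); rewrite -k0; exact: (half_DXD H).
Qed.

Lemma hc_mulYB y b : B b -> hc (iY y * b) = eps (iY y) *: hc b.
Proof.
have lh := hc_lin; move: b; apply: span_eq; try lin.
by move=> _ [h [x ->]]; rewrite mulrA hcE hcB scalerA.
Qed.

(** Right multiplication by A_0 X acts through a character with values in A_0, as on the generator
    of a universal Verma module. On A_0 X itself both sides vanish in nonzero degree; a left factor
    from Y contributes its counit only. *)
Lemma hc_mulB a b : B b -> hc (a * b) = hc a * hc b.
Proof.
have lh := hc_lin; move=> Bb; move: a; apply: A_ind => [|y h x].
  by apply: submod_eq; lin.
have -> : iY y * i0 A h * iX x * b = iY y * ((i0 A h * iX x) * b) by rewrite !mulrA.
have Bg := B_gen h x; rewrite hc_mulYB; last exact: B_mul.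
by rewrite hc_mulBB // hcE hcB scalerAl scalerA.
Qed.

(** Degrees replace a commutation rule between h and y: if y has nonzero degree in h y h' x, either
    the total degree is nonzero, or x has nonzero degree and its counit kills the product. *)
Lemma hc_i0l h a : hc (i0 A h * a) = h * hc a.
Proof.
have lh := hc_lin; move: a; apply: A_ind => [|y h' x]; first by apply: submod_eq; lin.
move: y; apply: Y_ind => [||j y Dj gy e0]; first by apply: submod_eq; lin.
  by rewrite rmorph1 mul1r mulrA -rmorphM !hcB scalerAr.
rewrite hcE e0 mul0r scale0r mulr0.
have j0 : j <> 0 by move=> j0; apply: (half_DY0 H); rewrite -j0.
move: x (hom_span (half_inj H) (half_gX H) x); apply: span_sub => [|x [i gx]].
  by apply: submod_eq; [lin|exact: lin0].
have g : pgr (j + i) (i0 A h * (iY y * i0 A h' * iX x)).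
  apply: pgr_i0; apply: pgrM => //; rewrite -[j]addr0.
  by apply: pgrM => //; exact: i0_deg.
have [e1|/eqP ne] := eqVneq (j + i) 0; last exact: (hc_deg g).
have i0' : i <> 0 by move=> i0'; apply: j0; rewrite -e1 i0' addr0.
rewrite mulrA hc_mulB; last exact: B_X.
by rewrite hcX (pgre_eps gx i0') scale0r mulr0.
Qed.

Lemma hc_degY c a : gsum (@pgr K A) DY c -> hc (c * a) = 0.
Proof.
have lh := hc_lin; move: c; apply: span_sub => [|c [k Dk gc]].
  by apply: submod_eq; [lin|exact: lin0].
move: a; apply: A_ind => [|y h x]; first by apply: submod_eq; [lin|exact: lin0].
have -> : c * (iY y * i0 A h * iX x) = (c * iY y) * (i0 A h * iX x) by rewrite !mulrA.
rewrite hc_mulB; last exact: B_gen.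
suff -> : hc (c * iY y) = 0 by rewrite mul0r.
move: y; apply: Y_ind => [||j y Dj gy e0]; first by apply: submod_eq; [lin|exact: lin0].
  by rewrite rmorph1 mulr1; apply: (hc_deg gc) => k0; apply: (half_DY0 H); rewrite -k0.
apply: (hc_deg (pgrM gc gy)) => k0; apply: (half_DY0 H); rewrite -k0.
exact: (half_DYD H).
Qed.

Lemma hc_eps b : B b -> eps (hc b) = eps b.
Proof.
have lh := hc_lin; move=> Bb; apply: (@eqKo K); move: b Bb; apply: span_eq; try lin.
move=> _ [h [x ->]]; rewrite hcB epsM eps_i0.
by rewrite (linear_mkZ _ _ (@eps_linear K (p0 A))) /GRing.scale /= mulrC.
Qed.

(** On A_0 X the projection is a morphism of coalgebras: in the coproduct of an element of nonzero
    degree every term has a factor of nonzero degree, which is projected to 0. *)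
Lemma sw_hc (Z : lmodType K) (f : p0 A -> p0 A -> Z) b : bilinear2 f -> B b ->
  tlift f (hD _ (hc b)) = tlift (fun x y => f (hc x) (hc y)) (hD A b).
Proof.
have lh := hc_lin; move=> bf; move: b; apply: B_ind => [|h|h k x Dk gx e0].
- by apply: submod_eq; lin.
- by rewrite hc_i0 sw_i0; [apply: tlift_ext => [||x y]; rewrite ?hc_i0 //; lin|lin].
have k0 : k <> 0 by move=> k0; apply: (half_DX0 H); rewrite -k0.
have g := pgr_i0 h gx; rewrite (hc_deg g k0).
have lf := tlift_linear bf; rewrite linear0 linear_mk0 //; symmetry.
rewrite -[RHS](tlift0 _ (hD A (i0 A h * iX x))); apply: (sw_deg _ _ g); try lin.
move=> i j u v ij gu gv; have [i0'|/eqP i0'] := eqVneq i 0.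
  have j0 : j <> 0 by move=> j0; apply: k0; rewrite -ij i0' j0.
  by rewrite (hc_deg gv j0) (linear_mk0 (bf.2 _)).
by rewrite (hc_deg gu i0') (linear_mk0 (bf.1 _)).
Qed.

End Triangular.

Section VermaModules.
Variables (K : fieldType) (A : polarized K) (X Y : algType K).
Variables (iX : {lrmorphism X -> A}) (iY : {lrmorphism Y -> A}) (DX DY : int -> Prop).
Hypothesis H : half iX iY DX DY.
Variable l : wfun A.
Hypothesis tl : torus l.

Local Notation B := (prodsub (i0 A) iX).
Local Notation M := (verma iX l).
Local Notation v := (verma_vec iX l : verma iX l).
Local Notation kappa := (hc H).

(** A_0 X acts on n as it does on the generator of the Verma module of weight l, so n is the image
    of that generator under a homomorphism. *)
Definition singular (N : amod A) (n : N) : Prop :=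
  forall h x, act (i0 A h * iX x) n = (l h * eps (iX x)) *: n.

Lemma pure_scale (a : A) (c : K) : a \ox (c : K^o) = (c *: a) \ox (1 : K^o).
Proof.
rewrite (linear_mkZ (f := fun a : A => a \ox (1 : K^o))); last lin.
rewrite -(linear_mkZ (f := fun z : K^o => a \ox z)); last lin.
by congr (_ \ox _); rewrite /GRing.scale /= mulr1.
Qed.

Lemma verma_actv a : act a v = qproj (verma_rel iX l) (a \ox (1 : K^o)).
Proof. by rewrite [LHS]verma_actE tmapE ?mulr1 //; exact: lmul_linear. Qed.

Lemma verma_cyclic (m : M) : exists a, m = act a v.
Proof.
have [t ->] := qproj_surj m.
suff [a ->] : exists a, t = a \ox (1 : K^o) by exists a; rewrite verma_actv.
move: t; apply: tens_ind => [|a c].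
  split=> [|c x y [a ->] [b ->]].
    exists 0; symmetry; apply: (linear_mk0 (f := fun a : A => a \ox (1 : K^o))); lin.
  by exists (c *: a + b); rewrite (pure_bilinear A K^o).1.
by exists (c *: a); exact: pure_scale.
Qed.

Lemma verma_sing a h x :
  act (a * (i0 A h * iX x)) v = (l h * eps (iX x)) *: act a v.
Proof.
rewrite !verma_actv -linearZ /=; apply/qprojP; apply: span_gen.
exists a, h, x, 1; congr (_ - _).
rewrite -(linear_mkZ (f := fun z : K^o => a \ox z)); last lin.
by congr (_ \ox _).
Qed.

Lemma verma_vec_singular : singular v.
Proof. by move=> h x; rewrite -[i0 A h * _]mul1r verma_sing act1. Qed.

Lemma verma_lift (Z : lmodType K) (F : A -> Z) : linear F ->
  (forall a h x, F (a * (i0 A h * iX x)) = (l h * eps (iX x)) *: F a) ->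
  exists2 G : M -> Z, linear G & forall a, G (act a v) = F a.
Proof.
move=> lF hF; pose f (a : A) (c : K^o) := (c : K) *: F a.
have bf : bilinear2 f.
  by apply: bil_mk => c; rewrite /f; [lin|apply: lin_scalel; exact: lin_id].
have f0 x : verma_rel iX l x -> mklin (tlift_linear bf) x = 0.
  move=> [a [h [y [c ->]]]]; rewrite linearB /= !tliftE // /f hF scalerA.
  by rewrite [c * _]mulrC subrr.
exists (qlift (tlift f)); first exact: (qlift_linear f0).
by move=> a; rewrite verma_actv (qliftE f0) /= tliftE // /f scale1r.
Qed.

Lemma verma_hom (N : amod A) (n : N) : singular n ->
  exists2 f : M -> N, is_hom f & f v = n.
Proof.
move=> sn; have [||f lf fE] := @verma_lift N (fun a => act a n).
- by lin.
- by move=> a h x; rewrite actM sn (linear_mkZ _ _ ((act_bilinear N).2 a)).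
exists f; last by rewrite -(act1 v) fE act1.
split=> // a m; have [b ->] := verma_cyclic m.
by rewrite -actM !fE actM.
Qed.

Lemma verma_hom_ext (N : amod A) (f g : M -> N) : is_hom f -> is_hom g ->
  f v = g v -> f = g.
Proof.
move=> [lf hf] [lg hg] e; apply: funext => m; have [a ->] := verma_cyclic m.
by rewrite hf hg e.
Qed.

Lemma hom_singular (N : amod A) (f : M -> N) : is_hom f -> singular (f v).
Proof. by move=> [lf hf] h x; rewrite -hf verma_vec_singular linear_mkZ. Qed.

Let ll : linear (l : p0 A -> K^o) := torus_lin tl.

(* The coefficient of v in a v. *)
Definition chi (a : A) : K := l (kappa a).

Lemma chi_lin : linear (chi : A -> K^o).
Proof. by have lk := hc_lin H; rewrite /chi; lin. Qed.

Lemma chi_mulB a b : B b -> chi (a * b) = chi a * chi b.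
Proof. by move=> Bb; case: tl => _ _ lM; rewrite /chi hc_mulB // lM. Qed.

Lemma chi_i0l h a : chi (i0 A h * a) = l h * chi a.
Proof. by case: tl => _ _ lM; rewrite /chi hc_i0l lM. Qed.

Lemma chi_i0 h : chi (i0 A h) = l h.
Proof. by rewrite /chi hc_i0. Qed.

Lemma chi1 : chi 1 = 1.
Proof. by case: tl => _ l1 _; rewrite /chi hc1. Qed.

Lemma chiB h x : chi (i0 A h * iX x) = l h * eps (iX x).
Proof. by rewrite /chi hcB (linear_mkZ _ _ ll) /GRing.scale /= mulrC. Qed.

Lemma chi_deg k (a : A) : pgr k a -> k <> 0 -> chi a = 0.
Proof. by move=> gk k0; rewrite /chi (hc_deg _ gk k0) (linear_mk0 ll). Qed.

Lemma chi_degY c a : gsum (@pgr K A) DY c -> chi (c * a) = 0.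
Proof. by move=> gc; rewrite /chi hc_degY // (linear_mk0 ll). Qed.

Lemma singularB (N : amod A) (n : N) : singular n -> forall b, B b -> act b n = chi b *: n.
Proof.
move=> sn b; have lc := chi_lin; move: b; apply: span_eq; try lin.
by move=> _ [h [x ->]]; rewrite sn chiB.
Qed.

Lemma singular_of (N : amod A) (n : N) :
  (forall b, B b -> act b n = chi b *: n) -> singular n.
Proof. by move=> sn h x; rewrite -chiB; apply: sn; exact: B_gen. Qed.

Lemma verma_dual : exists2 f : M -> K^o, linear f & forall a, f (act a v) = chi a.
Proof.
apply: verma_lift; first exact: chi_lin.
by move=> a h x; rewrite chi_mulB ?chiB 1?mulrC //; exact: B_gen.
Qed.

Lemma verma_grE k m : verma_gr iX l k m <-> exists2 a, pgr k a & m = act a v.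
Proof.
split=> [[a [c [ga ->]]]|[a ga ->]]; last by exists a, 1; rewrite verma_actv.
exists (c *: a); first by apply: submodZ => //; exact: pgr_submod.
by rewrite verma_actv; congr (qproj _ _); exact: pure_scale.
Qed.

(** Together with [verma_Y] this says that the Verma module is free of rank one over Y. The map
    comes from sending y h x to l(h) eps(x) y on A, which respects the relations because [chi] is
    multiplicative on A_0 X. *)
Lemma verma_projY : exists2 p : M -> Y, linear p & forall y, p (act (iY y) v) = y.
Proof.
have [|||F lF FE] := @A_lift _ _ _ _ _ _ _ _ H Y (fun y h x => (l h * eps (iX x)) *: y).
- by lin.
- by move=> y x; apply: lin_scalel; lin.
- by move=> y h; apply: lin_scalel; lin.
have lc := chi_lin.
have FB y b : B b -> F (iY y * b) = chi b *: y.
  move: b; apply: span_eq; try lin.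
  by move=> _ [h [x ->]]; rewrite mulrA FE chiB.
have [|p lp pE] := @verma_lift Y F lF.
  move=> a h x; rewrite -chiB; move: a; apply: (A_ind H) => [|y h' x'].
    by apply: submod_eq; lin.
  have Bg h1 x1 : B (i0 A h1 * iX x1) by exact: B_gen.
  have -> : iY y * i0 A h' * iX x' * (i0 A h * iX x) =
    iY y * ((i0 A h' * iX x') * (i0 A h * iX x)) by rewrite !mulrA.
  rewrite FB; last by apply: (B_mul H).
  by rewrite chi_mulB // FE chiB scalerA mulrC.
exists p => // y; rewrite pE -[iY y]mulr1 -[1](rmorph1 (i0 A)) FB; last exact: B_i0.
by rewrite chi_i0; case: tl => _ -> _; rewrite scale1r.
Qed.

Lemma verma_Y (m : M) : exists y, m = act (iY y) v.
Proof.
have [a ->] := verma_cyclic m; move: a; apply: (A_ind H) => [|y h x].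
  split=> [|c a b [y e] [z f]].
    by exists 0; rewrite (linear_mk0 (lrmorph_linear iY)).
  exists (c *: y + z); rewrite (lrmorph_linear iY).
  by rewrite !(act_bilinear M).1 e f.
exists ((l h * eps (iX x)) *: y); rewrite -mulrA verma_sing.
by rewrite (linear_mkZ _ _ (lrmorph_linear iY)) (linear_mkZ _ _ ((act_bilinear M).1 _)).
Qed.

(** The left ideal B ker(l) of B = A_0 X: the kernel of l in A_0 is spanned by the elements h - l(h)
    1. *)
Definition rideal : set A :=
  span [set z | exists b h, B b /\ z = b * i0 A h - l h *: b].

Lemma rideal_kill (Z : lmodType K) (F : A -> Z) : linear F ->
  (forall b h, B b -> F (b * i0 A h) = l h *: F b) -> forall z, rideal z -> F z = 0.
Proof.
move=> lF hF z; rewrite /rideal; move: z; apply: (span_eq lF (@lin0 _ _ _)) => _ [b [h [Bb ->]]].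
by rewrite linear_mkB // linear_mkZ // hF // subrr.
Qed.

End VermaModules.

(* E and E' realize the isomorphism B / B ker(l) = B / ker(eps) B of spaces of
   coinvariants of the Hopf A_0-bimodule B = A_0 X, and ker(eps) B is
   a complement of X; so X also spans B modulo B ker(l). *)
Section RightGeneration.
Variables (K : fieldType) (A : polarized K) (X Y : algType K).
Variables (iX : {lrmorphism X -> A}) (iY : {lrmorphism Y -> A}) (DX DY : int -> Prop).
Hypothesis H : half iX iY DX DY.
Hypothesis H' : half iY iX DY DX.
Variable l : wfun A.
Hypothesis tl : torus l.

Local Notation B := (prodsub (i0 A) iX).
Local Notation kappa := (hc H).
Local Notation R := (rideal iX l).

Let ll : linear (l : p0 A -> K^o) := torus_lin tl.
Let lN : linear (wopp l : p0 A -> K^o) := torus_lin (torusN tl).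
Let lk := hc_lin H.
Let l0 := lrmorph_linear (i0 A).

(** Translation by m of functions on T: a character takes at [q m h] the value that its sum with m
    takes at h. *)
Let q (m : wfun A) (h : p0 A) : p0 A := tlift (fun x y => m x *: y) (hD _ h).

Let q_lin m : wlin m -> linear (q m).
Proof. by rewrite /wlin => lm; rewrite /q; lin. Qed.

Let qq h : q l (q (wopp l) h) = h.
Proof.
have l1 := q_lin ll; rewrite [X in q l X]/q (tlift_comp (g := q l)); try lin.
transitivity (tlift (fun x y => tlift (fun y1 y2 => (wopp l x * l y1) *: y2) (hD _ y)) (hD (p0 A) h)).
  apply: tlift_ext => [||x y]; try lin.
  rewrite (linear_mkZ _ _ l1) /q (tlift_comp (g := fun z => wopp l x *: z)); try lin.
  by apply: tlift_ext => [||u v]; try lin; rewrite scalerA.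
rewrite -(sw_assoc (f := fun x y z => (wopp l x * l y) *: z)); try lin.
rewrite -[RHS](sw_el (g := fun z => z)); last lin.
apply: tlift_ext => [||x y]; try lin.
rewrite -[eps x]/(@w0 K A x) -(waddNl tl) /wadd.
by rewrite (tlift_comp (g := fun z : K^o => (z : K) *: y)) //; lin.
Qed.

Let s h := q (wopp l) (hS _ h).
Let E (b : A) : A := tlift (fun x y => x * i0 A (s (kappa y))) (hD A b).
Let E' (b : A) : A := tlift (fun x y => i0 A (hS _ (kappa y)) * x) (hD A b).

Let ls : linear s.
Proof. have := q_lin lN; rewrite /s => h; lin. Qed.

Let E_lin : linear E. Proof. rewrite /E; lin. Qed.
Let E'_lin : linear E'. Proof. rewrite /E'; lin. Qed.

(** Hence [E'] depends only on the class of b modulo ker(eps) B. Cocommutativity of A_0 brings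
    S(h_(2)) next to h_(1). *)
Let E'_i0 h b : E' (i0 A h * b) = eps h *: E' b.
Proof.
rewrite /E' swM ?sw_i0; try lin.
transitivity (tlift (fun u v => tlift (fun x y =>
    i0 A (hS _ (kappa v)) * (i0 A (hS _ y * x) * u)) (hD _ h)) (hD A b)).
  rewrite tlift_exch; try lin.
  apply: tlift_ext => [||u v]; try lin; apply: tlift_ext => [||x y]; try lin.
  by rewrite hc_i0l hS_anti !rmorphM !mulrA.
rewrite (tlift_comp (g := fun z => eps h *: z)); try lin.
apply: tlift_ext => [||u v]; try lin.
rewrite -(p0_cocomm h) /hDop tlift_swap; last lin.
rewrite (sw_Sl (g := fun z => i0 A (hS _ (kappa v)) * (i0 A z * u))); last lin.
by rewrite rmorph1 mul1r.
Qed.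

(** F stands for the projection modulo B ker(l), where a right factor from A_0 becomes its value
    under l. This turns s(kappa y) into its translate by l, that is into S(kappa y), which cancels
    against the neighbouring kappa v by the antipode axiom. *)
Let E'E (Z : lmodType K) (F : A -> Z) b : linear F ->
  (forall c h, B c -> F (c * i0 A h) = l h *: F c) -> B b -> F (E' (E b)) = F b.
Proof.
move=> lF hF Bb; have lq := q_lin ll.
have E1 c g : B c -> F (E' (c * i0 A g)) =
    tlift (fun u v => F (i0 A (hS _ (kappa v * q l g)) * u)) (hD A c).
  move=> Bc; rewrite /E' swM; last lin.
  rewrite (tlift_comp (g := F)); try lin; apply: (sw_B H) => // [||u v Bu Bv]; try lin.
  rewrite sw_i0; last lin.
  rewrite (tlift_comp (g := F)); try lin.
  rewrite /q (tlift_comp (g := fun z => F (i0 A (hS _ (kappa v * z)) * u))); try lin.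
  apply: tlift_ext => [||x y]; try lin.
  rewrite hc_mulB; last exact: B_i0.
  rewrite hc_i0 mulrA hF; last by apply: (B_mul H) => //; exact: B_i0.
  by rewrite -(linear_mkZ (f := fun z => F (i0 A (hS _ (kappa v * z)) * u))) //; lin.
rewrite [E b]/E (tlift_comp (g := fun z => F (E' z))); try lin.
transitivity (tlift (fun x y => tlift (fun u v =>
    F (i0 A (hS _ (kappa v * hS _ (kappa y))) * u)) (hD A x)) (hD A b)).
  apply: (sw_B H) => // [||x y Bx By]; try lin.
  by rewrite E1 // /s qq.
rewrite (sw_assoc (f := fun u v y => F (i0 A (hS _ (kappa v * hS _ (kappa y))) * u))); try lin.
rewrite -[RHS](sw_er b lF); apply: (sw_B H) => // [||x y Bx By]; try lin.
rewrite -(sw_hc H (f := fun v y => F (i0 A (hS _ (v * hS _ y)) * x))) //; last lin.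
rewrite (sw_Sr (g := fun z => F (i0 A (hS _ z) * x))); last lin.
by rewrite hS1 rmorph1 mul1r hc_eps.
Qed.

Let E'E_ideal b : B b -> R (E' (E b) - b).
Proof.
move=> Bb; pose S := [set z : A | exists b h, B b /\ z = b * i0 A h - l h *: b].
apply/(qprojP S); apply: (E'E (F := qproj S)) => //; first exact: qproj_is_linear.
move=> c h Bc; rewrite -linearZ; apply/qprojP; apply: span_gen.
by exists c, h.
Qed.

Let E_B b : B b -> B (E b).
Proof.
move=> Bb; have [_ _ _ /(_ b Bb) hb _] := half_hopf H; rewrite /E; move: hb.
have lE : linear (tlift (fun x y => x * i0 A (s (kappa y)))) by apply: tlift_linear; lin.
move: (hD A b); apply: span_sub => [|_ [u [w [Bu Bw ->]]]]; first exact: submod_pre lE (B_submod iX).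
by rewrite /= tliftE; [apply: (B_mul H) => //; exact: B_i0|lin].
Qed.

Let E_deg k b : pgr k b -> pgr k (E b).
Proof.
move=> /pgrD; rewrite /E /tgr; have sk := @pgr_submod K A k.
have lE : linear (tlift (fun x y => x * i0 A (s (kappa y)))) by apply: tlift_linear; lin.
move: (hD A b); apply: span_sub => [|_ [i [j [u [w [gu gw e ->]]]]]]; first exact: submod_pre lE sk.
rewrite /= tliftE; last lin.
have [j0|/eqP j0] := eqVneq j 0.
  by rewrite -[k]addr0; apply: pgrM; [rewrite -e j0 addr0|exact: i0_deg].
by rewrite (hc_deg H gw j0) (linear_mk0 ls) rmorph0 mulr0; exact: sk.1.
Qed.

Let P_exists : exists2 P : A -> X, linear P & forall h x, P (i0 A h * iX x) = eps h *: x.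
Proof.
have [|||P lP PE] := @A_lift _ _ _ _ _ _ _ _ H X (fun y h x => (eps (iY y) * eps h) *: x); try lin.
exists P => // h x; rewrite -[i0 A h]mul1r -[1](rmorph1 iY) PE rmorph1 eps1.
by rewrite mul1r.
Qed.

(** P E is injective on the finite-dimensional space X[d]: an element of X whose image vanishes lies
    in B ker(l), hence kills the generator of the opposite Verma module, which is free over X. So P
    E is onto, and any x in X[d] with P E x = P E b is congruent to b. *)
Lemma right_generation d b : B b -> pgr d b ->
  exists x, pgr d (iX x) /\ R (b - iX x).
Proof.
move=> Bb gb; have [P lP PE] := P_exists; have lX := lrmorph_linear iX.
have la := apr_lin (A := A); have sd := @pgr_submod K A d.
have E'P c : B c -> E' c = E' (iX (P c)).
  move: c; apply: span_eq; try lin; move=> _ [h [x ->]].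
  by rewrite E'_i0 PE (linear_mkZ _ _ lX) (linear_mkZ _ _ E'_lin).
have Pdeg c : B c -> pgr d c -> pgr d (iX (P c)).
  move=> Bc gc; suff <- : apr d (iX (P c)) = iX (P c) by exact: dsum_prP (aprP A).
  rewrite -{2}(apr_id gc); move: c Bc {gc}; apply: span_eq; try lin; move=> _ [h [x ->]].
  move: x (hom_span (half_inj H) (half_gX H) x); apply: span_eq; try lin.
  move=> x [k gx]; have g := pgr_i0 h gx.
  rewrite PE (linear_mkZ _ _ lX) (linear_mkZ _ _ (la d)).
  have [<-|/eqP kd] := eqVneq k d.
    by rewrite !apr_id // PE (linear_mkZ _ _ lX).
  by rewrite (apr_ne gx) ?(apr_ne g) ?(linear_mk0 lP) ?(linear_mk0 lX) ?scaler0 //; exact: nesym.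
pose Xd := [set x | pgr d (iX x)].
have sX : submod Xd by exact: submod_pre lX sd.
have lPE : linear (fun x => P (E (iX x))) by lin.
have Rneg z : R (0 - z) -> R z.
  by rewrite sub0r => /(spanN (K := K)); rewrite opprK.
have PEX x : Xd x -> Xd (P (E (iX x))).
  by move=> Xx; apply: Pdeg; [apply: E_B; exact: B_X|exact: E_deg].
have PEinj x : Xd x -> P (E (iX x)) = 0 -> x = 0.
  move=> Xx e; have := E'E_ideal (@B_X K A X iX x); rewrite E'P; last by apply: E_B; exact: B_X.
  rewrite e (linear_mk0 lX) (linear_mk0 E'_lin) => /Rneg Rx.
  have [p lp pE] := verma_projY H' tl; rewrite -(pE x).
  have lF : linear (fun a => act a (verma_vec iY l : verma iY l)) by lin.
  rewrite (rideal_kill lF _ Rx) ?linear_mk0 // => c h Bc.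
  rewrite -[i0 A h]mulr1 -[1](rmorph1 iY) verma_sing rmorph1 eps1.
  by rewrite mulr1.
have [|x Xx e] := inj_onto sX (half_fin H d) lPE PEX PEinj (y := P (E b)).
  by apply: Pdeg; [exact: E_B|exact: E_deg].
exists x; split=> //; apply: Rneg.
have Bx : B (b - iX x) by apply: (submodB (B_submod iX)) => //; exact: B_X.
have := E'E_ideal Bx; rewrite E'P; last exact: E_B.
by rewrite (linear_mkB _ _ E_lin) (linear_mkB _ _ lP) e subrr (linear_mk0 lX) (linear_mk0 E'_lin).
Qed.

Lemma wproj_i0 (V : amod A) (pr : wfun A -> V -> V) a h v :
  dsum_proj (wspace V) pr -> pr a (act (i0 A h) v) = a h *: pr a v.
Proof.
move=> [sg sp lp p1 p0]; have lpa := lp a; have lact := (act_bilinear V).2.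
move: v (sp v); apply: span_eq; try lin; move=> v [c vc].
have [<-|/eqP ca] := eqVneq c a; first by rewrite vc (linear_mkZ _ _ (lp c)) p1.
by rewrite vc (linear_mkZ _ _ (lp a)) (p0 _ _ _ (nesym ca) vc) !scaler0.
Qed.

(** Let x_i w_i have a nonzero component of weight a_i, and let h_i separate a_i from the other
    weights. Modulo B ker(l), which kills vectors of weight l, each h_i x_i is congruent to some y_i
    in X[d]. The functionals reading off the components of weight a_j show that the y_i are
    independent, so their number is bounded by the size of a spanning list of X[d]. *)
Lemma finite_weights d : exists N, forall (V : amod A) (pr : wfun A -> V -> V)
    (s : seq (wfun A)),
  dsum_proj (wspace V) pr -> uniq s ->
  (forall a, a \in s -> torus a /\ exists x w, [/\ pgr d (iX x), wspace V l w
     & pr a (act (iX x) w) <> 0]) -> (size s <= N)%N.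
Proof.
have [t ht] := half_fin H d; exists (size t) => V pr r hp ur hr.
have [sg sp lp _ _] := hp; have lX := lrmorph_linear iX.
pose a (i : 'I_(size r)) := tnth (in_tuple r) i.
have ar i : a i \in r by exact: mem_tnth.
have a_inj i j : a i = a j -> i = j.
  move=> e; apply/val_inj/eqP.
  rewrite -(nth_uniq (@w0 K A) (ltn_ord i) (ltn_ord j) ur); apply/eqP.
  by move: e; rewrite /a !(tnth_nth (@w0 K A)) /= => ->.
have /choice [xw hxw] i : exists xw : X * V, [/\ pgr d (iX xw.1), wspace V l xw.2
    & pr (a i) (act (iX xw.1) xw.2) <> 0].
  by have [_ [x [w h]]] := hr _ (ar i); exists (x, w).
have /choice [h hh] i : exists h : p0 A, a i h = 1 /\ forall j, j != i -> a j h = 0.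
  have [|h [h1 h0]] := torus_interp (s := rem (a i) r) (hr _ (ar i)).1.
    move=> b; rewrite mem_rem_uniq // inE => /andP[/eqP ne br].
    by split=> //; exact: (hr _ br).1.
  exists h; split=> // j ji; apply: h0; rewrite mem_rem_uniq // inE ar andbT.
  by apply: contraNneq ji => /a_inj ->.
pose f j (b : A) := pr (a j) (act b (xw j).2).
have lf j : linear (f j) by have lpa := lp (a j); rewrite /f; lin.
have fR j z : R z -> f j z = 0.
  apply: (rideal_kill (lf j)) => b g _; rewrite /f actM.
  have [_ wl _] := hxw j; rewrite wl (linear_mkZ _ _ ((act_bilinear V).2 b)).
  by rewrite (linear_mkZ _ _ (lp _)).
have /choice [y hy] i : exists y, pgr d (iX y) /\
    forall j, f j (iX y) = a j (h i) *: f j (iX (xw i).1).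
  have [gx _ _] := hxw i.
  have [y [gy Ry]] := right_generation (@B_gen K A X iX (h i) (xw i).1) (pgr_i0 (h i) gx).
  exists y; split=> // j; have := fR j _ Ry; rewrite (linear_mkB _ _ (lf j)).
  by move=> /eqP; rewrite subr_eq0 => /eqP <-; rewrite /f actM wproj_i0.
apply: (indep_size (p := y)) => [c e j|i]; last by apply: ht; exact: (hy i).1.
have := congr1 (fun z => f j (iX z)) e.
have lfX : linear (fun z => f j (iX z)) by have := lf j => lfj; lin.
rewrite (linear_mk0 lfX) (linear_mksum _ _ _ lfX) /= (bigD1 j) //=.
rewrite (linear_mkZ _ _ lfX) (hy j).2 (hh j).1 scale1r big1 ?addr0 => [/eqP|i ij].
  by rewrite scaler_eq0 => /orP[/eqP//|/eqP]; have [_ _] := hxw j.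
by rewrite (linear_mkZ _ _ lfX) (hy i).2 (hh i).2 1?eq_sym // scale0r scaler0.
Qed.

End RightGeneration.

(** * The pairing between A_+ and Verma modules *)

Section Singular.
Variables (K : fieldType) (A : polarized K).
Implicit Types (l m : wfun A) (V W : amod A).

Local Notation Hp := (half_pos A).
Local Notation Hm := (half_neg A).
Local Notation B := (prodsub (i0 A) (ip A)).
Local Notation phi l := (chi Hp l).

Section Dual.
Variable m : wfun A.
Hypothesis tm : torus m.

Lemma vpdual_spec : [/\ linear (@vpdual K A m : Mp m -> K^o),
  forall a, vpdual (act a (vp m)) = phi m a & vpdual (vp m) = 1].
Proof.
have [f lf fE] := verma_dual Hp tm.
have f1 : f (vp m) = 1 by rewrite -(act1 (vp m)) fE chi1.
pose S := [set f | [/\ linear (f : Mp m -> K^o), f (vp m) = 1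
    & forall k x, k <> 0 -> verma_gr (ip A) m k x -> f x = 0]].
have Sf : S f.
  split=> // k x k0 /verma_grE [a ga ->]; rewrite fE.
  exact: chi_deg ga k0.
have [lg g1 g0] : S (@vpdual K A m) by rewrite /vpdual; case: xgetP => [y -> //|/(_ f)].
suff E x : vpdual x = f x by split=> // a; rewrite E fE.
have [y ->] := verma_Y Hp x; move: y; apply: (Y_ind Hp).
- by apply: (submod_eq (W := K^o)); lin.
- by rewrite rmorph1 act1 f1.
move=> k y Dk gy _; have k0 : k <> 0 by move=> k0; rewrite k0 ltxx in Dk.
rewrite (g0 k) //; last by apply/verma_grE; exists (im A y).
by rewrite fE; symmetry; exact: chi_deg gy k0.
Qed.

Lemma vpdual_lin : linear (@vpdual K A m : Mp m -> K^o).
Proof. by case: vpdual_spec. Qed.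

Lemma vpdualE a : vpdual (act a (vp m)) = phi m a.
Proof. by case: vpdual_spec. Qed.

Lemma vpdual_i0 h x : vpdual (act (i0 A h) x) = m h * vpdual (x : Mp m).
Proof.
by have [a ->] := verma_cyclic x; rewrite -actM !vpdualE chi_i0l.
Qed.

Lemma vpdual_neg c x : gsum (@pgr K A) (fun k => k < 0)%R c ->
  vpdual (act c (x : Mp m)) = 0.
Proof.
by move=> gc; have [a ->] := verma_cyclic x; rewrite -actM vpdualE chi_degY.
Qed.

Lemma vpdual_gr k x : verma_gr (ip A) m k x -> k <> 0 -> vpdual (x : Mp m) = 0.
Proof. by move=> /verma_grE [a ga ->] k0; rewrite vpdualE (chi_deg _ tm ga). Qed.

(* The antipode makes beta (b a) x equal to beta a (S(b) x); hence pairing the first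
   factor of a singular vector z with beta b (ev b z below) gives its coefficient
   acted upon by b, twisted by a character. *)
Definition beta (a : A) (x : Mp m) : K := vpdual (act (hS A a) x).

Lemma beta_linl x : linear (fun a => beta a x : K^o).
Proof. by have lv := vpdual_lin; rewrite /beta; lin. Qed.

Lemma beta_linr a : linear (beta a : Mp m -> K^o).
Proof. by have lv := vpdual_lin; rewrite /beta; lin. Qed.

Lemma beta_S a b x : beta a (act (hS A b) x) = beta (b * a) x.
Proof. by rewrite /beta -actM hS_anti. Qed.

Lemma beta_i0 a h x : beta (a * i0 A h) x = wopp m h * beta a x.
Proof. by rewrite /beta hS_anti actM i0_S vpdual_i0. Qed.

(** S reverses products, so S(y), of negative degree when eps(y) = 0, comes to act last, where v^*
    kills it. With [beta_i0] this makes a |-> [beta a x] a functional on M^-_(-m). *)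
Lemma beta_m a y x : beta (a * im A y) x = eps (im A y) * beta a x.
Proof.
have lv := vpdual_lin; move: y; apply: (Y_ind Hp).
- by apply: (submod_eq (W := K^o)); rewrite /beta; lin.
- by rewrite rmorph1 mulr1 eps1 mul1r.
move=> k y Dk gy e0; rewrite e0 mul0r /beta hS_anti actM vpdual_neg //.
by apply: span_gen; exists k => //; exact: pgrS.
Qed.

Lemma beta_deg k j a x : pgr k a -> verma_gr (ip A) m j x -> k + j <> 0 -> beta a x = 0.
Proof.
move=> ga /verma_grE [b gb ->] kj; rewrite /beta; apply: (vpdual_gr (k := k + j)) => //.
by apply/verma_grE; exists (hS A a * b); [apply: pgrM => //; exact: pgrS|rewrite actM].
Qed.

Lemma verma_gr_span (x : Mp m) : span [set x | exists k, verma_gr (ip A) m k x] x.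
Proof.
have [a ->] := verma_cyclic x; have [_ sp _] := pgr_grading A.
move: a (sp a); apply: span_sub => [|a [k _ ga]].
  by apply: submod_pre; [lin|exact: span_submod].
by apply: span_gen; exists k; apply/verma_grE; exists a.
Qed.

Lemma verma_gr_submod k : submod (verma_gr (ip A) m k).
Proof.
have sk := @pgr_submod K A k; split=> [|c x y].
  apply/verma_grE; exists 0; first exact: sk.1.
  by symmetry; apply: (linear_mk0 (f := fun a : A => act a (vp m))); lin.
move=> /verma_grE[a ga ->] /verma_grE[b gb ->]; apply/verma_grE.
exists (c *: a + b); first exact: sk.2.
by rewrite (act_bilinear (Mp m)).1.
Qed.

Hypothesis irr1 : irreducible (verma (ip A) m).
Hypothesis irr2 : irreducible (verma (im A) (wopp m)).

(** By [beta_S] the vectors of M^-_(-m) killed by all the functionals [beta _ x] form a submodule.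
    It does not contain the generator, which pairs to 1 with [vp m], so it is zero by
    irreducibility; and A_+ acts freely on the generator. *)
Lemma beta_nondeg (p : pp A) : (forall x, beta (ip A p) x = 0) -> p = 0.
Proof.
move=> bp; pose v' : verma (im A) (wopp m) := verma_vec (im A) (wopp m).
have th x : exists2 t : verma (im A) (wopp m) -> K^o, linear t &
    forall a, t (act a v') = beta a x.
  apply: verma_lift; first exact: beta_linl.
  by move=> a h y; rewrite mulrA beta_m beta_i0 mulrA; congr (_ * _); rewrite mulrC.
have /choice [t ht] : forall x, exists t : verma (im A) (wopp m) -> K^o, linear t /\
    forall a, t (act a v') = beta a x.
  by move=> x; have [t] := th x; exists t.
pose N : set (verma (im A) (wopp m)) := [set n | forall x, t x n = 0].
have sN : submod N.
  split=> [x|c n n' hn hn' x]; first exact: (linear_mk0 (ht x).1).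
  by rewrite (ht x).1 hn hn' scaler0 addr0.
have aN a n : N n -> N (act a n).
  move=> hn x; have [b e] := verma_cyclic n.
  by rewrite e -actM (ht x).2 -beta_S -(ht _).2 -/v' -e hn.
case: irr2 => _ /(_ N sN aN) [] eN.
  have [q lq qE] := verma_projY Hm (torusN tm); rewrite -[p]qE.
  suff -> : act (ip A p) v' = 0 by exact: linear_mk0.
  have : N (act (ip A p) v') by move=> x; rewrite (ht x).2.
  by rewrite eN.
have : N v' by rewrite eN.
move=> /(_ (vp m)); rewrite -(act1 v') (ht _).2 /beta hS1 act1.
have [_ _ ->] := vpdual_spec => /eqP; by rewrite oner_eq0.
Qed.

(** Testing against A_+ amounts to testing against A, since v^* kills what A_- produces in negative
    degree and is an eigenvector for A_0. The vectors orthogonal to all of A form a submodule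
    without the generator. *)
Lemma dual_nondeg (x : Mp m) : (forall p, vpdual (act (ip A p) x) = 0) -> x = 0.
Proof.
have lv := vpdual_lin; move=> hx.
pose N : set (Mp m) := [set n | forall a, vpdual (act a n) = 0].
have sN : submod N.
  split=> [a|c n n' hn hn' a].
    by rewrite (linear_mk0 ((act_bilinear (Mp m)).2 a)) (linear_mk0 lv).
  by rewrite (act_bilinear (Mp m)).2 lv hn hn' scaler0 addr0.
have aN a n : N n -> N (act a n) by move=> hn b; rewrite -actM.
have Nx : N x.
  apply: (A_ind Hp) => [|y h p]; first by apply: (submod_eq (W := K^o)); lin.
  rewrite -mulrA; move: y; apply: (Y_ind Hp).
  - by apply: (submod_eq (W := K^o)); lin.
  - by rewrite rmorph1 mul1r actM vpdual_i0 hx mulr0.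
  move=> k y Dk gy _; rewrite actM vpdual_neg //; apply: span_gen; by exists k.
case: irr1 => _ /(_ N sN aN) [] eN; first by move: Nx; rewrite eN.
have : N (vp m) by rewrite eN.
move=> /(_ 1); rewrite act1; have [_ _ ->] := vpdual_spec => /eqP; by rewrite oner_eq0.
Qed.

Lemma verma_dual_bases (d : int) : exists n (p : 'I_n -> pp A) (q : 'I_n -> Mp m),
  [/\ forall i, pgr d (ip A (p i)), forall i, verma_gr (ip A) m (- d) (q i),
      forall x, pgr d (ip A x) -> x = \sum_i beta (ip A x) (q i) *: p i
    & forall y, verma_gr (ip A) m (- d) y -> y = \sum_i beta (ip A (p i)) y *: q i].
Proof.
have lv := vpdual_lin; have lX := lrmorph_linear (ip A).
apply: (dual_bases (X := [set p | pgr d (ip A p)])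
  (* Irreducibility of M^+_m serves the plain form [b1], that of M^-_(-m) the form [b2] with the
     antipode. Both pair degree d with degree -d only, so nondegeneracy holds degree by degree. *)
  (b1 := fun p x => vpdual (act (ip A p) x)) (b2 := fun p x => beta (ip A p) x)).
- by apply: submod_pre => //; exact: pgr_submod.
- exact: verma_gr_submod.
- exact: ip_fin.
- lin.
- lin.
- by move=> x; rewrite /beta; lin.
- by move=> x; exact: beta_linr.
- move=> x gx hx; apply: dual_nondeg => p.
  move: p (hom_span (half_inj Hp) (half_gX Hp) p).
  apply: (span_sub (V := pp A)) => [|p [k gp]].
    by apply: (submod_eq (W := K^o)); lin.
  have [e|/eqP ne] := eqVneq k d; first by apply: hx; rewrite /= -e.
  move: gx => /verma_grE [a ga ->]; rewrite -actM vpdualE; apply: (chi_deg _ tm (pgrM gp ga)).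
  by move=> /eqP; rewrite subr_eq0 => /eqP.
- move=> p gp hp; apply: beta_nondeg => x.
  move: x (verma_gr_span x); apply: (span_sub (V := Mp m)) => [|x [k gx]].
    by apply: (submod_eq (W := K^o)); [exact: beta_linr|exact: lin0].
  have [e|/eqP ne] := eqVneq k (- d); first by apply: hp; rewrite /= -e.
  apply: (beta_deg gp gx) => e; apply: ne; apply/eqP.
  by rewrite -[k](addKr d) e addr0.
Qed.

End Dual.

End Singular.

(** * Singular vectors in tensor products *)

Section SingularVectors.
Variables (K : fieldType) (A : polarized K).
Implicit Types (l m : wfun A).

Local Notation Hp := (half_pos A).
Local Notation Hm := (half_neg A).
Local Notation B := (prodsub (i0 A) (ip A)).
Local Notation phi l := (chi Hp l).

Variables (l m : wfun A).
Hypotheses (tl : torus l) (tm : torus m).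

Let lphi : linear (phi l : A -> K^o) := chi_lin Hp tl.
Let lbeta_l := beta_linl tm.
Let lbeta_r := beta_linr tm.

(** [chi] is a character of the Hopf algebra A_0 A_+, so its composition with S is its convolution
    inverse there. *)
Lemma chi_convl (Z : lmodType K) (z : Z) y : B y ->
  tlift (fun y1 y2 => (phi l (hS A y1) * phi l y2) *: z) (hD A y) = eps y *: z.
Proof.
move=> By; transitivity (tlift (fun y1 y2 => phi l (hS A y1 * y2) *: z) (hD A y)).
  by apply: (sw_B Hp) => // [||x y' Bx By']; try lin; rewrite chi_mulB.
by rewrite (sw_Sl (g := fun a => phi l a *: z)) ?chi1 ?scale1r //; lin.
Qed.

Lemma chi_convr (Z : lmodType K) (z : Z) y : B y ->
  tlift (fun y1 y2 => (phi l y1 * phi l (hS A y2)) *: z) (hD A y) = eps y *: z.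
Proof.
move=> By; transitivity (tlift (fun y1 y2 => phi l (y1 * hS A y2) *: z) (hD A y)).
  by apply: (sw_B Hp) => // [||x y' Bx By']; try lin; rewrite chi_mulB //; exact: (B_S Hp).
by rewrite (sw_Sr (g := fun a => phi l a *: z)) ?chi1 ?scale1r //; lin.
Qed.

Section Module.
Variable V : amod A.

Definition actL (a : A) (z : tens (Mp m) V) : tens (Mp m) V := act2 (a \ox 1) z.
Definition actR (a : A) (z : tens (Mp m) V) : tens (Mp m) V := act2 (1 \ox a) z.

Lemma actL_bil : bilinear2 actL. Proof. by rewrite /actL; lin. Qed.
Lemma actR_bil : bilinear2 actR. Proof. by rewrite /actR; lin. Qed.

Lemma actLM a b z : actL (a * b) z = actL a (actL b z).
Proof. by rewrite /actL -act2M tmulE mulr1. Qed.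

Lemma actL1 z : actL 1 z = z.
Proof. exact: act2_1. Qed.

Lemma act_tensE a (z : tens (Mp m) V) :
  act a (z : tensm (Mp m) V) = tlift (fun x y => actL x (actR y z)) (hD A a).
Proof.
transitivity (act2 (hD A a) z); first by [].
rewrite -{1}(tlift_pure (hD A a)) (tlift_comp (g := fun d => act2 d z)); try lin.
have bL := actL_bil; have bR := actR_bil.
apply: tlift_ext => [||x y]; try lin.
by rewrite /actL /actR -act2M tmulE mulr1 mul1r.
Qed.

Definition ev (a : A) (z : tens (Mp m) V) : V := tlift (fun x u => beta a x *: u) z.

Let bev a : bilinear2 (fun (x : Mp m) (u : V) => beta a x *: u).
Proof. by have := lbeta_r a => h; lin. Qed.

Lemma evE a x u : ev a (x \ox u) = beta a x *: u.
Proof. by rewrite /ev tliftE. Qed.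

Lemma ev_bil : bilinear2 ev.
Proof.
rewrite /ev; apply: bil_mk => w; last exact: tlift_linear.
by apply: lin_tlift_fun => // x u; apply: lin_scalel; exact: lbeta_l.
Qed.

Lemma ev_actR a b z : ev a (actR b z) = act b (ev a z).
Proof.
have bL := ev_bil; have bR := actR_bil.
move: z; apply: tens_ext; try lin.
move=> x u; rewrite /actR act2E act1 !evE.
by rewrite (linear_mkZ _ _ ((act_bilinear V).2 b)).
Qed.

Lemma ev_actL a b z : ev a (actL (hS A b) z) = ev (b * a) z.
Proof.
have bL := ev_bil; have bR := actL_bil.
move: z; apply: tens_ext; try lin.
by move=> x u; rewrite /actL act2E act1 !evE beta_S.
Qed.

Lemma ev_i0 a h z : ev (a * i0 A h) z = wopp m h *: ev a z.
Proof.
have bL := ev_bil; move: z; apply: tens_ext; try lin.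
by move=> x u; rewrite !evE beta_i0 // scalerA.
Qed.

Lemma vp_coefE z : vp_coef z = ev 1 z.
Proof.
have lv := vpdual_lin tm; apply: tlift_ext; try lin => //.
by move=> x u; rewrite /beta hS1 act1.
Qed.

(** Apply S(b_(1)) on the first factor to the action of b_(2) on x, which is a scalar. The antipode
    cancels the first leg of the coproduct, and only b on the second factor remains. *)
Lemma singular_actR (x : tens (Mp m) V) b : singular (ip A) l (x : tensm (Mp m) V) -> B b ->
  actR b x = tlift (fun b1 b2 => phi l b2 *: actL (hS A b1) x) (hD A b).
Proof.
move=> sx Bb; have bL := actL_bil; have bR := actR_bil; symmetry.
transitivity (tlift (fun b1 b2 => actL (hS A b1)
    (tlift (fun x1 x2 => actL x1 (actR x2 x)) (hD A b2))) (hD A b)).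
  apply: (sw_B Hp) => // [||b1 b2 B1 B2]; try lin.
  by rewrite -act_tensE (singularB Hp tl sx) // (linear_mkZ _ _ (bL.2 _)).
transitivity (tlift (fun b1 b2 => tlift (fun x1 x2 =>
    actL (hS A b1 * x1) (actR x2 x)) (hD A b2)) (hD A b)).
  apply: tlift_ext => [||b1 b2]; try lin.
  rewrite (tlift_comp (g := actL (hS A b1))); try lin.
  by apply: tlift_ext => [||x1 x2]; try lin; rewrite actLM.
rewrite -(sw_assoc (f := fun u y z => actL (hS A u * y) (actR z x))); try lin.
rewrite -(sw_el (g := fun y => actR y x) b); last lin.
apply: tlift_ext => [||u y]; try lin.
by rewrite (sw_Sl (g := fun a => actL a (actR y x))) ?actL1 //; lin.
Qed.

Lemma singular_of_actR (x : tens (Mp m) V) :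
  (forall b, B b -> actR b x = tlift (fun b1 b2 => phi l b2 *: actL (hS A b1) x) (hD A b)) ->
  singular (ip A) l (x : tensm (Mp m) V).
Proof.
move=> hx; have bL := actL_bil; have bR := actR_bil.
apply: (singular_of (H := Hp) tl) => b Bb; rewrite act_tensE.
transitivity (tlift (fun b1 y => tlift (fun y1 y2 =>
    phi l y2 *: actL (b1 * hS A y1) x) (hD A y)) (hD A b)).
  apply: (sw_B Hp) => // [||b1 y B1 By]; try lin.
  rewrite hx // (tlift_comp (g := actL b1)); try lin.
  by apply: tlift_ext => [||y1 y2]; try lin; rewrite (linear_mkZ _ _ (bL.2 _)) actLM.
rewrite -(sw_assoc (f := fun b1 y1 y2 => phi l y2 *: actL (b1 * hS A y1) x)); try lin.
rewrite -(sw_el (g := fun y => phi l y *: (x : tens _ _)) b); last lin.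
apply: tlift_ext => [||w y]; try lin.
by rewrite (sw_Sr (g := fun a => phi l y *: actL a x)) ?actL1 //; lin.
Qed.

Lemma singular_coef (x : tens (Mp m) V) b : singular (ip A) l (x : tensm (Mp m) V) -> B b ->
  act b (vp_coef x) = tlift (fun b1 b2 => phi l b2 *: ev b1 x) (hD A b).
Proof.
move=> sx Bb; have bL := actL_bil; have bR := actR_bil; have be := ev_bil.
rewrite vp_coefE -ev_actR (singular_actR sx) // (tlift_comp (g := ev 1)); try lin.
apply: tlift_ext => [||b1 b2]; try lin.
by rewrite (linear_mkZ _ _ (be.2 1)) ev_actL mulr1.
Qed.

Lemma coef_weight (x : tens (Mp m) V) : singular (ip A) l (x : tensm (Mp m) V) ->
  wspace V (wsub l m) (vp_coef x).
Proof.
move=> sx h; have be := ev_bil; rewrite (singular_coef sx); last exact: B_i0.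
have ll : linear (l : _ -> K^o) := torus_lin tl.
have lm : linear (wopp m : _ -> K^o) := torus_lin (torusN tm).
rewrite sw_i0; last lin; rewrite /wsub waddC // /wadd.
rewrite (tlift_comp (g := fun z : K^o => (z : K) *: vp_coef x)); first last.
- lin.
- by apply: lin_scalel; exact: lin_id.
apply: tlift_ext => [||h1 h2]; try lin.
by rewrite chi_i0 -[i0 A h1]mul1r ev_i0 -vp_coefE scalerA mulrC.
Qed.

(** The formula of [singular_coef] is inverted by convolution with [chi] composed with S. All values
    [ev b x] are thus determined by the coefficient of x. *)
Lemma ev_of_coef (x : tens (Mp m) V) b : singular (ip A) l (x : tensm (Mp m) V) -> B b ->
  ev b x = tlift (fun b1 b2 => phi l (hS A b2) *: act b1 (vp_coef x)) (hD A b).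
Proof.
move=> sx Bb; have be := ev_bil; symmetry.
transitivity (tlift (fun b1 b2 => tlift (fun u w =>
   (phi l w * phi l (hS A b2)) *: ev u x) (hD A b1)) (hD A b)).
  apply: (sw_B Hp) => // [||b1 b2 B1 B2]; try lin.
  rewrite (singular_coef sx) // (tlift_comp (g := fun z => phi l (hS A b2) *: z)); try lin.
  by apply: tlift_ext => [||u w]; try lin; rewrite scalerA mulrC.
rewrite (sw_assoc (f := fun u w y => (phi l w * phi l (hS A y)) *: ev u x)); try lin.
rewrite -(sw_er (g := fun y => ev y x) b); last lin.
by apply: (sw_B Hp) => // [||u y Bu By]; try lin; rewrite chi_convr.
Qed.

End Module.

End SingularVectors.

(** * Uniqueness and existence of singular vectors *)

Section SingularExistence.
Variables (K : fieldType) (A : polarized K).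
Variables (l m : wfun A) (V : amod A).
Hypotheses (tl : torus l) (tm : torus m).
Hypothesis irr1 : irreducible (verma (ip A) m).
Hypothesis irr2 : irreducible (verma (im A) (wopp m)).

Local Notation Hp := (half_pos A).
Local Notation B := (prodsub (i0 A) (ip A)).
Local Notation phi l := (chi Hp l).

Let lphi : linear (phi l : A -> K^o) := chi_lin Hp tl.
Let lbeta_l := beta_linl tm.
Let lbeta_r := beta_linr tm.

Definition dual_basis_at (d : int)
    (D : {n & (('I_n -> pp A) * ('I_n -> Mp m))%type}) : Prop :=
  let p := (projT2 D).1 in let q := (projT2 D).2 in
  [/\ forall i, pgr d (ip A (p i)), forall i, verma_gr (ip A) m (- d) (q i),
      forall x, pgr d (ip A x) -> x = \sum_i beta (ip A x) (q i) *: p i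
    & forall y, verma_gr (ip A) m (- d) y -> y = \sum_i beta (ip A (p i)) y *: q i].

Lemma dual_basis_family : exists D, forall d, dual_basis_at d (D d).
Proof.
have h d : exists D, dual_basis_at d D.
  have [n [p [q h]]] := verma_dual_bases tm irr1 irr2 d.
  by exists (existT _ n (p, q)).
by have [D DP] := choice h; exists D.
Qed.

(** By the dual basis property, the sum of q_i (x) ev p_i z over the dual bases in degree d projects
    the first factor of z to degree -d; summing over finitely many d recovers z from the values
    [ev p z]. *)
Lemma ev_separates (z : tens (Mp m) V) : (forall p, ev (ip A p) z = 0) -> z = 0.
Proof.
have [D DP] := dual_basis_family; have be := ev_bil tm V.
pose T d (z : tens (Mp m) V) : tens (Mp m) V :=
  \sum_i (projT2 (D d)).2 i \ox ev (ip A ((projT2 (D d)).1 i)) z.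
have lT d : linear (T d) by rewrite /T; apply: lin_sum => i; lin.
have [s hs] : exists s : seq int, forall t, uniq t -> {subset s <= t} ->
    z = \sum_(d <- t) T d z.
  move: z; apply: tens_ind => [|x u].
    split=> [|c x y [s hs] [t ht]].
      by exists [::] => t _ _; rewrite big1 // => d _; exact: linear_mk0 (lT d).
    exists (s ++ t) => r ur sr; have [ex ey] := (hs r ur, ht r ur).
    transitivity (c *: (\sum_(d <- r) T d x) + \sum_(d <- r) T d y).
      rewrite -ex => [|d ds]; last by apply: sr; rewrite mem_cat ds.
      by rewrite -ey // => d dt; apply: sr; rewrite mem_cat dt orbT.
    by rewrite scaler_sumr -big_split /=; apply: eq_bigr => d _; rewrite (lT d).
  move: x (verma_gr_span x); apply: (span_sub (V := Mp m)) => [|x [k gx]].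
    split=> [|c x y [s hs] [t ht]].
      exists [::] => t _ _; have e0 : (0 : Mp m) \ox u = 0.
        by apply: (linear_mk0 (f := fun x : Mp m => x \ox u)); lin.
      by rewrite e0 big1 // => d _; exact: linear_mk0 (lT d).
    exists (s ++ t) => r ur sr; rewrite (pure_bilinear (Mp m) V).1.
    have [ex ey] := (hs r ur, ht r ur).
    transitivity (c *: (\sum_(d <- r) T d (x \ox u)) + \sum_(d <- r) T d (y \ox u)).
      rewrite -ex => [|d ds]; last by apply: sr; rewrite mem_cat ds.
      by rewrite -ey // => d dt; apply: sr; rewrite mem_cat dt orbT.
    by rewrite scaler_sumr -big_split /=; apply: eq_bigr => d _; rewrite (lT d).
  have TE d : T d (x \ox u) = if d == - k then x \ox u else 0.
    have [g1 g2 h1 h2] := DP d; case: eqP => [dk|dk].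
      rewrite [x in RHS]h2; last by rewrite dk opprK.
      rewrite (linear_mksum _ _ _ (f := fun x : Mp m => x \ox u)); last lin.
      apply: eq_bigr => i _; rewrite evE //.
      rewrite (linear_mkZ (f := fun x : Mp m => x \ox u)); last lin.
      by rewrite -(linear_mkZ (f := fun u : V => _ \ox u)) //; lin.
    rewrite /T big1 // => i _; rewrite evE // (beta_deg tm (g1 i) gx); last first.
      by move=> /eqP; rewrite addr_eq0 => /eqP.
    by rewrite scale0r (linear_mk0 (f := fun u : V => _ \ox u)) //; lin.
  exists [:: - k] => t ut st; rewrite (bigD1_seq (- k)) //=; last first.
    by apply: st; rewrite mem_head.
  rewrite TE eqxx big1 ?addr0 // => d /negPf dk; by rewrite TE dk.
move=> hz; rewrite (hs (undup s)) ?undup_uniq // => [|d]; last by rewrite mem_undup.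
rewrite big1 // => d _; rewrite /T big1 // => i _.
by rewrite hz (linear_mk0 (f := fun u : V => _ \ox u)) //; lin.
Qed.

Lemma singular_unique (x y : tens (Mp m) V) :
  singular (ip A) l (x : tensm (Mp m) V) -> singular (ip A) l (y : tensm (Mp m) V) ->
  vp_coef x = vp_coef y -> x = y.
Proof.
move=> sx sy e; apply/eqP; rewrite -subr_eq0; apply/eqP; apply: ev_separates => p.
have be := ev_bil tm V; rewrite (linear_mkB _ _ (be.2 _)).
by rewrite !(ev_of_coef tl tm _ (B_X p)) // e subrr.
Qed.

Variable v : V.
Hypothesis wv : wspace V (wsub l m) v.
Hypothesis bv : exists N : nat, forall (d : int) (a : A), (N%:Z < d)%R -> pgr d a -> act a v = 0.

(* The value that ev a x must have on a singular vector x of coefficient v. *)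
Definition twist (a : A) : V := tlift (fun a1 a2 => phi l (hS A a2) *: act a1 v) (hD A a).

Lemma twist_lin : linear twist.
Proof. by rewrite /twist; lin. Qed.

Lemma twist1 : twist 1 = v.
Proof. by rewrite /twist sw1 ?hS1 ?chi1 ?scale1r ?act1 //; lin. Qed.

(** The same rule as for [ev]: the weight l - m of v and the factor -l from [chi] composed with S
    add up to -m. *)
Lemma twist_i0 a h : twist (a * i0 A h) = wopp m h *: twist a.
Proof.
have ll : linear (l : _ -> K^o) := torus_lin tl.
rewrite /twist swM; last lin; rewrite (tlift_comp (g := fun z => wopp m h *: z)); try lin.
have lN : linear (wopp l : _ -> K^o) := torus_lin (torusN tl).
have ls : linear (wsub l m : _ -> K^o) := torus_lin (torusB tl tm).
apply: tlift_ext => [||x y]; try lin.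
rewrite sw_i0; last lin.
have -> : wopp m h = wadd (wsub l m) (wopp l) h.
  have tN := torusN tm; rewrite /wsub (waddC (torus_lin tl)) ?waddA ?waddN ?wadd0 //;
  exact: torus_lin || (apply: torus_lin; exact: torusN).
rewrite /wadd (tlift_comp (g := fun z : K^o => (z : K) *: (phi l (hS A y) *: act x v))); first last.
- by lin.
- by apply: lin_scalel; exact: lin_id.
apply: tlift_ext => [||h1 h2]; try lin.
rewrite hS_anti i0_S chi_i0l // actM wv (linear_mkZ _ _ ((act_bilinear V).2 x)).
by rewrite !scalerA; congr (_ *: _); rewrite mulrC mulrA.
Qed.

Lemma twist_deg (d : int) (a : A) : pgr d a ->
  span [set u | exists2 b : A, pgr d b & u = act b v] (twist a).
Proof.
move=> /pgrD; rewrite /twist /tgr; move: (hD A a).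
have lt : linear (tlift (fun a1 a2 => phi l (hS A a2) *: act a1 v)) by lin.
apply: span_sub => [|_ [i [j [x [y [gx gy e ->]]]]]].
  by apply: submod_pre lt _; exact: span_submod.
rewrite /= tliftE; last lin.
have [j0|/eqP j0] := eqVneq j 0; last by rewrite (chi_deg Hp tl (pgrS gy) j0) scale0r; exact: span0.
by apply: spanZ; apply: span_gen; exists x => //; rewrite -e j0 addr0.
Qed.

(** The vector x is the sum of q_i (x) twist p_i over dual bases, so that [ev p x = twist p] on A_+
    by construction. The last clause records that apart from the leading term only vectors of A v in
    the second factor occur; it controls the weights involved. *)
Lemma singular_exists : exists x : tens (Mp m) V,
  [/\ singular (ip A) l (x : tensm (Mp m) V), vp_coef x = v
    & span [set z | exists q d a, [/\ (0 < d)%R, pgr d (a : A) & z = q \ox act a v]]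
        (x - vp m \ox v)].
Proof.
have [D DP] := dual_basis_family; have be := ev_bil tm V; have lt := twist_lin.
have bL := actL_bil m V; have bR := actR_bil m V.
have [N hN] := bv.
pose S d : tens (Mp m) V := \sum_i (projT2 (D d)).2 i \ox twist (ip A ((projT2 (D d)).1 i)).
(* A_+ lives in degrees at least 0, and [twist] vanishes in degrees above N because v is killed
   there; so the degrees from 0 to N suffice. *)
pose s := [seq n%:Z | n <- iota 0 N.+1].
pose x := \sum_(d <- s) S d.
have us : uniq s by rewrite map_inj_uniq ?iota_uniq // => i j [].
have ms d : d \in s = (0 <= d)%R && (d <= N%:Z)%R.
  apply/mapP/idP => [[n]|]; first by rewrite mem_iota => /andP[_ h] ->; rewrite lez_nat.
  case: d => // n; rewrite lez_nat => /andP[_ h]; exists n => //.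
  by rewrite mem_iota.
have twist0 (d : int) a : pgr d a -> (N%:Z < d)%R -> twist a = 0.
  move=> ga Nd; apply: (span_sub (submod0 V) _ (twist_deg ga)) => _ [b gb ->].
  exact: hN gb.
have evx e p : pgr e (ip A p) -> ev (ip A p) x = twist (ip A p).
  move=> gp; rewrite /x (linear_mksum _ _ _ (be.2 _)).
  have evS d : ev (ip A p) (S d) = if d == e then twist (ip A p) else 0.
    have [g1 g2 h1 h2] := DP d; rewrite (linear_mksum _ _ _ (be.2 _)).
    case: eqP => [de|de].
      rewrite [p in RHS]h1; last by rewrite de.
      have ltp : linear (fun p => twist (ip A p)) by lin.
      rewrite (linear_mksum _ _ _ ltp); apply: eq_bigr => i _.
      by rewrite evE // (linear_mkZ _ _ ltp).
    rewrite big1 // => i _; rewrite evE // (beta_deg tm gp (g2 i)) ?scale0r //.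
    by move=> /eqP; rewrite subr_eq0 => /eqP /esym.
  have [es|es] := boolP (e \in s).
    rewrite (bigD1_seq e) //= evS eqxx big1 ?addr0 // => d /negPf de.
    by rewrite evS de.
  rewrite big_seq big1 => [|d ds]; last first.
    by rewrite evS; case: eqP => // de; rewrite -de ds in es.
  move: es; rewrite ms negb_and -!ltNge => /orP[e0|eN]; last by rewrite (twist0 _ _ gp eN).
  have [->|[e1 _]|[e1 _]] := hom_cases (half_inj Hp) (half_degX Hp) (half_DX0 Hp) gp.
  - by rewrite (linear_mk0 (lrmorph_linear (ip A))) (linear_mk0 lt).
  - by have := lt_trans e0 e1; rewrite ltxx.
  - by rewrite e1 ltxx in e0.
have evp p : ev (ip A p) x = twist (ip A p).
  have lX := lrmorph_linear (ip A).
  move: p (hom_span (half_inj Hp) (half_gX Hp) p).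
  by apply: span_eq => [||p [k gp]]; [lin|lin|exact: evx gp].
(* A_+ spans A_0 A_+ modulo right multiples of the kernel of -m, and both sides transform by -m
   under right multiplication by A_0. *)
have evB b : B b -> ev b x = twist b.
  move: b; apply: span_eq; try lin; move=> _ [h [p ->]].
  have lX := lrmorph_linear (ip A).
  move: p (hom_span (half_inj Hp) (half_gX Hp) p).
  apply: span_eq => [||p [k gp]]; try lin.
  have [p' [gp' Rp]] := right_generation Hp (half_neg A) (torusN tm) (B_gen h p) (pgr_i0 h gp).
  apply/eqP; rewrite -subr_eq0; apply/eqP.
  pose F b := ev b x - twist b.
  have lF : linear F by rewrite /F; lin.
  suff : F (i0 A h * ip A p - ip A p') = 0.
    by rewrite (linear_mkB _ _ lF) /F evp subrr subr0.
  apply: (rideal_kill lF _ Rp) => b g Bb.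
  by rewrite /F ev_i0 // twist_i0 scalerBr.
(* The criterion of [singular_of_actR] is tested against every [ev p]. Both sides then involve only
   [twist]; on the right, expanding twist (b_(1) p) yields two values of [chi] that cancel by
   [chi_convl]. *)
have sx : singular (ip A) l (x : tensm (Mp m) V).
  apply: singular_of_actR => // b Bb; apply/eqP; rewrite -subr_eq0; apply/eqP.
  apply: ev_separates => p; rewrite (linear_mkB _ _ (be.2 _)).
  apply/eqP; rewrite subr_eq0; apply/eqP; rewrite ev_actR // evp.
  rewrite (tlift_comp (g := ev (ip A p))); try lin.
  transitivity (tlift (fun b1 b2 => tlift (fun u w =>
     (phi l (hS A w) * phi l b2) *: act u (twist (ip A p))) (hD A b1)) (hD A b)).
    rewrite (sw_assoc (f := fun u w y => (phi l (hS A w) * phi l y) *: act u (twist (ip A p)))); try lin.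
    rewrite -(sw_er (g := fun y => act y (twist (ip A p))) b); last lin.
    by apply: (sw_B Hp) => // [||u y Bu By]; try lin; rewrite chi_convl.
  apply: (sw_B Hp) => // [||b1 b2 B1 B2]; try lin.
  rewrite (linear_mkZ _ _ (be.2 _)) ev_actL // evB; last by apply: (B_mul Hp) => //; exact: B_X.
  rewrite {2}/twist swM; last lin.
  rewrite (tlift_comp (g := fun z => phi l b2 *: z)); try lin.
  apply: (sw_B Hp) => // [||u w Bu Bw]; try lin.
  rewrite {1}/twist (tlift_comp (g := act u)); try lin.
  rewrite !(tlift_comp (g := fun z => _ *: z)); try lin.
  apply: tlift_ext => [||p1 p2]; try lin.
  rewrite (linear_mkZ _ _ ((act_bilinear V).2 u)) hS_anti chi_mulB //; last exact: (B_S Hp).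
  by rewrite !scalerA actM; congr (_ *: _); rewrite (mulrC (phi l (hS A w))) -mulrA (mulrC (phi l (hS A w))).
exists x; split=> //.
  by rewrite vp_coefE // -[1](rmorph1 (ip A)) evp rmorph1 twist1.
(* In degree 0 the algebra A_+ consists of scalars, so every p_i is a multiple of 1 and twist 1 = v
   can be pulled out of the sum. *)
have S0 : S 0 = vp m \ox v.
  have [g1 g2 h1 h2] := DP 0.
  have gv : verma_gr (ip A) m (- 0) (vp m).
    by rewrite oppr0; apply/verma_grE; exists 1; [exact: pgr1|rewrite act1].
  rewrite {1}(h2 _ gv) (linear_mksum _ _ _ (f := fun y : Mp m => y \ox v)); last lin.
  apply: eq_bigr => i _; set p := (projT2 (D 0)).1 i; set q := (projT2 (D 0)).2 i.
  have [e|[+ _]|[_ e]] := hom_cases (half_inj Hp) (half_degX Hp) (half_DX0 Hp) (g1 i).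
  - rewrite /p e (linear_mk0 (lrmorph_linear (ip A))) (linear_mk0 lt).
    rewrite (linear_mk0 (lbeta_l _)) scale0r (linear_mk0 (f := fun y : Mp m => y \ox v)); last lin.
    by apply: (linear_mk0 (f := fun u : V => q \ox u)); lin.
  - by rewrite ltxx.
  rewrite -/p in e; rewrite e; set c := eps _.
  rewrite (linear_mkZ _ _ (lrmorph_linear (ip A))) rmorph1 (linear_mkZ _ _ lt) twist1.
  rewrite (linear_mkZ _ _ (lbeta_l _)) /beta hS1 act1; have [_ _ ->] := vpdual_spec tm.
  rewrite (linear_mkZ (f := fun u : V => q \ox u)); last lin.
  by rewrite (linear_mkZ (f := fun y : Mp m => y \ox v)) ?[_ *: 1]mulr1 //; lin.
have s0 : 0 \in s by rewrite ms lexx.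
rewrite /x (bigD1_seq 0) //= S0 addrAC subrr add0r big_seq_cond.
apply: submod_sum => [|d /andP[ds d0]]; first exact: span_submod.
have d1 : (0 < d)%R by rewrite lt_neqAle eq_sym d0; move: ds; rewrite ms => /andP[].
apply: submod_sum => [|i _]; first exact: span_submod.
have [g1 g2 h1 h2] := DP d; set q := (projT2 (D d)).2 i.
move: (twist_deg (g1 i)); set w := twist _; move: w.
apply: span_sub => [|_ [a ga ->]].
  by apply: (submod_pre (f := fun u : V => q \ox u)); [lin|exact: span_submod].
by apply: span_gen; exists q, d, a.
Qed.

End SingularExistence.

(** * Fusion matrices *)

Section TensorProducts.
Variables (K : fieldType) (A : hopf K).
Implicit Types M N V W U : amod A.

Lemma tactE V W a (v : V) (w : W) :
  act a (v \ox w : tensm V W) = tlift (fun x y => act x v \ox act y w) (hD A a).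
Proof.
transitivity (act2 (hD A a) (v \ox w)); first by [].
rewrite -{1}(tlift_pure (hD A a)) (tlift_comp (g := fun d => act2 d (v \ox w))); try lin.
by apply: tlift_ext => [||x y]; try lin; rewrite act2E.
Qed.

Lemma tact_linl V W (z : tens V W) : linear (fun a => act a (z : tensm V W)).
Proof. exact: (act_bilinear (tensm V W)).1. Qed.

Lemma tact_linr V W a : linear (fun z : tens V W => act a (z : tensm V W) : tens V W).
Proof. exact: (act_bilinear (tensm V W)).2. Qed.

Lemma tassoc_hom V W U : is_hom (fun x : tensm (tensm V W) U => tassoc x : tensm V (tensm W U)).
Proof.
split=> [|a]; first exact: tassoc_linear.
have l1 := @tact_linr V (tensm W U) a; have l2 := @tact_linr (tensm V W) U a.
apply: tens_ext => [||x u].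
- exact: lin_tassoc l2.
- exact: lin_comp l1 (@tassoc_linear _ _ _ _).
move: x; apply: tens_ext => [||v w].
- by apply: lin_tassoc; apply: (lin_comp l2); lin.
- by apply: (lin_comp l1); lin.
rewrite tassocE !tactE (tlift_comp (g := @tassoc K V W U)); first last.
- apply: bil_mk => ?; last by lin.
  by apply: lin_purel; exact: tact_linl.
- exact: tassoc_linear.
transitivity (tlift (fun x y => tlift (fun x1 x2 =>
    act x1 v \ox (act x2 w \ox act y u)) (hD A x)) (hD A a)).
  apply: tlift_ext => [||x y]; try lin.
  rewrite tactE (tlift_comp (g := fun z => tassoc (z \ox act y u))); try lin.
  by apply: tlift_ext => [||x1 x2]; try lin; rewrite tassocE.
rewrite (sw_assoc (f := fun x y z => act x v \ox (act y w \ox act z u))); try lin.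
apply: tlift_ext => [||x y]; try lin.
by rewrite tactE (tlift_comp (g := fun z => act x v \ox z)) //; lin.
Qed.

Lemma tmap_hom V W V' W' (f : V -> V') (g : W -> W') : is_hom f -> is_hom g ->
  is_hom (fun x : tensm V W => tmap f g x : tensm V' W').
Proof.
move=> [lf hf] [lg hg]; split=> [|a]; first exact: tmap_linear.
have l1 := @tact_linr V W a; have l2 := @tact_linr V' W' a.
have lt := tmap_linear lf lg.
apply: tens_ext => [||v w].
- exact: lin_comp lt l1.
- exact: lin_comp l2 lt.
rewrite tmapE // !tactE (tlift_comp (g := tmap f g)); try lin.
by apply: tlift_ext => [||x y]; try lin; rewrite tmapE // hf hg.
Qed.

Lemma id_hom V : is_hom (idfun : V -> V).
Proof. by split. Qed.

Lemma comp_hom V W U (g : W -> U) (f : V -> W) : is_hom g -> is_hom f ->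
  is_hom (fun x => g (f x)).
Proof. by move=> [lg hg] [lf hf]; split=> [|a m]; [exact: lin_comp|rewrite hf hg]. Qed.

Lemma tassocK (V W U : lmodType K) (x : tens (tens V W) U) : tassocV (tassoc x) = x.
Proof.
move: x; apply: tens_ext => [||x u]; try lin.
move: x; apply: tens_ext => [||v w]; try lin.
by rewrite tassocE tassocVE.
Qed.

Lemma tassocVK (V W U : lmodType K) (x : tens V (tens W U)) : tassoc (tassocV x) = x.
Proof.
move: x; apply: tens_ext => [||v x]; try lin.
move: x; apply: tens_ext => [||w u]; try lin.
by rewrite tassocVE tassocE.
Qed.

Lemma tswapK (V W : lmodType K) (x : tens V W) : tswap (tswap x) = x.
Proof. by move: x; apply: tens_ext => [||v w]; try lin; rewrite !tswapE. Qed.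

End TensorProducts.

Section WeightSpaces.
Variables (K : fieldType) (A : polarized K).
Implicit Types (a b c l m n : wfun A) (V W U : amod A).

Lemma wspace_submod V a : submod (wspace V a).
Proof.
split=> [h|c x y hx hy h]; first by rewrite scaler0 (linear_mk0 ((act_bilinear V).2 _)).
by rewrite (act_bilinear V).2 hx hy scalerDr !scalerA mulrC.
Qed.

Lemma wspace_torus V a v : wspace V a v -> v <> 0 -> torus a.
Proof.
move=> wv /eqP v0.
have inj (x y : K) : x *: v = y *: v -> x = y.
  move=> /eqP; rewrite -subr_eq0 -scalerBl scaler_eq0 (negPf v0) orbF subr_eq0.
  by move/eqP.
have l0 := lrmorph_linear (i0 A); split.
- move=> c x y; apply: inj; rewrite -wv l0 (act_bilinear V).1 !wv.
  by rewrite scalerDl scalerA.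
- by apply: inj; rewrite -wv rmorph1 act1 scale1r.
- move=> g h; apply: inj; rewrite -wv rmorphM actM wv.
  by rewrite (linear_mkZ _ _ ((act_bilinear V).2 _)) wv scalerA mulrC.
Qed.

Definition diagonal V : Prop :=
  forall v, span [set u | exists2 l, torus l & wspace V l u] v.

(** The index set is all functions on A_0: those that are not characters have zero weight space.
    Independence follows by letting a separating element of A_0 act. *)
Lemma wspace_dsum V : diagonal V -> dsum (wspace V).
Proof.
move=> dV; apply: dsum_of_indep => [a|v|s f us wf e a as_]; first exact: wspace_submod.
  move: v (dV v); apply: span_mono => v [l _ wv]; by apply: span_gen; exists l.
have [->//|/eqP fa] := eqVneq (f a) 0.
have ta := wspace_torus (wf a) fa.
have [|h [ah hh]] := torus_interp (s := [seq b <- s | (b != a) && (f b != 0)]) ta.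
  move=> b; rewrite mem_filter => /andP[/andP[/eqP ba /eqP fb] _].
  by split=> //; exact: wspace_torus (wf b) fb.
have lh := (act_bilinear V).2 (i0 A h).
have := congr1 (act (i0 A h)) e; rewrite (linear_mk0 lh) (linear_mksum _ _ _ lh).
rewrite (bigD1_seq a) //= wf ah scale1r big_seq_cond big1 ?addr0 // => b /andP[bs ba].
rewrite wf; have [->|fb] := eqVneq (f b) 0; first by rewrite scaler0.
by rewrite hh ?scale0r // mem_filter ba fb.
Qed.

Lemma wspace_tens V W a b v w : wspace V a v -> wspace W b w ->
  wspace (tensm V W) (wadd a b) (v \ox w).
Proof.
move=> wv ww; have [v0|/eqP v0] := eqVneq v 0.
  have -> : v \ox w = 0 by rewrite v0 (linear_mk0 (f := fun v => v \ox w)) //; lin.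
  exact: (wspace_submod (tensm V W) _).1.
have [w0|/eqP w0] := eqVneq w 0.
  have -> : v \ox w = 0 by rewrite w0 (linear_mk0 (f := fun w => v \ox w)) //; lin.
  exact: (wspace_submod (tensm V W) _).1.
have la : linear (a : _ -> K^o) := torus_lin (wspace_torus wv v0).
have lb : linear (b : _ -> K^o) := torus_lin (wspace_torus ww w0).
move=> h; rewrite tactE sw_i0; last lin.
rewrite /wadd (tlift_comp (g := fun z : K^o => (z : K) *: (v \ox w))); first last.
- lin.
- by apply: lin_scalel; exact: lin_id.
apply: tlift_ext => [||x y]; try lin.
rewrite wv ww (linear_mkZ (f := fun v => v \ox _)); last lin.
by rewrite (linear_mkZ (f := fun w => v \ox w)) ?scalerA //; lin.
Qed.

Lemma diagonal_tens V W : diagonal V -> diagonal W -> diagonal (tensm V W).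
Proof.
move=> dV dW; apply: tens_ind => [|v w]; first exact: span_submod.
apply: (span_pure2 (span_submod _) _ (dV v) (dW w)) => {}v {}w [a ta wv] [b tb ww].
apply: span_gen; exists (wadd a b); [exact: torusD|exact: wspace_tens].
Qed.

Lemma hom_wspace V W (f : V -> W) a v : is_hom f -> wspace V a v -> wspace W a (f v).
Proof. by move=> [lf hf] wv h; rewrite -hf wv linear_mkZ. Qed.

End WeightSpaces.

Section CategoryO.
Variables (K : fieldType) (A : polarized K).
Variables V W : catO A.

Lemma tgr_dsum (V' W' : lmodType K) (g : int -> set V') (h : int -> set W') :
  dsum g -> dsum h -> dsum (tgr g h).
Proof.
move=> dg dh; have := dsum_coarsen (fun p : int * int => p.1 + p.2) (dsum_tens dg dh).
apply: dsum_equiv => k x; split.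
  apply: span_mono => {}x [[i j] /= e]; apply: span_mono => _ [v [w [gv hw ->]]].
  by apply: span_gen; exists i, j, v, w.
apply: span_mono => _ [i [j [v [w [gv hw e ->]]]]]; apply: span_gen.
by exists (i, j) => //; apply: span_gen; exists v, w.
Qed.

Lemma tensO_grading : is_grading (tgr (@ogr K A V) (@ogr K A W)).
Proof. by apply/dsum_grading/tgr_dsum; apply: grading_dsum; exact: ogr_grading. Qed.

Lemma tgr_act (V' W' : amod A) (g : int -> set V') (h : int -> set W') :
  (forall k l a v, pgr k a -> g l v -> g (k + l) (act a v)) ->
  (forall k l a v, pgr k a -> h l v -> h (k + l) (act a v)) ->
  forall k l a (x : tensm V' W'), pgr k a -> tgr g h l x -> tgr g h (k + l) (act a x).
Proof.
move=> hg hh k l a x ga; have l1 := @tact_linr _ A V' W' a.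
rewrite /tgr; move: x; apply: (span_sub (V := tens V' W')) => [|_ [i [j [v [w [gv hw <- ->]]]]]].
  by apply: (submod_pre l1); exact: span_submod.
rewrite tactE; move: (pgrD ga); rewrite /tgr; move: (hD A a).
have lt : linear (tlift (fun x y => act x v \ox act y w)) by lin.
apply: span_sub => [|_ [i' [j' [x [y [gx gy <- ->]]]]]].
  by apply: (submod_pre lt); exact: span_submod.
rewrite /= tliftE; last lin; apply: span_gen.
exists (i' + i), (j' + j), (act x v), (act y w); split=> //.
- exact: hg.
- exact: hh.
by rewrite addrACA.
Qed.

Lemma tensO_bounded : exists N : int, forall (k : int) v, (N < k)%R ->
  tgr (@ogr K A V) (@ogr K A W) k v -> v = 0.
Proof.
have [N hN] := ogr_bounded V; have [M hM] := ogr_bounded W.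
exists (N + M) => k v Nk; move: v; apply: span_eq; [exact: lin_id|exact: lin0|].
move=> _ [i [j [v [w [gv hw e ->]]]]].
have [Ni|iN] := ltP N i.
  by rewrite (hN _ _ Ni gv) (linear_mk0 (f := fun v => v \ox w)) //; lin.
have Mj : (M < j)%R by move: Nk; rewrite -e; lia.
by rewrite (hM _ _ Mj hw) (linear_mk0 (f := fun w => v \ox w)) //; lin.
Qed.

Definition tensO : catO A := @CatO K A (tensm V W) _ tensO_grading
  (tgr_act (@ogr_act K A V) (@ogr_act K A W)) tensO_bounded
  (diagonal_tens (@o_diag K A V) (@o_diag K A W)).

(** Boundedness of the grading in the form that makes the sum over dual bases finite. N depends on
    v, through the lowest degree among its components. *)
Lemma ogr_nilp (v : V) : exists N : nat, forall (d : int) (a : A),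
  (N%:Z < d)%R -> pgr d a -> act a v = 0.
Proof.
have [B hB] := ogr_bounded V; have [sg sp _] := ogr_grading V.
move: v (sp v); apply: span_sub => [|v [k _ gv]].
  split=> [|c x y [N hN] [M hM]].
    by exists 0%N => d a _ _; exact: (linear_mk0 ((act_bilinear V).2 a)).
  exists (maxn N M) => d a; move=> dN ga; rewrite (act_bilinear V).2.
  rewrite (hN d) ?(hM d) ?scaler0 ?addr0 //; lia.
exists `|B - k|%N => d a dN ga; apply: (hB (d + k)); last exact: ogr_act.
lia.
Qed.

End CategoryO.

Section Intertwiners.
Variables (K : fieldType) (A : polarized K).
Implicit Types (a b c l m n : wfun A) (V W U : amod A).

Local Notation Hp := (half_pos A).

(** The condition on the target M_m under which intertwiners into its tensor products exist and are
    unique; the source M_l is arbitrary. *)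
Definition irr m : Prop :=
  irreducible (verma (ip A) m) /\ irreducible (verma (im A) (wopp m)).

Lemma generic_and (P Q : wfun A -> Prop) :
  generic P -> generic Q -> generic (fun l => P l /\ Q l).
Proof.
move=> gP gQ; have g (i : nat) : generic (if i is 0%N then P else Q) by case: i.
by apply: generic_imp (generic_forall g) => l _ h; split; [exact: (h 0%N)|exact: (h 1%N)].
Qed.

Lemma generic_irr : nondegenerate_polarized A -> generic irr.
Proof.
move=> hA; apply: generic_imp (generic_and hA (generic_opp hA)) => l _.
by move=> [[h _] [_ h']].
Qed.

Lemma vp_coef_lin m V : torus m -> linear (@vp_coef K A m V).
Proof.
move=> tm; have lv := vpdual_lin tm; apply: tlift_linear.
by apply: bil_mk => ?; lin.
Qed.

Lemma vp_coef_pure m V x (v : V) : torus m -> vp_coef (x \ox v) = vpdual (x : Mp m) *: v.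
Proof. by move=> tm; have lv := vpdual_lin tm; rewrite /vp_coef tliftE //; lin. Qed.

Lemma vp_coef_map m V W (g : V -> W) (z : tens (Mp m) V) : torus m -> linear g ->
  vp_coef (tmap idfun g z) = g (vp_coef z).
Proof.
move=> tm lg; have lc V' := @vp_coef_lin m V' tm.
have lt := tmap_linear (@id_linear K (Mp m)) lg.
move: z; apply: tens_ext => [||x v].
- exact: lin_comp (lc W) lt.
- exact: lin_comp lg (lc V).
by rewrite tmapE // !vp_coef_pure // linear_mkZ.
Qed.

Lemma Phi_definedP l m V : irr m -> torus l -> torus m ->
  (forall v : V, exists N : nat, forall (d : int) (a : A),
     (N%:Z < d)%R -> pgr d a -> act a v = 0) ->
  Phi_defined l m V (wsub l m).
Proof.
move=> [irr1 irr2] tl tm bV v wv.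
have [x [sx cx _]] := singular_exists tl tm irr1 irr2 wv (bV v).
have [f hf fx] := @verma_hom _ _ _ _ l (tensm (Mp m) V) x sx.
exists f; split=> [|g [hg cg]]; first by split=> //; rewrite fx.
apply: verma_hom_ext => //; rewrite fx.
apply: (singular_unique tl tm irr1 irr2 sx); first exact: hom_singular.
by rewrite cg.
Qed.

Lemma PhiP l m V a (v : V) : Phi_defined l m V a -> wspace V a v ->
  is_intertwiner v (Phi l m v).
Proof. by move=> dV wv; rewrite /Phi; case: xgetP => [f -> //|h]; have [f [/h]] := dV v wv. Qed.

Lemma Phi_uniq l m V a (v : V) f : Phi_defined l m V a -> wspace V a v ->
  is_intertwiner v f -> f = Phi l m v.
Proof.
move=> dV wv hf; have [g [_ hg]] := dV v wv.
by rewrite -(hg _ hf); apply: hg; exact: PhiP dV wv.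
Qed.

Lemma lin_hom (M N : amod A) (f g : M -> N) (k : K) : is_hom f -> is_hom g ->
  is_hom (fun x => k *: f x + g x).
Proof.
move=> [lf hf] [lg hg]; split=> [|a x]; first by lin.
by rewrite hf hg (act_bilinear N).2.
Qed.

Lemma Phi_lin l m V a k (v w : V) x : torus m -> Phi_defined l m V a ->
  wspace V a v -> wspace V a w -> Phi l m (k *: v + w) x = k *: Phi l m v x + Phi l m w x.
Proof.
move=> tm dV wv ww; have [hv cv] := PhiP dV wv; have [hw cw] := PhiP dV ww.
suff -> : Phi l m (k *: v + w) = fun x => k *: Phi l m v x + Phi l m w x by [].
symmetry; apply: (Phi_uniq dV); first exact: (wspace_submod V a).2.
split; first exact: lin_hom.
by rewrite (@vp_coef_lin m V tm) cv cw.
Qed.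

Lemma Phi2_hom l m n W V a b (w : W) (v : V) :
  Phi_defined l m V a -> Phi_defined m n W b -> wspace V a v -> wspace W b w ->
  is_hom (Phi2 l m n w v).
Proof.
move=> dV dW wv ww; have [hv _] := PhiP dV wv; have [hw _] := PhiP dW ww.
exact: (comp_hom (@tassoc_hom _ _ (Mp n) W V) (comp_hom (tmap_hom hw (@id_hom _ _ V)) hv)).
Qed.

Section Fusion.
Variables (W V : amod A) (l : wfun A).
Hypotheses (dW : diagonal W) (dV : diagonal V) (tl : torus l).

(** The value forced upon J(w (x) v): an intertwiner can only be the one attached to its own
    coefficient. *)
Definition fcoef b a (w : W) (v : V) : tens W V :=
  let m := wsub l a in let n := wsub m b in vp_coef (Phi2 l m n w v (vp l) : tens (Mp n) (tensm W V)).

Lemma fcoef_linr b a w : torus a -> torus b -> fusion_defined W V l b a -> wspace W b w ->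
  forall k v v', wspace V a v -> wspace V a v' ->
  fcoef b a w (k *: v + v') = k *: fcoef b a w v + fcoef b a w v'.
Proof.
move=> ta tb [d1 d2 d3] ww k v v' wv wv'; rewrite /fcoef /Phi2.
have tm := torusB tl ta; have tn := torusB tm tb.
have [[lw _] _] := PhiP d2 ww.
have lt := tmap_linear lw (@id_linear K V).
pose F (z : tens (Mp (wsub l a)) V) : tens W V :=
  @vp_coef K A (wsub (wsub l a) b) (tensm W V) (tassoc (tmap (Phi (wsub l a) (wsub (wsub l a) b) w) idfun z)).
have lF : linear F.
  exact: lin_comp (@vp_coef_lin _ (tensm W V) tn) (lin_comp (@tassoc_linear _ _ _ _) lt).
rewrite -[LHS]/(F (Phi l (wsub l a) (k *: v + v') (vp l))).
by rewrite (Phi_lin _ _ tm d1 wv wv'); exact: lF.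
Qed.

Lemma fcoef_linl b a v : torus a -> torus b -> fusion_defined W V l b a -> wspace V a v ->
  forall k w w', wspace W b w -> wspace W b w' ->
  fcoef b a (k *: w + w') v = k *: fcoef b a w v + fcoef b a w' v.
Proof.
move=> ta tb [d1 d2 d3] wv k w w' ww ww'; rewrite /fcoef /Phi2.
have tm := torusB tl ta; have tn := torusB tm tb.
have [[lw _] _] := PhiP d2 ww; have [[lw' _] _] := PhiP d2 ww'.
have ws := (wspace_submod W b).2 k w w' ww ww'.
have [[lws _] _] := PhiP d2 ws.
have lt := tmap_linear lw (@id_linear K V); have lt' := tmap_linear lw' (@id_linear K V).
have lts := tmap_linear lws (@id_linear K V).
pose F (f : Mp (wsub l a) -> tens (Mp (wsub (wsub l a) b)) W) (z : tens (Mp (wsub l a)) V) : tens W V :=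
  @vp_coef K A (wsub (wsub l a) b) (tensm W V) (tassoc (tmap f idfun z)).
have lF f : linear (tmap f idfun : tens (Mp (wsub l a)) V -> tens _ _) -> linear (F f).
  move=> lf.
  exact: lin_comp (@vp_coef_lin _ (tensm W V) tn) (lin_comp (@tassoc_linear _ _ _ _) lf).
have [[h1 h2] h3] := (lF _ lt, lF _ lt', lF _ lts).
have h4 : linear (fun z => k *: F (Phi (wsub l a) (wsub (wsub l a) b) w) z +
  F (Phi (wsub l a) (wsub (wsub l a) b) w') z) by lin.
suff E x u : F (Phi (wsub l a) (wsub (wsub l a) b) (k *: w + w')) (x \ox u) =
    k *: F (Phi (wsub l a) (wsub (wsub l a) b) w) (x \ox u) +
    F (Phi (wsub l a) (wsub (wsub l a) b) w') (x \ox u).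
  exact: (tens_ext h3 h4 E).
rewrite /F !tmapE // (Phi_lin _ _ tn d2 ww ww').
set y := Phi _ _ w x; set y' := Phi _ _ w' x.
have lG : linear (fun z : tens (Mp (wsub (wsub l a) b)) W =>
   @vp_coef K A (wsub (wsub l a) b) (tensm W V) (tassoc (z \ox u))).
  apply: (lin_comp (@vp_coef_lin _ (tensm W V) tn)); lin.
exact: lG.
Qed.

Lemma fcoef_intertwiner b a w v : torus a -> torus b -> fusion_defined W V l b a ->
  wspace W b w -> wspace V a v ->
  wspace (tensm W V) (wadd a b) (fcoef b a w v) /\
  is_intertwiner (fcoef b a w v : tensm W V) (Phi2 l (wsub l a) (wsub (wsub l a) b) w v).
Proof.
move=> ta tb [d1 d2 d3] ww wv; have hh := Phi2_hom d1 d2 wv ww.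
have tm := torusB tl ta; have tn := torusB tm tb.
split; last by split.
have -> : wadd a b = wsub l (wsub (wsub l a) b).
  by rewrite -wsubDA // wsubKK //; exact: torusD.
apply: (coef_weight tl tn); exact: hom_singular hh.
Qed.

Lemma fusion_exists : exists J, is_fusion W V l J.
Proof.
have [prW hW] := wspace_dsum dW; have [prV hV] := wspace_dsum dV.
have [_ _ lW W1 _] := hW; have [_ _ lV V1 _] := hV.
(* The pairs of weights where intertwiners prescribe J; on the other components G is the identity,
   as the convention demands. *)
pose ok (p : wfun A * wfun A) := [/\ torus p.1, torus p.2 & fusion_defined W V l p.1 p.2].
pose G p (w : W) (v : V) : tens W V := if `[< ok p >] then
  fcoef p.1 p.2 (prW p.1 w) (prV p.2 v) else prW p.1 w \ox prV p.2 v.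
have bG p : bilinear2 (G p).
  rewrite /G; case: asboolP => [[tb ta fd]|_].
    split=> [v k w w'|w k v v']; rewrite ?lW ?lV.
      by apply: fcoef_linl => //; exact: dsum_prP.
    by apply: fcoef_linr => //; exact: dsum_prP.
  have l1 := lW p.1; have l2 := lV p.2; lin.
have [|J lJ JE] := dsum_ext (dsum_tens (wspace_dsum dW) (wspace_dsum dV))
  (f := fun p => tlift (G p)); first by move=> p; exact: tlift_linear.
have JG b a w v : wspace W b w -> wspace V a v -> J (w \ox v) =
    if `[< ok (b, a) >] then fcoef b a w v else w \ox v.
  move=> ww wv; rewrite (JE (b, a)); last by apply: span_gen; exists w, v.
  by rewrite tliftE // /G /= W1 // V1.
exists J; split=> // b a w v tb ta ww wv m n; rewrite (JG b a) //.
case: asboolP => [[_ _ fd]|nd]; split=> [fd'|nfd] //; last by case: nd.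
have [ws hi] := fcoef_intertwiner ta tb fd ww wv; split=> //.
by case: fd => _ _ d3; apply: (Phi_uniq d3).
Qed.

Lemma fusionP : is_fusion W V l (fusion W V l).
Proof. by have [J hJ] := fusion_exists; rewrite /fusion; case: xgetP => [f ->//|/(_ J)]. Qed.

Lemma fusion_lin : linear (fusion W V l : tens W V -> tens W V).
Proof. by case: fusionP. Qed.

Lemma fusionE b a (w : W) (v : V) : torus b -> torus a -> wspace W b w -> wspace V a v ->
  fusion_defined W V l b a -> fusion W V l (w \ox v) = fcoef b a w v.
Proof.
move=> tb ta ww wv fd; have [_ /(_ b a w v tb ta ww wv) [/(_ fd) [ws e] _]] := fusionP.
by have [_ _ d3] := fd; rewrite /fcoef /= e; have [_ ->] := PhiP d3 ws.
Qed.

Lemma fusion_weight b a (w : W) (v : V) : torus b -> torus a ->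
  wspace W b w -> wspace V a v -> fusion_defined W V l b a ->
  wspace (tensm W V) (wadd a b) (fusion W V l (w \ox v)).
Proof.
move=> tb ta ww wv fd; rewrite (fusionE tb ta) //.
by have [] := fcoef_intertwiner ta tb fd ww wv.
Qed.

Lemma fusion_Phi b a (w : W) (v : V) : torus b -> torus a ->
  wspace W b w -> wspace V a v -> fusion_defined W V l b a ->
  Phi l (wsub (wsub l a) b) (fusion W V l (w \ox v) : tensm W V) =
  Phi2 l (wsub l a) (wsub (wsub l a) b) w v.
Proof.
by move=> tb ta ww wv fd; have [_ /(_ b a w v tb ta ww wv) [/(_ fd) [ws e] _]] := fusionP.
Qed.

Lemma fusion_undef b a (w : W) (v : V) : torus b -> torus a ->
  wspace W b w -> wspace V a v -> ~ fusion_defined W V l b a ->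
  fusion W V l (w \ox v) = w \ox v.
Proof.
by move=> tb ta ww wv fd; have [_ /(_ b a w v tb ta ww wv) [_ /(_ fd)]] := fusionP.
Qed.

End Fusion.

End Intertwiners.

(** * Unipotence and invertibility of the fusion matrix *)

Section Unipotent.
Variables (K : fieldType) (X : lmodType K) (F : int -> set X) (J : X -> X) (N : int).
Hypotheses (sF : forall j, submod (F j)) (decF : forall j x, F (j + 1) x -> F j x).
Hypotheses (F0 : forall j x, (N < j)%R -> F j x -> x = 0).
Hypotheses (lJ : linear J) (JF : forall j x, F j x -> F (j + 1) (J x - x)).

(** Downward induction on j from above N, where F j is zero: y itself solves J z = y up to an error
    in F (j + 1), which the next level corrects. *)
Lemma unipotent_bij j :
  (forall y, F j y -> exists2 z, F j z & J z = y) /\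
  (forall z, F j z -> J z = 0 -> z = 0).
Proof.
have [n] : exists n : nat, (N < j + n%:Z)%R by exists `|N - j|%N.+1; lia.
elim: n j => [|n IH] j nj.
  have Fj0 x : F j x -> x = 0 by apply: F0; lia.
  split=> [y /Fj0 ->|z /Fj0//]; exists 0; last exact: linear_mk0.
  exact: (sF j).1.
have [|IH1 IH2] := IH (j + 1); first by lia.
split=> [y Fy|z Fz Jz].
  have [z' Fz' e] := IH1 _ (submodN (sF _) (JF Fy)).
  exists (y + z'); first by apply: submodD => //; exact: decF.
  by rewrite (linear_mkD _ _ lJ) e opprB addrC subrK.
apply: IH2 => //; have := JF Fz; rewrite Jz sub0r => /(submodN (sF _)).
by rewrite opprK.
Qed.

End Unipotent.

Section VermaGrading.
Variables (K : fieldType) (A : polarized K) (m : wfun A).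
Hypothesis tm : torus m.

Local Notation Hp := (half_pos A).

Lemma apr_mulr k i (a b : A) : pgr i b -> apr k (a * b) = apr (k - i) a * b.
Proof.
move=> gb; have [l1 l2] := (apr_lin (A := A) k, apr_lin (A := A) (k - i)).
have [_ sp _] := pgr_grading A; move: a (sp a); apply: span_eq; try lin.
move=> a [j _ ga]; have gab := pgrM ga gb.
have [e|/eqP ne] := eqVneq (j + i) k.
  by rewrite -e addrK !apr_id.
rewrite (apr_ne gab); last exact: nesym.
by rewrite (apr_ne ga) ?mul0r // => e; apply: ne; rewrite -e subrK.
Qed.

(** The degree projections of A descend to M_m: right multiplication by h x of degree i shifts
    degrees by i, but the scalar l(h) eps(x) it acts by vanishes unless i = 0. *)
Lemma verma_gr_dsum : dsum (verma_gr (ip A) m).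
Proof.
have vp0 : linear (fun a : A => act a (vp m)) by lin.
have E k : exists F : Mp m -> Mp m, linear F /\
    forall a, F (act a (vp m)) = act (apr k a) (vp m).
  have la := apr_lin (A := A) k; have lX := lrmorph_linear (ip A).
  have [||F lF FE] := @verma_lift K A (pp A) (ip A) m (Mp m) (fun a => act (apr k a) (vp m)).
  - lin.
  - move=> a h x; have le := @eps_linear K A.
    move: x (hom_span (half_inj Hp) (half_gX Hp) x); apply: span_eq; try lin.
    move=> x [i gx]; rewrite (apr_mulr _ _ (pgr_i0 h gx)) verma_sing.
    have [->|/eqP i0] := eqVneq i 0; first by rewrite subr0.
    by rewrite (pgre_eps gx i0) mulr0 !scale0r.
  - by exists F.
have [F hF] := choice E; exists F; split.
- exact: verma_gr_submod.
- exact: verma_gr_span.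
- by move=> k; exact: (hF k).1.
- by move=> k x /verma_grE [a ga ->]; rewrite (hF k).2 apr_id.
- move=> j k x jk /verma_grE [a ga ->]; rewrite (hF j).2 (apr_ne ga) //.
  exact: (linear_mk0 vp0).
Qed.

Lemma verma_gr_pos k (x : Mp m) : (0 < k)%R -> verma_gr (ip A) m k x -> x = 0.
Proof.
move=> k0 gx; have [pr [_ _ lp p1 p0]] := verma_gr_dsum; rewrite -(p1 _ _ gx).
have lpk := lp k; have lY := lrmorph_linear (im A).
have [y ->] := verma_Y Hp x; move: y; apply: (Y_ind Hp).
- by apply: submod_eq; lin.
- rewrite rmorph1; apply: (p0 _ 0); first by move=> e; rewrite e ltxx in k0.
  by apply/verma_grE; exists 1 => //; exact: pgr1.
move=> j y Dj gy _; apply: (p0 _ j); last by apply/verma_grE; exists (im A y).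
by move=> e; have := lt_trans Dj k0; rewrite e ltxx.
Qed.

Lemma verma_gr0 (x : Mp m) : verma_gr (ip A) m 0 x -> x = vpdual x *: vp m.
Proof.
move=> gx; have [pr [_ _ lp p1 p0]] := verma_gr_dsum.
have lv := vpdual_lin tm; have lp0 := lp 0; have lY := lrmorph_linear (im A).
rewrite -{1}(p1 _ _ gx); have [y ->] := verma_Y Hp x; move: y; apply: (Y_ind Hp).
- by apply: submod_eq; [lin|apply: lin_scalel; lin].
- rewrite rmorph1 act1; have [_ _ ->] := vpdual_spec tm.
  rewrite scale1r p1 //; apply/verma_grE; exists 1; first exact: pgr1.
  by rewrite act1.
move=> j y Dj gy _; have gj : verma_gr (ip A) m j (act (im A y) (vp m)).
  by apply/verma_grE; exists (im A y).
have j0 : j <> 0 by move=> e; rewrite e ltxx in Dj.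
by rewrite (p0 _ _ _ (nesym j0) gj) (vpdual_gr tm gj j0) scale0r.
Qed.

End VermaGrading.

Section Triangularity.
Variables (K : fieldType) (A : polarized K).
Implicit Types (a b c l m n : wfun A) (V W U : catO A).

Local Notation Hp := (half_pos A).

Lemma ogr_dsum V : dsum (@ogr K A V).
Proof. by apply: grading_dsum; exact: ogr_grading. Qed.

Lemma act_proj (M : amod A) (g : int -> set M) pr (k j : int) (a : A) (x : M) :
  (forall (k l : int) (a : A) v, pgr k a -> g l v -> g (k + l) (act a v)) ->
  dsum_proj g pr -> pgr k a -> pr (k + j) (act a x) = act a (pr j x).
Proof.
move=> ha [sg sp lp p1 p0] ga; have [l1 l2] := (lp (k + j), lp j).
move: x (sp x); apply: span_eq; try lin; move=> x [i gx].
have gax := ha _ _ _ _ ga gx.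
have [<-|/eqP ne] := eqVneq i j; first by rewrite !p1.
rewrite (p0 _ _ _ _ gax); last by move=> /addrI /esym.
by rewrite (p0 _ _ _ (nesym ne) gx) (linear_mk0 ((act_bilinear M).2 a)).
Qed.

(** A_0 lies in degree 0, so the projections of the grading preserve every weight space. *)
Lemma weight_homogeneous V (Q : set (wfun A)) k (v : V) :
  span [set u | exists2 a, Q a & wspace V a u] v -> ogr k v ->
  span [set u | [/\ ogr k u & exists2 a, Q a & wspace V a u]] v.
Proof.
have [pr hp] := ogr_dsum V; have [sg sp lp p1 p0] := hp; move=> sv gv.
rewrite -(p1 _ _ gv); move: v sv {gv}; apply: (span_map (lp k)) => v [a Qa wv].
apply: span_gen; split; first exact: dsum_prP hp.
exists a => // h; rewrite -[k]add0r.
have := act_proj k v (@ogr_act K A V) hp (i0_deg h).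
by rewrite add0r => <-; rewrite wv (linear_mkZ _ _ (lp k)).
Qed.

Lemma verma_act_gr m (k l : int) (a : A) (x : Mp m) : pgr k a -> verma_gr (ip A) m l x ->
  verma_gr (ip A) m (k + l) (act a x).
Proof.
move=> ga /verma_grE [b gb ->]; apply/verma_grE; exists (a * b); first exact: pgrM.
by rewrite actM.
Qed.

(** The component of total degree j of Phi^v applied to the generator is again singular with
    coefficient v, hence is everything. As M_m lives in degrees at most 0 with [vp m] spanning
    degree 0, all other terms have their second factor in degree above j. The argument rests on
    uniqueness of the intertwiner, so it also covers exceptional l at which it happens to be
    defined. *)
Lemma Phi_homogeneous l m V a j (v : V) : torus l -> torus m ->
  Phi_defined l m V a -> wspace V a v -> ogr j v ->
  span [set z | exists q k u, [/\ (j < k)%R, ogr k (u : V) & z = q \ox u]]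
    ((Phi l m v (vp l) : tens (Mp m) V) - vp m \ox v).
Proof.
move=> tl tm dV wv gv; set z : tens (Mp m) V := Phi l m v (vp l).
have [hz cz] := PhiP dV wv.
have sz : singular (ip A) l (z : tensm (Mp m) V) := hom_singular hz.
have dg := tgr_dsum (verma_gr_dsum m) (ogr_dsum V).
have [pr hp] := dg; have [sg sp lp p1 p0] := hp; have lpj := lp j.
have ha := @tgr_act _ _ (Mp m) V _ _ (@verma_act_gr m) (@ogr_act K A V).
have lc := @vp_coef_lin _ _ m V tm.
have [prV hV] := ogr_dsum V; have [_ _ lV V1 V0] := hV; have lVj := lV j.
(* Taking the coefficient preserves degrees, because v^* vanishes outside degree 0. *)
have cj y : vp_coef (pr j y) = prV j (vp_coef y).
  move: y (sp y); apply: span_eq; try lin; move=> y [k]; rewrite /tgr; move: y.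
  apply: span_eq; try lin; move=> _ [i [k' [x [u [gx gu _ ->]]]]].
  have gxu : tgr (verma_gr (ip A) m) (@ogr K A V) (i + k') (x \ox u).
    by apply: span_gen; exists i, k', x, u.
  rewrite [vp_coef (x \ox u)]vp_coef_pure // (linear_mkZ _ _ lVj).
  have [e|/eqP ne] := eqVneq (i + k') j.
    rewrite -e p1 // vp_coef_pure //.
    have [i0|/eqP i0] := eqVneq i 0; first by rewrite i0 add0r V1.
    by rewrite (vpdual_gr tm gx i0) !scale0r.
  rewrite (p0 _ _ _ (nesym ne) gxu) (linear_mk0 lc).
  have [i0|/eqP i0] := eqVneq i 0; last by rewrite (vpdual_gr tm gx i0) scale0r.
  by rewrite (V0 _ _ _ _ gu) ?scaler0 // => e; apply: ne; rewrite i0 add0r.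
have sj : singular (ip A) l (pr j z : tensm (Mp m) V).
  move=> h p; have lX := lrmorph_linear (ip A); have le := @eps_linear K A.
  have lact := (act_bilinear (tensm (Mp m) V)).1 (pr j z).
  move: p (hom_span (half_inj Hp) (half_gX Hp) p).
  apply: (span_eq (W := tensm (Mp m) V)) => [||p [k gp]].
  - by apply: (lin_comp lact); lin.
  - by apply: lin_scalel; lin.
  rewrite -(act_proj (M := tensm (Mp m) V) j z ha hp (pgr_i0 h gp)) sz.
  have lkj := lp (k + j); rewrite (linear_mkZ _ _ lkj).
  have [->|/eqP k0] := eqVneq k 0; first by rewrite add0r.
  by rewrite (pgre_eps gp k0) mulr0 !scale0r.
have zj : pr j z = z.
  have [f hf fE] := @verma_hom _ _ _ _ l (tensm (Mp m) V) (pr j z) sj.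
  have e : f = Phi l m v.
    by apply: (Phi_uniq dV wv); split=> //; rewrite fE cj cz V1.
  by rewrite -fE e.
have gz : tgr (verma_gr (ip A) m) (@ogr K A V) j z by rewrite -zj; exact: dsum_prP hp.
rewrite -cz -/z; move: gz; rewrite /tgr; move: z {sz sj zj hz cz cj}.
apply: span_sub => [|_ [i [k [x [u [gx gu e ->]]]]]].
  apply: (submod_pre (f := fun z : tens (Mp m) V => z - vp m \ox vp_coef z)); last exact: span_submod.
  by lin.
rewrite /= vp_coef_pure //.
rewrite (linear_mkZ (f := fun u : V => vp m \ox u)); last lin.
rewrite -(linear_mkZ (f := fun y : Mp m => y \ox u)); last lin.
have [i0|i0|i0] := ltgtP i 0.
- have i0' : i <> 0 by move=> e'; rewrite e' ltxx in i0.
  rewrite (vpdual_gr tm gx i0') scale0r (linear_mk0 (f := fun y : Mp m => y \ox u)); last lin.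
  rewrite subr0; apply: span_gen; exists x, k, u; split=> //.
  by move: i0 e; lia.
- rewrite (verma_gr_pos i0 gx) (linear_mk0 (vpdual_lin tm)) scale0r subrr; exact: span0.
- rewrite i0 in gx; rewrite -(verma_gr0 tm gx) subrr; exact: span0.
Qed.

(** The decreasing filtration of W (x) V by the degree of the second factor, restricted to vectors
    with weights in Q. With Q the whole torus it filters all of W (x) V. *)
Definition TQ (Q : set (wfun A)) W V (j : int) : set (tens W V) :=
  span [set z | exists b a k w u, [/\ Q b, Q a, (j <= k)%R & [/\ wspace W b w, wspace V a u,
    ogr k u & z = w \ox u]]].

Arguments TQ Q W V j : clear implicits.

Definition Qpart (Q : set (wfun A)) (M : amod A) : set M :=
  span [set u | exists2 a, Q a & wspace M a u].

Arguments Qpart Q M : clear implicits.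

Lemma TQ_pure Q W V j k w u : (j <= k)%R -> Qpart Q W w -> Qpart Q V u -> ogr k u ->
  TQ Q W V j (w \ox u).
Proof.
move=> jk Qw Qu gu; have := weight_homogeneous Qu gu; move: Qw {Qu gu}; rewrite /Qpart.
move: w u; apply: span_pure2 => [|w u [b Qb ww] [gu [a Qa wu]]]; first exact: span_submod.
by apply: span_gen; exists b, a, k, w, u.
Qed.

(** The intertwiner of w and the extraction of the coefficient combine into one linear map F,
    applied to the singular vector of v. Statements about J then reduce to pure tensors x (x) u. *)
Lemma fusion_unfold W V l b a (w : W) (v : V) : torus l -> torus b -> torus a ->
  wspace W b w -> wspace V a v -> fusion_defined W V l b a ->
  exists2 F : tens (Mp (wsub l a)) V -> tens W V, linear F &
    fusion W V l (w \ox v) = F (Phi l (wsub l a) v (vp l)) /\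
    forall x u, F (x \ox u) =
      (vp_coef (Phi (wsub l a) (wsub (wsub l a) b) w x : tens _ W) \ox u : tens W V).
Proof.
move=> tl tb ta ww wv fd; have [dW dV] := (@o_diag _ _ W, @o_diag _ _ V).
have tm := torusB tl ta; have tn := torusB tm tb.
rewrite (fusionE dW dV tl tb ta) //; have [d1 d2 d3] := fd.
have [[lw _] cw] := PhiP d2 ww; have lt := tmap_linear lw (@id_linear K V).
pose F (z : tens (Mp (wsub l a)) V) : tens W V :=
  @vp_coef K A (wsub (wsub l a) b) (tensm W V) (tassoc (tmap (Phi (wsub l a) (wsub (wsub l a) b) w) idfun z)).
exists F; first exact: lin_comp (@vp_coef_lin _ _ _ (tensm W V) tn) (lin_comp (@tassoc_linear _ _ _ _) lt).
split=> // x u; rewrite /F tmapE //; move: (Phi _ _ w x).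
have lc := @vp_coef_lin _ _ _ W tn; have lc2 := @vp_coef_lin _ _ _ (tensm W V) tn.
apply: tens_ext => [||y w'].
- by apply: (lin_comp lc2); lin.
- by lin.
rewrite tassocE !vp_coef_pure //.
by rewrite (linear_mkZ (f := fun w : W => w \ox u)) //; lin.
Qed.

Lemma fusion_tri W V l b a j (w : W) (v : V) : torus l -> torus b -> torus a ->
  wspace W b w -> wspace V a v -> ogr j v ->
  TQ (@torus K A) W V (j + 1) (fusion W V l (w \ox v) - w \ox v).
Proof.
move=> tl tb ta ww wv gv; have [dW dV] := (@o_diag _ _ W, @o_diag _ _ V).
have fullQ (M : catO A) (x : M) : Qpart (@torus K A) M x.
  by move: x (o_diag x); apply: span_mono => x [c tc wx]; apply: span_gen; exists c.
have [fd|nfd] := pselect (fusion_defined W V l b a); last first.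
  by rewrite (fusion_undef dW dV tl tb ta) // subrr; exact: span0.
have tm := torusB tl ta; have tn := torusB tm tb.
have [F lF [-> FE]] := fusion_unfold tl tb ta ww wv fd; have [d1 d2 d3] := fd.
have [_ cw] := PhiP d2 ww; have h := Phi_homogeneous tl tm d1 wv gv.
set z : tens (Mp _) V := Phi l _ v _ in h *.
(* w (x) v is the image under F of the leading term [vp _ \ox v], so the difference is F of the
   higher terms, whose second factor F leaves alone. *)
rewrite -cw -FE -(linear_mkB _ _ lF).
move: h; set z' := z - _; move: z'; apply: span_sub => [|_ [x [k [u [jk gu ->]]]]].
  by apply: (submod_pre lF); exact: span_submod.
by rewrite /= FE; apply: (TQ_pure (k := k)) => //; lia.
Qed.

Lemma TQ_submod Q W V j : submod (TQ Q W V j).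
Proof. exact: span_submod. Qed.

Lemma TQ_le Q W V i j z : (i <= j)%R -> TQ Q W V j z -> TQ Q W V i z.
Proof.
move=> ij; rewrite /TQ; move: z; apply: span_mono => x [b [a [k [w [u [Qb Qa jk h]]]]]].
by apply: span_gen; exists b, a, k, w, u; split=> //; exact: le_trans ij jk.
Qed.

Lemma TQ_zero Q W V : exists N : int, forall j z, (N < j)%R -> TQ Q W V j z -> z = 0.
Proof.
have [N hN] := ogr_bounded V; exists N => j z Nj; rewrite /TQ; move: z.
apply: span_eq; [exact: lin_id|exact: lin0|].
move=> _ [b [a [k [w [u [_ _ jk [_ _ gu ->]]]]]]].
have -> : u = 0 by apply: (hN k) => //; exact: lt_le_trans Nj jk.
by apply: (linear_mk0 (f := fun u : V => w \ox u)); lin.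
Qed.

Lemma TQ_union Q W V z :
  span [set z | exists b a w u, [/\ Q b, Q a, wspace W b w, wspace V a u & z = w \ox u]] z ->
  exists j, TQ Q W V j z.
Proof.
move: z; apply: span_sub => [|_ [b [a [w [u [Qb Qa ww wu ->]]]]]].
  split=> [|c x y [i hi] [j hj]]; first by exists 0; exact: span0.
  exists (Order.min i j); apply: (TQ_submod _ _ _ _).2.
    by apply: TQ_le hi; rewrite ge_min lexx.
  by apply: TQ_le hj; rewrite ge_min lexx orbT.
have Qw : Qpart Q W w by apply: span_gen; exists b.
have Qu : Qpart Q V u by apply: span_gen; exists a.
have [pr hp] := ogr_dsum V; have [sg sp lp p1 p0] := hp.
have [s [us hs]] := dsum_supp u hp.
have e := dsum_sum hp us hs.
have [j hj] : exists j, forall k, k \in s -> (j <= k)%R.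
  elim: s {us hs e} => [|k s [j hj]]; first by exists 0.
  exists (Order.min j k) => i; rewrite inE => /orP[/eqP ->|/hj ji].
    by rewrite ge_min lexx orbT.
  by rewrite ge_min ji.
exists j; rewrite e (linear_mksum _ _ _ (f := fun u : V => w \ox u)); last lin.
apply: submod_sum_seq => [|k ks]; first exact: TQ_submod.
apply: (TQ_pure (k := k)) => //; [exact: hj| |exact: dsum_prP hp].
move: u wu Qu {hs e}; move=> u wu _; apply: span_gen; exists a => // h.
have := act_proj k u (@ogr_act K A V) hp (i0_deg h).
by rewrite add0r => <-; rewrite wu (linear_mkZ _ _ (lp k)).
Qed.

(* J(l) is unipotent for the filtration by the degree of the second factor, at every l:
   where the intertwiners are not defined it is the identity by convention. Bijectivity
   at the exceptional l makes the exchange matrices linear there as well, as dyn needs. *)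
Lemma fusion_bij W V l : torus l ->
  (forall y, exists z, fusion W V l z = y) /\
  (forall z, fusion W V l z = 0 -> z = 0).
Proof.
move=> tl; have lJ := fusion_lin (@o_diag _ _ W) (@o_diag _ _ V) tl.
have [N hN] := TQ_zero (@torus K A) W V.
have JF j x : TQ (@torus K A) W V j x -> TQ (@torus K A) W V (j + 1) (fusion W V l x - x).
  rewrite {1}/TQ; move: x; apply: span_sub.
    apply: (submod_pre (f := fun x : tens W V => fusion W V l x - x)); last exact: span_submod.
    exact: lin_add lJ (lin_opp (@lin_id _ _)).
  move=> _ [b [a [k [w [u [tb ta jk [ww wu gu ->]]]]]]] /=.
  by apply: TQ_le (fusion_tri tl tb ta ww wu gu); rewrite lerD2r.
have B j := unipotent_bij (TQ_submod (@torus K A) W V)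
  (fun j x => @TQ_le _ W V j (j + 1) x ltac:(lia)) hN lJ JF j.
have full (z : tens W V) : exists j, TQ (@torus K A) W V j z.
  apply: TQ_union; move: z; apply: tens_ind => [|w v]; first exact: span_submod.
  apply: (span_pure2 (span_submod _) _ (o_diag w) (o_diag v)) => {}w {}v [b tb ww] [a ta wv].
  by apply: span_gen; exists b, a, w, v.
split=> [y|z].
  by have [j Tj] := full y; have [z _ e] := (B j).1 y Tj; exists z.
by have [j Tj] := full z => e; exact: (B j).2 Tj e.
Qed.

End Triangularity.


Arguments TQ {K A} Q W V j _.
Arguments Qpart {K A} Q M _.

(** * Fusion matrices and stable sets of weights *)

Section StableWeights.
Variables (K : fieldType) (A : polarized K).
Implicit Types (a b c l m n : wfun A) (V W U : catO A).

Variables (Q G : set (wfun A)).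
Hypotheses (tQ : forall a, Q a -> torus a) (tG : forall l, G l -> torus l).
Hypotheses (irrG : forall l, G l -> irr l) (GB : forall l a, G l -> Q a -> G (wsub l a)).

Lemma fusion_ok W V l b a : torus l -> torus a -> torus b ->
  irr (wsub l a) -> irr (wsub (wsub l a) b) -> fusion_defined W V l b a.
Proof.
move=> tl ta tb im' in'; have tm := torusB tl ta; have tn := torusB tm tb; split.
- have := Phi_definedP im' tl tm (@ogr_nilp _ _ V); by rewrite wsubKK.
- have := Phi_definedP in' tm tn (@ogr_nilp _ _ W); by rewrite wsubKK.
- have := Phi_definedP in' tl tn (@ogr_nilp _ _ (tensO W V)).
  by rewrite -wsubDA // wsubKK //; exact: torusD.
Qed.

Definition stable V : Prop := forall (a : A) (v : V), Qpart Q V v -> Qpart Q V (act a v).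

Lemma Qpart_gen (V : amod A) a (v : V) : Q a -> wspace V a v -> Qpart Q V v.
Proof. by move=> Qa wv; apply: span_gen; exists a. Qed.

Lemma Qpart_submod (V : amod A) : submod (Qpart Q V).
Proof. exact: span_submod. Qed.

(** By the last clause of [singular_exists] the singular vector attached to w lies in M (x) A w, and
    stability keeps A w inside the Q-part. Since q is of the form a' v_l, its image is obtained by
    letting a' act on that vector. *)
Lemma coef_Qpart W l a b (w : W) q : stable W -> torus l -> torus a -> torus b ->
  Q b -> wspace W b w -> irr (wsub l b) ->
  Qpart Q W (vp_coef (Phi l (wsub l b) w q : tens (Mp (wsub l b)) W)).
Proof.
move=> sW tl ta tb Qb ww ir; have tm := torusB tl tb.
have dW := Phi_definedP ir tl tm (@ogr_nilp _ _ W); rewrite wsubKK // in dW.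
have [hw cw] := PhiP dW ww; have lc := @vp_coef_lin _ _ (wsub l b) W tm.
pose MW := span [set z : tens (Mp (wsub l b)) W | exists x u, Qpart Q W u /\ z = x \ox u].
have sMW : submod MW by exact: span_submod.
have Qw := Qpart_gen Qb ww.
have MWv : MW (Phi l (wsub l b) w (vp l)).
  have [irr1 irr2] := ir.
  have wv' : wspace W (wsub l (wsub l b)) w by rewrite wsubKK.
  have [x [sx cx hx]] := singular_exists tl tm irr1 irr2 wv' (ogr_nilp w).
  have <- : x = Phi l (wsub l b) w (vp l).
    apply: (singular_unique tl tm irr1 irr2 sx); first exact: (hom_singular hw).
    by rewrite cw.
  rewrite -[x](subrK (vp (wsub l b) \ox w)); apply: (submodD sMW); last first.
    by apply: span_gen; exists (vp (wsub l b)), w.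
  move: hx; set x' := x - _; move: x'; apply: span_mono => _ [q' [d [a' [_ _ ->]]]].
  by apply: span_gen; exists q', (act a' w); split=> //; exact: sW.
have MWact (a' : A) z : MW z -> MW (act a' (z : tensm (Mp (wsub l b)) W)).
  have l1 := @tact_linr _ A (Mp (wsub l b)) W a'.
  rewrite {1}/MW; move: z; apply: span_sub => [|_ [x [u [Qu ->]]]].
    exact: (submod_pre l1).
  rewrite tactE; move: (hD A a'); apply: tens_ind => [|a1 a2].
    by apply: (submod_pre (f := tlift (fun x0 y => act x0 x \ox act y u))) => //; lin.
  rewrite tliftE; last lin; apply: span_gen; exists (act a1 x), (act a2 u).
  by split=> //; exact: sW.
have cMW z : MW z -> Qpart Q W (vp_coef z).
  rewrite /MW; move: z; apply: span_sub => [|_ [x [u [Qu ->]]]].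
    exact: (submod_pre lc (Qpart_submod W)).
  by rewrite /= vp_coef_pure //; exact: (submodZ _ (Qpart_submod W)).
apply: cMW; have [a' ->] := verma_cyclic q; have [_ hact] := hw.
by rewrite hact; exact: MWact.
Qed.

Lemma fusion_triQ W V l b a j (w : W) (v : V) : stable W -> stable V ->
  G l -> Q b -> Q a -> wspace W b w -> wspace V a v -> ogr j v ->
  TQ Q W V (j + 1) (fusion W V l (w \ox v) - w \ox v).
Proof.
move=> sW sV Gl Qb Qa ww wv gv.
have [tl ta tb] : [/\ torus l, torus a & torus b] by split; [exact: tG|exact: tQ|exact: tQ].
have tm := torusB tl ta; have tn := torusB tm tb.
have Gm := GB Gl Qa; have Gn := GB Gm Qb; have [irr1 irr2] := irrG Gm.
have fd : fusion_defined W V l b a by apply: fusion_ok => //; exact: irrG.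
have [F lF [-> FE]] := fusion_unfold tl tb ta ww wv fd; have [d1 d2 d3] := fd.
have [hv cv] := PhiP d1 wv; have [_ cw] := PhiP d2 ww.
have wv' : wspace V (wsub l (wsub l a)) v by rewrite wsubKK.
have [x [sx cx hx]] := singular_exists tl tm irr1 irr2 wv' (ogr_nilp v).
have <- : x = Phi l (wsub l a) v (vp l).
  apply: (singular_unique tl tm irr1 irr2 sx); first exact: (hom_singular hv).
  by rewrite cv.
rewrite -cw -FE -(linear_mkB _ _ lF); move: hx; set x' := x - _; move: x'.
apply: span_sub => [|_ [q [d [a' [d0 ga ->]]]]].
  by apply: (submod_pre lF); exact: span_submod.
rewrite /= FE; apply: (TQ_pure (k := d + j)); first by lia.
- by apply: (coef_Qpart (a := a)) => //; exact: irrG.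
- by apply: sV; exact: Qpart_gen wv.
- exact: ogr_act.
Qed.

Definition Qtens (W V : amod A) : set (tens W V) :=
  span [set z | exists b a w u, [/\ Q b, Q a, wspace W b w, wspace V a u & z = w \ox u]].

Lemma TQ_Qtens W V j z : TQ Q W V j z -> @Qtens W V z.
Proof.
rewrite /TQ /Qtens; move: z; apply: span_mono => z [b [a [k [w [u [Qb Qa _ [ww wu _ e]]]]]]].
by apply: span_gen; exists b, a, w, u.
Qed.

(** J is unipotent on the Q-part as well. The second half is what will confine J^-1, hence the
    exchange matrix, to the Q-part. *)
Lemma fusion_Q W V l : stable W -> stable V -> G l ->
  (forall z, @Qtens W V z -> @Qtens W V (fusion W V l z)) /\
  (forall y, @Qtens W V y -> exists2 z, @Qtens W V z & fusion W V l z = y).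
Proof.
move=> sW sV Gl; have tl := tG Gl.
have lJ := fusion_lin (@o_diag _ _ W) (@o_diag _ _ V) tl.
have [N hN] := TQ_zero Q W V.
have JF j x : TQ Q W V j x -> TQ Q W V (j + 1) (fusion W V l x - x).
  rewrite {1}/TQ; move: x; apply: span_sub.
    apply: (submod_pre (f := fun x : tens W V => fusion W V l x - x)); last exact: span_submod.
    exact: lin_add lJ (lin_opp (@lin_id _ _)).
  move=> _ [b [a [k [w [u [Qb Qa jk [ww wu gu ->]]]]]]] /=.
  by apply: TQ_le (fusion_triQ sW sV Gl Qb Qa ww wu gu); rewrite lerD2r.
have B j := unipotent_bij (TQ_submod Q W V)
  (fun j x => @TQ_le _ _ Q W V j (j + 1) x ltac:(lia)) hN lJ JF j.
split=> z /TQ_union [j Tj]; last first.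
  by have [z' Tz e] := (B j).1 z Tj; exists z' => //; exact: TQ_Qtens Tz.
rewrite -[fusion W V l z](subrK z); apply: (submodD (span_submod _)).
  exact: TQ_Qtens (JF _ _ Tj).
exact: TQ_Qtens Tj.
Qed.

End StableWeights.

(** * Countably many weights *)

Section CountableWeights.
Variables (K : fieldType) (A : polarized K).
Implicit Types (a b c l : wfun A) (V W U : catO A).

Lemma bounded_countable (T : eqType) (S : set T) N :
  (forall s : seq T, uniq s -> (forall x, x \in s -> S x) -> (size s <= N)%N) ->
  countable S.
Proof.
move=> hN; pose Pn n := `[< exists s : seq T, [/\ uniq s, forall x, x \in s -> S x & size s = n] >].
have P0 : exists n, Pn n by exists 0%N; apply/asboolP; exists [::].
have Ple n : Pn n -> (n <= N)%N by move=> /asboolP[s [us hs <-]]; exact: hN.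
have [n /asboolP[s [us hs ss]] nmax] := ex_maxnP P0 Ple.
apply: (sub_countable (B := [set` s])); last exact/finite_set_countable/finite_seq.
apply: subset_card_le => x Sx /=; apply: contrapT => /negP xs.
have /nmax : Pn n.+1; last by rewrite ltnn.
apply/asboolP; exists (x :: s); split=> /=; [by rewrite xs|move=> y|by rewrite ss].
by rewrite inE => /orP[/eqP ->|/hs].
Qed.

Definition wproj V : wfun A -> V -> V := projT1 (cid (wspace_dsum (@o_diag _ _ V))).

Lemma wprojP V : dsum_proj (wspace V) (@wproj V).
Proof. exact: projT2 (cid _). Qed.

(** The weights of V reached from weight a by elements of X of degree d. *)
Definition raised (X : algType K) (iX : X -> A) V a (d : int) : set (wfun A) :=
  [set b | exists x w, [/\ pgr d (iX x), wspace V a w & wproj b (act (iX x) w) <> 0]].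

Lemma raised_countable (X Y : algType K) (iX : {lrmorphism X -> A})
    (iY : {lrmorphism Y -> A}) DX DY V a d : half iX iY DX DY -> half iY iX DY DX ->
  torus a -> countable (raised iX V a d).
Proof.
move=> H H' ta; have [N hN] := finite_weights H H' ta d.
apply: (bounded_countable (N := N)) => s us hs; apply: (hN V _ _ (wprojP V) us) => b /hs hb.
split=> //; have [x [w [_ _ nz]]] := hb.
apply: (wspace_torus _ nz); exact: dsum_prP (wprojP V).
Qed.

Lemma raised_torus (X : algType K) (iX : X -> A) V a d b : raised iX V a d b -> torus b.
Proof.
move=> [x [w [_ _ nz]]]; apply: (wspace_torus _ nz); exact: dsum_prP (wprojP V).
Qed.

Definition raise (L : nat -> catO A) (Q : set (wfun A)) : set (wfun A) :=
  Q `|` \bigcup_(a in Q) \bigcup_(i in [set: nat]) \bigcup_(d in [set: int])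
    (raised (ip A) (L i) a d `|` raised (im A) (L i) a d).

Lemma countableU (T : Type) (S R : set T) : countable S -> countable R -> countable (S `|` R).
Proof.
move=> cS cR; have -> : S `|` R = \bigcup_(i in [set: bool]) (if i then S else R).
  apply/seteqP; split=> [x [h|h]|x [[] _ h]]; [by exists true|by exists false|by left|by right].
by apply: bigcup_countable => [|[] _]; [exact: countableP|..].
Qed.

Lemma raise_countable L Q : (forall a, Q a -> torus a) -> countable Q -> countable (raise L Q).
Proof.
move=> tQ cQ; apply: countableU => //; apply: bigcup_countable => // a Qa.
apply: bigcup_countable => [|i _]; first exact: countableP.
apply: bigcup_countable => [|d _]; first exact: countableP.
have ta := tQ _ Qa; apply: countableU.
- exact: raised_countable (half_pos A) (half_neg A) ta.
- exact: raised_countable (half_neg A) (half_pos A) ta.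
Qed.

Lemma raise_torus L Q : (forall a, Q a -> torus a) -> forall a, raise L Q a -> torus a.
Proof.
by move=> tQ a [/tQ//|[b _ [i _ [d _]]]]; case; exact: raised_torus.
Qed.

(** By the triangular decomposition it is enough to follow weights under A_+ and A_-, since A_0 does
    not move them. *)
Lemma raised_stable V (Q : set (wfun A)) :
  (forall a d b, Q a -> raised (ip A) V a d b -> Q b) ->
  (forall a d b, Q a -> raised (im A) V a d b -> Q b) -> stable Q V.
Proof.
move=> hp hm a; have hw := wprojP V; have [sg sp lp p1 p0] := hw.
have sQ := Qpart_submod Q V; have lact := (act_bilinear V).2.
have act0 h v : Qpart Q V v -> Qpart Q V (act (i0 A h) v).
  rewrite {1}/Qpart; move: v; apply: span_sub => [|v [b Qb wv]].
    exact: (submod_pre (lact _)).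
  by rewrite /= wv; apply: (submodZ _ sQ); exact: (Qpart_gen Qb).
have actX (X Y : algType K) (iX : {lrmorphism X -> A}) (iY : {lrmorphism Y -> A}) DX DY :
    half iX iY DX DY -> (forall a d b, Q a -> raised iX V a d b -> Q b) ->
    forall x v, Qpart Q V v -> Qpart Q V (act (iX x) v).
  move=> H hX x v; rewrite {1}/Qpart; move: v; apply: span_sub => [|v [b Qb wv]].
    exact: (submod_pre (lact _)).
  have lX := lrmorph_linear iX.
  move: x (hom_span (half_inj H) (half_gX H) x); apply: span_sub => [|x [d gx]].
    by apply: (submod_pre (f := fun x => act (iX x) v)) => //; lin.
  have [s [us hs]] := dsum_supp (act (iX x) v) hw.
  rewrite (dsum_sum hw us hs); apply: (submod_sum_seq sQ) => c _.
  have [->|/eqP nz] := eqVneq (wproj c (act (iX x) v)) 0; first exact: sQ.1.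
  apply: (Qpart_gen (a := c)); last exact: dsum_prP hw.
  by apply: (hX b d) => //; exists x, v.
move: a; apply: (A_ind (half_pos A)) => [|y h x v Qv].
  split=> [v _|c a b ha hb v Qv]; first by rewrite (linear_mk0 ((act_bilinear V).1 v)); exact: sQ.1.
  by rewrite (act_bilinear V).1; apply: sQ.2; [exact: ha|exact: hb].
rewrite !actM; apply: (actX _ _ _ _ _ _ (half_neg A)) => //; apply: act0.
exact: (actX _ _ _ _ _ _ (half_pos A)).
Qed.

(* J(l) preserves only total weights, so the intermediate vectors in the identities
   leave the weight spaces in P. A homogeneous element of A_+ or A_- moves a given weight
   to finitely many others, which leaves countably many irreducibility conditions on l. *)
Lemma countable_closure (L : nat -> catO A) (P : set (wfun A)) : countable P ->
  exists Q : set (wfun A), [/\ countable Q, forall a, Q a -> torus a,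
    forall a, torus a -> P a -> Q a & forall i, stable Q (L i)].
Proof.
move=> cP; pose Q := fix Q n := if n is k.+1 then raise L (Q k) else P `&` (@torus K A).
have tQ n a : Q n a -> torus a.
  elim: n a => [a []//|n IH a]; exact: raise_torus.
have cQ n : countable (Q n).
  elim: n => [|n IH]; last by apply: raise_countable => //; exact: tQ.
  by apply: (sub_countable (B := P)) => //; apply: subset_card_le => a [].
exists (\bigcup_(n in [set: nat]) Q n); split=> [|a [n _ /tQ]//|a ta Pa|i].
- by apply: bigcup_countable => // n _; exact: countableP.
- by exists 0%N.
- apply: raised_stable => a d b [n _ Qa] hb; exists n.+1 => //; right.
  + by exists a => //; exists i => //; exists d => //; left.
  + by exists a => //; exists i => //; exists d => //; right.
Qed.

(** Allowing all finite sequences of shifts makes the set closed under subtraction of weights in Q,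
    so every weight met in an iterated construction is covered. *)
Definition good (Q : set (wfun A)) : set (wfun A) := [set l | torus l /\
  forall s : seq (wfun A), (forall a, a \in s -> Q a) -> irr (foldl (@wsub K A) l s)].

Lemma good_irr Q l : good Q l -> irr l.
Proof. by move=> [_ /(_ [::])]; apply. Qed.

Lemma good_sub Q l a : (forall a, Q a -> torus a) -> good Q l -> Q a -> good Q (wsub l a).
Proof.
move=> tQ [tl hl] Qa; split=> [|s hs]; first by apply: torusB => //; exact: tQ.
by apply: (hl (a :: s)) => b; rewrite inE => /orP[/eqP ->|/hs].
Qed.

Lemma generic_good Q : nondegenerate_polarized A -> countable Q ->
  (forall a, Q a -> torus a) -> generic (good Q).
Proof.
move=> hA cQ tQ; have gi := generic_irr hA.
have gs (s : seq (wfun A)) (R : wfun A -> Prop) : (forall a, a \in s -> Q a) -> generic R ->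
    generic (fun l => R (foldl (@wsub K A) l s)).
  elim: s => [//|a s IH] hs gR; have IH' := IH (fun b bs => hs b (@mem_behead _ (a :: s) b bs)) gR.
  by apply: (generic_sub (tQ _ (hs a (mem_head _ _))) IH').
have /countable_injP [f finj] := cQ.
(* A left inverse on Q of the injection f, with the zero weight as default. Finite sequences in Q
   are coded by sequences of indices, and [R] imposes nothing for a number that codes no sequence in
   Q. *)
pose g (n : nat) : wfun A := xget (@w0 K A) [set a | Q a /\ f a = n].
have gE a : Q a -> g (f a) = a.
  move=> Qa; rewrite /g; case: xgetP => [b -> [Qb e]|/(_ a) []//].
  by apply: finj; rewrite ?inE.
pose R (k : nat) (l : wfun A) : Prop :=
  forall s : seq nat, unpickle k = Some s -> (forall a, a \in map g s -> Q a) ->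
    irr (foldl (@wsub K A) l (map g s)).
have gR k : generic (R k).
  case E : (unpickle k : option (seq nat)) => [s|]; last first.
    by apply: (generic_imp _ gi) => l _ _ s; rewrite E.
  have [hs|hs] := pselect (forall a, a \in map g s -> Q a).
    by apply: (generic_imp _ (gs _ _ hs gi)) => l _ h s'; rewrite E => -[<-].
  by apply: (generic_imp _ gi) => l _ _ s'; rewrite E => -[<-] /hs.
apply: (generic_imp _ (generic_forall gR)) => l tl h; split=> // s hs.
have e : map g (map f s) = s.
  by rewrite -map_comp -[RHS]map_id; apply/eq_in_map => a /hs /gE.
rewrite -e; apply: (h (pickle (map f s))); first by rewrite pickleK.
by rewrite e.
Qed.

End CountableWeights.

(** * The cocycle condition *)

Section Dynamical.
Variables (K : fieldType) (A : polarized K).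

Lemma dyn_spec (X : lmodType K) (U : amod A) (F : wfun A -> X -> X) : diagonal U ->
  (forall c, torus c -> linear (F c)) ->
  linear (dyn U F) /\ forall c x u, torus c -> wspace U c u -> dyn U F (x \ox u) = F c x \ox u.
Proof.
move=> dU lF; have [pr hp] := wspace_dsum dU; have [_ _ lp p1 _] := hp.
(* X is decomposed trivially, so that X (x) U is the direct sum of its subspaces X (x) U[c]. *)
have dX : dsum (fun _ : unit => [set: X]).
  exists (fun _ x => x); split=> // [x|[] [] //].
  by apply: span_gen; exists tt.
pose f (p : unit * wfun A) : tens X U -> tens X U :=
  if `[< torus p.2 >] then tmap (F p.2) (pr p.2) else fun=> 0.
have lf p : linear (f p).
  by rewrite /f; case: asboolP => [/lF h|_]; [apply: tmap_linear|exact: lin0].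
have [G lG GE] := dsum_ext (dsum_tens dX (wspace_dsum dU)) lf.
rewrite /dyn; case: xgetP => [G' -> //|/(_ G) []]; split=> // c x u tc wu.
rewrite (GE (tt, c)); last by apply: span_gen; exists x, u.
have lpc := lp c; have lFc := lF c tc.
by rewrite /f /=; case: asboolP => // _; rewrite tmapE // p1.
Qed.

Lemma dyn_lin (X : lmodType K) (U : catO A) (F : wfun A -> X -> X) :
  (forall c, torus c -> linear (F c)) -> linear (dyn U F).
Proof. by move=> lF; case: (dyn_spec (@o_diag _ _ U) lF). Qed.

Lemma dynE (X : lmodType K) (U : catO A) (F : wfun A -> X -> X) c x (u : U) :
  (forall c, torus c -> linear (F c)) -> torus c -> wspace U c u ->
  dyn U F (x \ox u) = F c x \ox u.
Proof. by move=> lF; case: (dyn_spec (@o_diag _ _ U) lF) => _; exact. Qed.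

(** The inverses of the F c are linear and again assemble over the weights of U, into a left
    inverse. *)
Lemma dyn_inj (X : lmodType K) (U : catO A) (F : wfun A -> X -> X) :
  (forall c, torus c -> linear (F c)) ->
  (forall c, torus c -> forall y, exists z, F c z = y) ->
  (forall c, torus c -> forall z, F c z = 0 -> z = 0) -> injective (dyn U F).
Proof.
move=> lF sF iF.
have /choice [H hH] c : exists H : X -> X, torus c -> linear H /\ forall x, H (F c x) = x.
  have [tc|//] := pselect (torus c); last by exists id.
  have inj x y : F c x = F c y -> x = y.
    move=> e; apply/eqP; rewrite -subr_eq0; apply/eqP/(iF c tc).
    by rewrite (linear_mkB _ _ (lF c tc)) e subrr.
  have /choice [H hH] := sF c tc; exists H => _; split=> [a x y|x].
    by apply: inj; rewrite (lF c tc) !hH.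
  by apply: inj; rewrite hH.
have lH c : torus c -> linear (H c) by move=> /hH[].
have l1 := @dyn_lin X U F lF; have l2 := @dyn_lin X U H lH.
apply: (can_inj (g := dyn U H)) => z; move: z (tens_span z).
apply: span_eq; [exact: lin_comp l2 l1|exact: lin_id|] => _ [[x u] _ <-] /=.
move: u (o_diag u); apply: span_eq.
- by apply: (lin_comp l2); apply: (lin_comp l1); lin.
- by lin.
by move=> u [c tc wu]; rewrite (dynE _ lF tc wu) (dynE _ lH tc wu) (hH c tc).2.
Qed.

End Dynamical.

Section Cocycle.
Variables (K : fieldType) (A : polarized K).
Implicit Types (a b c l m n : wfun A) (V W U : catO A).

(** The intermediate and target weights are kept as variables: l - c - b and l - (c + b) are equal
    but not convertible, and the cocycle condition identifies intertwiners written with either. *)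
Lemma fusion_unfold_at W V l m n b a (w : W) (v : V) : torus l -> torus b -> torus a ->
  wspace W b w -> wspace V a v -> fusion_defined W V l b a ->
  m = wsub l a -> n = wsub m b ->
  exists2 F : tens (Mp m) V -> tens W V, linear F &
    fusion W V l (w \ox v) = F (Phi l m v (vp l)) /\
    forall x u, F (x \ox u) = (vp_coef (Phi m n w x : tens (Mp n) W) \ox u : tens W V).
Proof. by move=> tl tb ta ww wv fd -> ->; exact: fusion_unfold. Qed.

Lemma Phi_natural (V V' : catO A) (g : V -> V') l m a (v : V) : is_hom g -> torus m ->
  Phi_defined l m V a -> Phi_defined l m V' a -> wspace V a v ->
  Phi l m (g v) = fun x => tmap idfun g (Phi l m v x).
Proof.
move=> hg tm dV dV' wv; have [hv cv] := PhiP dV wv.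
symmetry; apply: (Phi_uniq dV'); first exact: hom_wspace hg wv.
split; first exact: comp_hom (tmap_hom (@id_hom _ _ (Mp m)) hg) hv.
by rewrite vp_coef_map //; [rewrite cv|case: hg].
Qed.

Lemma fusion_natural1 (W W' V : catO A) (g : W -> W') l b a (w : W) (v : V) :
  is_hom g -> torus l -> torus b -> torus a -> wspace W b w -> wspace V a v ->
  fusion_defined W V l b a -> fusion_defined W' V l b a ->
  fusion W' V l (g w \ox v) = tmap g idfun (fusion W V l (w \ox v)).
Proof.
move=> hg tl tb ta ww wv fd fd'; have [lg _] := hg.
have [F lF [-> FE]] := fusion_unfold tl tb ta ww wv fd.
have [F' lF' [-> FE']] := fusion_unfold tl tb ta (hom_wspace hg ww) wv fd'.
have [d1 d2 d3] := fd; have [d1' d2' d3'] := fd'.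
have tm := torusB tl ta; have tn := torusB tm tb.
have lt := tmap_linear lg (@id_linear K V).
move: (Phi l _ v _); apply: tens_ext => [||x u]; [exact: lF'|exact: lin_comp lt lF|].
rewrite FE FE' tmapE // (Phi_natural hg tn d2 d2' ww) vp_coef_map //.
Qed.

Lemma fusion_natural2 (W V V' : catO A) (g : V -> V') l b a (w : W) (v : V) :
  is_hom g -> torus l -> torus b -> torus a -> wspace W b w -> wspace V a v ->
  fusion_defined W V l b a -> fusion_defined W V' l b a ->
  fusion W V' l (w \ox g v) = tmap idfun g (fusion W V l (w \ox v)).
Proof.
move=> hg tl tb ta ww wv fd fd'; have [lg _] := hg.
have [F lF [-> FE]] := fusion_unfold tl tb ta ww wv fd.
have [F' lF' [-> FE']] := fusion_unfold tl tb ta ww (hom_wspace hg wv) fd'.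
have [d1 d2 d3] := fd; have [d1' d2' d3'] := fd'.
have tm := torusB tl ta; have tn := torusB tm tb.
have lt := tmap_linear (@id_linear K W) lg.
have lt' := tmap_linear (@id_linear K (Mp (wsub l a))) lg.
rewrite (Phi_natural hg tm d1 d1' wv).
move: (Phi l _ v _); apply: tens_ext => [||x u]; [exact: lin_comp lF' lt'|exact: lin_comp lt lF|].
by rewrite tmapE // FE FE' tmapE.
Qed.

(** Both sides are the coefficient of the threefold composite M_l -> M_n (x) V (x) W (x) U.
    Replacing each inner fusion matrix by the composite that defines it, one peels off the vectors
    attached to u, w and v in turn by linearity, until both sides reduce to a pure tensor. *)
Lemma cocycle_pure V W U l a b c (v : V) (w : W) (u : U) :
  torus l -> torus a -> torus b -> torus c ->
  wspace V a v -> wspace W b w -> wspace U c u ->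
  irr (wsub l c) -> irr (wsub (wsub l c) b) -> irr (wsub (wsub (wsub l c) b) a) ->
  tassoc (fusion (tensm V W) U l (fusion V W (wsub l c) (v \ox w) \ox u)) =
  fusion V (tensm W U) l (v \ox fusion W U l (w \ox u)).
Proof.
move=> tl ta tb tc wv ww wu i1 i2 i3.
set m := wsub l c; set m2 := wsub m b; set n := wsub m2 a.
have tm : torus m by exact: torusB. have tm2 : torus m2 by exact: torusB.
have tn : torus n by exact: torusB. have tba := torusD tb ta; have tcb := torusD tc tb.
have e1 : n = wsub m (wadd b a) by rewrite wsubDA.
have e2 : m2 = wsub l (wadd c b) by rewrite wsubDA.
have [dV dW dU] : [/\ diagonal V, diagonal W & diagonal U] by split; exact: o_diag.
have fd1 : fusion_defined V W m a b by exact: fusion_ok.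
have fd2 : fusion_defined W U l b c by exact: fusion_ok.
have fd3 : fusion_defined (tensO V W) U l (wadd b a) c.
  by apply: fusion_ok => //; rewrite -/m -e1.
have fd4 : fusion_defined V (tensO W U) l a (wadd c b).
  by apply: fusion_ok => //; rewrite -e2.
have w1 := fusion_weight dV dW tm ta tb wv ww fd1.
have w2 := fusion_weight dW dU tl tb tc ww wu fd2.
have P1 := fusion_Phi dV dW tm ta tb wv ww fd1.
have P2 := fusion_Phi dW dU tl tb tc ww wu fd2.
have [F lF [EF FE]] := @fusion_unfold_at (tensO V W) U l m n _ _ _ u tl tba tc w1 wu fd3 erefl e1.
have [G lG [EG GE]] := @fusion_unfold_at V (tensO W U) l m2 n _ _ v _ tl ta tcb wv w2 fd4 e2 erefl.
rewrite -/m EF EG; rewrite -/m -/m2 -/n in P1; rewrite -/m -/m2 in P2.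
have [d1 d2 d3] := fd1; have [d1' d2' d3'] := fd2.
have [[lv _] cv] := PhiP d2 wv; have [[lw _] cw] := PhiP d1 ww.
rewrite -/m -/m2 -/n in lv lw.
rewrite P2 /Phi2; set z := Phi l m u (vp l).
have lt1 := tmap_linear lw (@id_linear K U).
move: (z : tens (Mp m) U); apply: tens_ext => [||y u'].
- by apply: (lin_comp (@tassoc_linear _ _ _ _)); exact: lF.
- exact: lin_comp lG (lin_comp (@tassoc_linear _ _ _ _) lt1).
rewrite tmapE // FE P1 /Phi2; move: (Phi m m2 w y : tens (Mp m2) W).
have lt2 := tmap_linear lv (@id_linear K W).
have lc1 := @vp_coef_lin _ _ n (tensm V W) tn.
have lc2 := @vp_coef_lin _ _ n V tn.
have l1 : linear (fun t : tens V W => tassoc (t \ox u')) by lin.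
apply: tens_ext => [||y' w'].
- apply: (lin_comp l1); apply: (lin_comp lc1).
  exact: lin_comp (@tassoc_linear _ _ _ _) lt2.
- by apply: (lin_comp lG); lin.
rewrite tassocE GE tmapE //; move: (Phi m2 n v y' : tens (Mp n) V).
apply: tens_ext => [||q v'].
- by apply: (lin_comp l1); apply: (lin_comp lc1); lin.
- by lin.
rewrite tassocE !vp_coef_pure // (linear_mkZ (f := fun t : tens V W => t \ox u')); last lin.
rewrite (linear_mkZ _ _ (@tassoc_linear _ _ _ _)) tassocE.
by rewrite (linear_mkZ (f := fun v : V => v \ox (w' \ox u'))) //; lin.
Qed.

End Cocycle.

(** * Braidings *)

Lemma perm132E (K : fieldType) (V W U : lmodType K) (v : V) (w : W) (u : U) :
  perm132 (v \ox w \ox u) = v \ox u \ox w.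
Proof.
by have lt := @tswap_linear K W U; rewrite /perm132 tassocE tmapE // tswapE tassocVE.
Qed.

Lemma perm132_linear (K : fieldType) (V W U : lmodType K) : linear (@perm132 K V W U).
Proof. by rewrite /perm132; lin. Qed.

Definition eventually (P : nat -> Prop) : Prop := exists M, forall n, (M <= n)%N -> P n.

Lemma eventually_and (P Q : nat -> Prop) :
  eventually P -> eventually Q -> eventually (fun n => P n /\ Q n).
Proof.
move=> [M hM] [N hN]; exists (maxn M N) => n; rewrite geq_max => /andP[Mn Nn].
by split; [exact: hM|exact: hN].
Qed.

Lemma eventually_ex (P : nat -> Prop) : eventually P -> exists n, P n.
Proof. by move=> [M hM]; exists M; exact: hM. Qed.

Lemma eventually_imp (P Q : nat -> Prop) :
  (forall n, P n -> Q n) -> eventually P -> eventually Q.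
Proof. by move=> PQ [M hM]; exists M => n /hM/PQ. Qed.

Lemma submod_eventually (K : fieldType) (V : lmodType K) (X : nat -> set V) :
  (forall n, submod (X n)) -> submod [set v | eventually (fun n => X n v)].
Proof.
move=> sX; split=> [|a x y /= hx hy]; first by exists 0%N => n _; exact: (sX n).1.
by apply: (eventually_imp _ (eventually_and hx hy)) => n [Xx Xy]; exact: (sX n).2.
Qed.

(** * The action of the completed tensor product *)

Section Completion.
Variables (K : fieldType) (A : polarized K).
Implicit Types (V W U : catO A) (R : ctens A).

Lemma AIproj_linear n : linear (@AIproj K A n).
Proof. exact: (linearP (qproj (igen n))). Qed.

Lemma AItransE n m (a : A) : (n <= m)%N -> AItrans n (AIproj m a) = AIproj n a.
Proof.
move=> nm; apply: (qliftE (S := igen m) (f := mklin (AIproj_linear n))) => x.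
move=> [b [c [j [mj gc ->]]]]; apply/qproj0P; apply: span_gen; exists b, c, j; split=> //; lia.
Qed.

Lemma AItrans_linear n m : (n <= m)%N -> linear (@AItrans K A m n).
Proof.
move=> nm; apply: (qlift_linear (S := igen m) (f := mklin (AIproj_linear n))) => x.
move=> [b [c [j [mj gc ->]]]]; apply/qproj0P; apply: span_gen; exists b, c, j; split=> //; lia.
Qed.

Lemma crepE R n m : (n <= m)%N -> proj2 n (crep R m) = R n.
Proof.
move=> nm; have lt := AItrans_linear nm.
have lp := AIproj_linear; have e : proj2 m (crep R m) = R m.
  have [D hD'] := cfam_degrees R; have [x _ ex] := hD' m.
  by rewrite /crep; case: xgetP => [y -> //|/(_ x) []].
rewrite -(cfam_compat R nm) -e; move: (crep R m); apply: tens_ext => [||a b].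
- exact: (tmap_linear (lp n) (lp n)).
- exact: (lin_tmap lt lt (tmap_linear (lp m) (lp m))).
rewrite /proj2 !tmapE //; try exact: lp.
by congr (_ \ox _); rewrite -[RHS]/(AItrans n (AIproj m _)) AItransE.
Qed.

(** I_n kills v once n exceeds the degree beyond which elements of A act on v by zero. *)
Lemma act_factor V (v : V) : eventually (fun n => exists2 q : AI A n -> V, linear q &
  forall a, act a v = q (AIproj n a)).
Proof.
have [N hN] := ogr_nilp v; exists N.+1 => n Nn.
have h x : igen n x -> mklin ((act_bilinear V).1 v) x = 0.
  move=> [a [b [j [nj gb ->]]]] /=; rewrite actM (hN j) //; last by lia.
  exact: (linear_mk0 ((act_bilinear V).2 a)).
by exists (qlift (mklin ((act_bilinear V).1 v))); [exact: qlift_linear|move=> a; rewrite qliftE].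
Qed.

(** Continuity of the action at a fixed vector, with the discrete topology on V (x) W: limits in the
    completion become equalities between actions of representatives of large index. *)
Lemma act2_cont V W (x : tens V W) : eventually (fun n => forall s t,
  proj2 n s = proj2 n t -> act2 s x = act2 t x).
Proof.
move: x; apply: tens_ind => [|v w].
  apply: (submod_eventually (X := fun n x => forall s t, proj2 n s = proj2 n t ->
    act2 s x = act2 t x)) => n; split=> [s t _|a x y hx hy s t e].
    by rewrite !(linear_mk0 ((act2_bilinear V W).2 _)).
  by rewrite !(act2_bilinear V W).2 (hx s t e) (hy s t e).
apply: (eventually_imp _ (eventually_and (act_factor v) (act_factor w))).
move=> n [[p lp pE] [q lq qE]] s t e; have la := @AIproj_linear n.
suff H d : act2 d (v \ox w) = tmap p q (proj2 n d) by rewrite !H e.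
have lpq := tmap_linear lp lq; have lpr := tmap_linear la la.
move: d; apply: tens_ext => [||a b]; [by lin|exact: lin_comp lpq lpr|].
by rewrite act2E /proj2 !tmapE // pE qE.
Qed.

Lemma cactE R V W (x : tens V W) : eventually (fun n => act2 (crep R n) x = cact R V W x).
Proof.
have [M hM] := act2_cont x.
have h n : (M <= n)%N -> act2 (crep R n) x = act2 (crep R M) x.
  by move=> Mn; apply: (hM M) => //; rewrite !crepE.
rewrite /cact; case: xgetP => [y -> [N hN]|/(_ (act2 (crep R M) x)) []]; last by exists M.
exists (maxn M N) => n; rewrite geq_max => /andP[_ Nn]; exact: hN.
Qed.

Lemma cact_linear R V W : linear (cact R V W).
Proof.
move=> a x y.
have /eventually_ex [n [<- [<- <-]]] := eventually_and (cactE R (a *: x + y))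
  (eventually_and (cactE R x) (cactE R y)).
exact: (act2_bilinear V W).2.
Qed.

Lemma act2_natural (V W V' W' : amod A) (f : V -> V') (g : W -> W') d (x : tens V W) :
  is_hom f -> is_hom g -> act2 d (tmap f g x) = tmap f g (act2 d x).
Proof.
move=> [lf hf] [lg hg]; have lt := tmap_linear lf lg; move: d; apply: tens_ext => [||a b].
- by lin.
- by apply: (lin_comp lt); lin.
move: x; apply: tens_ext => [||v w]; first by apply: lin_act2r.
  by apply: (lin_comp lt); lin.
by rewrite act2E !tmapE // act2E hf hg.
Qed.

Lemma cact_natural R V W V' W' (f : V -> V') (g : W -> W') x :
  is_hom f -> is_hom g -> cact R V' W' (tmap f g x) = tmap f g (cact R V W x).
Proof.
move=> hf hg.
have /eventually_ex [n [<- <-]] := eventually_and (cactE R (tmap f g x)) (cactE R x).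
exact: act2_natural.
Qed.

Lemma act2_swap (V W : amod A) d (x : tens V W) : act2 d (tswap x) = tswap (act2 (tswap d) x).
Proof.
move: d; apply: tens_ext => [||a b]; try by lin.
move: x; apply: tens_ext => [||v w]; try by lin.
by rewrite !tswapE !act2E tswapE.
Qed.

Definition braid R V W (x : tensm V W) : tensm W V := tswap (cact R V W x).

Lemma braid_linear R V W : linear (@braid R V W).
Proof. exact: (lin_tswap (@cact_linear R V W)). Qed.

Lemma braid_natural R V W V' W' (f : V -> V') (g : W -> W') (x : tensm V W) :
  is_hom f -> is_hom g ->
  braid R (tmap f g x : tensm V' W') = tmap g f (braid R x).
Proof.
move=> hf hg; rewrite /braid cact_natural //; have [[lf _] [lg _]] := (hf, hg).
have lt := tmap_linear lf lg; have lt' := tmap_linear lg lf.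
move: (cact R V W x); apply: tens_ext => [||v w]; first by lin.
  by apply: (lin_comp lt'); lin.
by rewrite tmapE // !tswapE tmapE.
Qed.

Lemma braid_hom R V W : quasitriangular R -> is_hom (@braid R V W).
Proof.
move=> [_ hR _ _]; split=> [|a x]; first exact: braid_linear.
have [M hM] := act2_cont (x : tens V W).
have [N hN] := hR a M; have hN' : eventually (fun m =>
    act2 (tmul (crep R m) (hD A a)) x = act2 (tmul (hDop a) (crep R m)) x).
  by exists (maxn M N) => m; rewrite geq_max => /andP[Mm Nm]; apply: (hM M) => //; exact: hN.
have /eventually_ex [n [e [e1 e2]]] := eventually_and hN'
  (eventually_and (cactE R (x : tens V W)) (cactE R (act a x : tens V W))).
rewrite /braid -e1 -e2.
transitivity (tswap (act2 (tmul (crep R n) (hD A a)) x)); first by rewrite act2M.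
rewrite e act2M; symmetry.
exact: (act2_swap (hD A a) (act2 (crep R n) x)).
Qed.

Definition act3 (V W U : amod A) (v : V) (w : W) (u : U) (d : tens A (tens A A)) :
    tens (tens V W) U :=
  tlift (fun a e => tlift (fun b c => act a v \ox act b w \ox act c u) e) d.

Lemma act3_bilinear (V W U : amod A) (v : V) (w : W) (u : U) :
  bilinear2 (fun (a : A) (e : tens A A) =>
    tlift (fun b c => act a v \ox act b w \ox act c u) e).
Proof. by lin. Qed.

Lemma act3_linear (V W U : amod A) (v : V) (w : W) (u : U) : linear (act3 v w u).
Proof. exact: tlift_linear (act3_bilinear v w u). Qed.

Lemma act3E (V W U : amod A) (v : V) (w : W) (u : U) a b c :
  act3 v w u (a \ox (b \ox c)) = act a v \ox act b w \ox act c u.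
Proof. by rewrite /act3 tliftE ?tliftE //; [lin|exact: act3_bilinear]. Qed.

Lemma act3_cont V W U (v : V) (w : W) (u : U) : eventually (fun n => forall s t,
  proj3 n s = proj3 n t -> act3 v w u s = act3 v w u t).
Proof.
apply: (eventually_imp _ (eventually_and (act_factor v)
  (eventually_and (act_factor w) (act_factor u)))).
move=> n [[p lp pE] [[q lq qE] [r lr rE]]] s t e; have la := @AIproj_linear n.
pose F (y : tens (AI A n) (tens (AI A n) (AI A n))) : tens (tens V W) U :=
  tlift (fun a e => tlift (fun b c => p a \ox q b \ox r c) e) y.
have bF : bilinear2 (fun (a : AI A n) (e : tens (AI A n) (AI A n)) =>
  tlift (fun b c => p a \ox q b \ox r c) e) by lin.
suff H d : act3 v w u d = F (proj3 n d) by rewrite !H e.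
have lF : linear F := tlift_linear bF.
have l2 : linear (@proj2 K A n) := tmap_linear la la.
have l3 : linear (@proj3 K A n) := tmap_linear la l2.
have la3 := act3_linear v w u.
move: d; apply: tens_ext => [||a d]; [exact: la3|exact: (lin_comp lF l3)|].
move: d; apply: tens_ext => [||b c]; first by apply: (lin_comp la3); lin.
  by apply: (lin_comp lF); apply: (lin_comp l3); lin.
rewrite act3E /proj3 tmapE; [|exact: la|exact: l2].
rewrite /proj2 tmapE; [|exact: la|exact: la].
by rewrite /F !tliftE ?pE ?qE ?rE //; lin.
Qed.

Lemma act3_tassoc (V W U : amod A) (v : V) (w : W) (u : U) s :
  act3 v w u (tassoc (tmap (hD A) idfun s)) = act2 s ((v \ox w : tensm V W) \ox u).
Proof.
have la3 := act3_linear v w u; move: s; apply: tens_ext => [||a b]; first by lin.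
  exact: (act2_bilinear (tensm V W) U).1.
transitivity (act2 (hD A a) (v \ox w) \ox act b u); last first.
  by symmetry; exact: (@act2E K A (tensm V W) U a b (v \ox w) u).
rewrite tmapE //; [|by lin]; move: (hD A a : tens A A).
apply: tens_ext => [||a1 a2]; try by lin.
by rewrite tassocE act3E act2E.
Qed.

(** The product s^13 t^23 acts by t on W (x) U and afterwards by s on V (x) U; [perm132] makes V and
    U adjacent. *)
Lemma act3_legs (V W U : amod A) (v : V) (w : W) (u : U) s t :
  act3 v w u (tmul3 (leg13 s) (leg23 t)) =
  perm132 (tmap (act2 s) idfun (perm132 (tassocV (v \ox act2 t (w \ox u))))).
Proof.
have la3 := act3_linear v w u; have bm := tmul_bilinear A.
have b3 (a : A) (e : tens A A) : bilinear2 (fun a' e' => (a * a') \ox tmul e e') by lin.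
have m3 (x : tens A (tens A A)) (a : A) (e : tens A A) : tmul3 (a \ox e) x = tlift (fun a' e' => (a * a') \ox tmul e e') x.
  by rewrite /tmul3 /tmulg tliftE //; lin.
have l3 (y : tens A (tens A A)) : linear (fun x : tens A (tens A A) => tmul3 x y) by rewrite /tmul3 /tmulg; lin.
have b13 : bilinear2 (fun a b : A => a \ox (1 \ox b : tens A A)) by lin.
have l13 := tlift_linear b13 : linear (@leg13 K A).
have lact2 d := (act2_bilinear V U).2 d.
pose F (r : tens A A) (y : tens (tens V W) U) := perm132 (tmap (act2 r) idfun (perm132 y)).
rewrite -[RHS]/(F s _); have lF r : linear (F r) by rewrite /F /perm132; lin.
move: s; apply: tens_ext => [||a b].
- by apply: (lin_comp la3); exact: (lin_comp (l3 _) l13).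
- move=> c r r'; set z := tassocV _; move: (z : tens (tens V W) U).
  apply: tens_ext => [||y u']; [exact: lF|by apply: lin_add; [apply: lin_scaler|]; exact: lF|].
  move: y; apply: tens_ext => [||v' w'].
  + by apply: (lin_comp (lF _)); lin.
  + by apply: lin_add; [apply: lin_scaler|]; apply: (lin_comp (lF _)); lin.
  rewrite /F !perm132E !tmapE //.
  have lp : linear (fun z : tens V U => perm132 (z \ox w')) by rewrite /perm132; lin.
  by rewrite (act2_bilinear V U).1 lp.
rewrite /leg13 tliftE // m3 /leg23.
rewrite tliftE //; move: t; apply: tens_ext => [||c d].
- by apply: (lin_comp la3); lin.
- by apply: (lin_comp (lF _)); lin.
rewrite tmulE act3E act2E /F tassocVE perm132E tmapE // act2E perm132E.
by rewrite mulr1 mul1r actM.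
Qed.

(** The relation (Delta (x) 1) R = R^13 R^23 evaluated on v (x) w (x) u, at a single index n beyond
    which all the limits involved are attained. *)
Lemma hexagon R V W U (v : V) (w : W) (u : U) : quasitriangular R ->
  cact R (tensO V W) U ((v \ox w : tensm V W) \ox u) =
  perm132 (tmap (cact R V U) idfun (perm132 (tassocV (v \ox cact R W U (w \ox u))))).
Proof.
move=> [_ _ hR _].
have [M hM] := act3_cont v w u.
have [N hN] := hR M; have h1 : eventually (fun m =>
    act3 v w u (tassoc (tmap (hD A) idfun (crep R m))) =
    act3 v w u (tmul3 (leg13 (crep R m)) (leg23 (crep R m)))).
  by exists (maxn M N) => m; rewrite geq_max => /andP[Mm Nm]; apply: (hM M) => //; exact: hN.
set y := perm132 (tassocV _).
(* Here y is a finite sum of pure tensors, so one index serves all its terms. *)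
have h2 : eventually (fun m => tmap (act2 (crep R m)) idfun y = tmap (cact R V U) idfun y).
  move: y; apply: tens_ind => [|x z].
    apply: (submod_eventually (X := fun m => [set y | tmap (act2 (crep R m)) idfun y =
      tmap (cact R V U) idfun y])) => m; apply: submod_eq; apply: tmap_linear => //.
      exact: (act2_bilinear V U).2.
    exact: cact_linear.
  apply: (eventually_imp _ (cactE R x)) => m e.
  by rewrite !tmapE ?e //; [exact: cact_linear|exact: (act2_bilinear V U).2].
have /eventually_ex [n [e1 [e2 [e3 e4]]]] := eventually_and h1 (eventually_and h2
  (eventually_and (cactE R (w \ox u)) (@cactE R (tensO V W) U (v \ox w \ox u)))).
by rewrite -[LHS]e4 -act3_tassoc e1 act3_legs e3 -/y e2.
Qed.

(** The hexagon for the braiding: U is moved past V (x) W by passing W and then V. *)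
Lemma braid_tens R V W U (z : tens (tens V W) U) : quasitriangular R ->
  @braid R (tensO V W) U z = tassoc (tmap (@braid R V U) idfun
    (tassocV (tmap idfun (@braid R W U) (tassoc z)))).
Proof.
move=> hR; have lWU := @braid_linear R W U; have lVU := @braid_linear R V U.
have cWU := @cact_linear R W U; have cVU := @cact_linear R V U.
have lT := @braid_linear R (tensO V W) U.
move: z; apply: tens_ext => [||z u]; [exact: lT|by lin|].
move: z; apply: tens_ext => [||v w]; [by apply: (lin_comp lT); lin|by lin|].
rewrite tassocE tmapE // /braid hexagon //.
have e1 (y : tens W U) : perm132 (tassocV (v \ox y)) = tassocV (v \ox tswap y).
  move: y; apply: tens_ext => [||w' u']; [by rewrite /perm132; lin|by lin|].
  by rewrite tassocVE perm132E tswapE tassocVE.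
rewrite e1; move: (tassocV _) => y; move: (y : tens (tens V U) W).
have lb : linear (fun x : tens V U => tswap (cact R V U x)) by lin.
apply: tens_ext => [||{}y w']; [by rewrite /perm132; lin|by lin|].
rewrite !tmapE //; move: (cact R V U y); apply: tens_ext => [||v' u'].
- by rewrite /perm132; lin.
- by lin.
by rewrite perm132E !tswapE tassocE.
Qed.

End Completion.

(** * Exchange matrices *)

Section Legs.
Variable K : fieldType.
Implicit Types V W U : lmodType K.

Definition swap12 V W U (x : tens (tens V W) U) : tens (tens W V) U :=
  tmap (@tswap K V W) idfun x.

Definition map23 V W U (E : tens W U -> tens W U) (x : tens (tens V W) U) : tens (tens V W) U :=
  tassocV (tmap idfun E (tassoc x)).

Lemma swap12_linear V W U : linear (@swap12 V W U).
Proof. by rewrite /swap12; lin. Qed.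

Lemma swap12E V W U (v : V) (w : W) (u : U) : swap12 (v \ox w \ox u) = w \ox v \ox u.
Proof. by have lt := @tswap_linear K V W; rewrite /swap12 tmapE // tswapE. Qed.

Lemma tens3_ext V W U (X : lmodType K) (f g : tens (tens V W) U -> X) :
  linear f -> linear g -> (forall v w u, f (v \ox w \ox u) = g (v \ox w \ox u)) -> f =1 g.
Proof.
move=> lf lg h; apply: tens_ext => // y u; move: y; apply: tens_ext => [||v w //].
- by apply: (lin_comp lf); lin.
- by apply: (lin_comp lg); lin.
Qed.

Ltac llin := rewrite /op13 /map23 /swap12 /perm132; lin.

Lemma swap12K V W U (x : tens (tens V W) U) : swap12 (swap12 x) = x.
Proof.
by move: x; apply: tens3_ext => [||v w u]; [llin|llin|rewrite !swap12E].
Qed.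

Lemma perm132K V W U (x : tens (tens V W) U) : perm132 (perm132 x) = x.
Proof.
by move: x; apply: tens3_ext => [||v w u]; [llin|llin|rewrite !perm132E].
Qed.

Lemma swap12_perm132 V W U (x : tens (tens V W) U) :
  perm132 (swap12 (perm132 x)) = swap12 (perm132 (swap12 x)).
Proof.
by move: x; apply: tens3_ext => [||v w u]; [llin|llin|rewrite !(perm132E, swap12E)].
Qed.

Lemma tswap_tassoc V W U (x : tens (tens V W) U) : tswap (tassoc x) = perm132 (swap12 x).
Proof.
move: x; apply: tens3_ext => [||v w u]; [llin|llin|].
by rewrite swap12E perm132E tassocE tswapE.
Qed.

Lemma op23_map V W U (E : tens W U -> tens W U) (x : tens (tens V W) U) : linear E ->
  op23 (tmap E idfun) x = map23 E x.
Proof.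
move=> lE; rewrite /op23 /map23; congr tassocV; move: (tassoc x).
apply: tens_ext => [||v y]; [llin|llin|].
by rewrite tswapE !tmapE // tswapE.
Qed.

(** After reordering, an operator in the outer factors acts in two adjacent ones, where the triple
    fusion matrix can absorb it. *)
Lemma op13_map V W U (E : tens V U -> tens V U) (y : tens (tens W U) V) : linear E ->
  op13 (tmap E idfun) (tassocV (tswap y)) = swap12 (map23 E (perm132 y)).
Proof.
move=> lE; rewrite /op13 /map23; move: y; apply: tens3_ext => [||w u v]; [llin|llin|].
rewrite tswapE tassocVE !perm132E tassocE !tmapE //; move: (E _).
apply: tens_ext => [||v' u']; [llin|llin|].
by rewrite perm132E tassocVE swap12E.
Qed.

Lemma map12_map23 V W U (E : tens V W -> tens V W) (x : tens (tens V W) U) : linear E ->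
  swap12 (perm132 (tmap E idfun x)) = map23 E (swap12 (perm132 x)).
Proof.
move=> lE; rewrite /map23; move: x; apply: tens3_ext => [||v w u]; [llin|llin|].
rewrite perm132E swap12E tassocE !tmapE //; move: (E _).
apply: tens_ext => [||v' w']; [llin|llin|].
by rewrite perm132E swap12E tassocVE.
Qed.

End Legs.

Section Exchange.
Variables (K : fieldType) (A : polarized K) (Rm : ctens A).
Hypothesis hR : quasitriangular Rm.
Implicit Types (a b c l : wfun A) (V W U X Y Z : catO A).

Lemma fusion_linear X Y l : torus l -> linear (fusion X Y l : tens X Y -> tens X Y).
Proof. exact: (fusion_lin (@o_diag _ _ X) (@o_diag _ _ Y)). Qed.

Lemma fusion_inj X Y l : torus l -> injective (fusion X Y l : tens X Y -> tens X Y).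
Proof.
move=> tl x y e; apply/eqP; rewrite -subr_eq0; apply/eqP; apply: (fusion_bij X Y tl).2.
by rewrite (linear_mkB _ _ (@fusion_linear X Y l tl)) e subrr.
Qed.

Lemma exchangeP X Y l (x : tens X Y) : torus l ->
  fusion X Y l (exchange Rm X Y l x) = braid Rm (fusion Y X l (tswap x)).
Proof.
move=> tl; rewrite /exchange; case: xgetP => [z -> /= ->|].
  by rewrite tswapK.
have [z e] := (fusion_bij X Y tl).1
  (tswap (cact Rm Y X (tswap (tswap (fusion Y X l (tswap x)))))).
by move/(_ z).
Qed.

Lemma exchange_linear X Y l : torus l -> linear (exchange Rm X Y l : tens X Y -> tens X Y).
Proof.
move=> tl c x y; apply: (fusion_inj tl).
have l1 := @fusion_linear X Y l tl; have l2 := @fusion_linear Y X l tl.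
have l3 : linear (fun x : tens X Y => braid Rm (fusion Y X l (tswap x)) : tens X Y).
  exact: (lin_comp (@braid_linear _ _ Rm Y X) (lin_comp l2 (@tswap_linear _ _ _))).
by rewrite l1 !exchangeP // l3.
Qed.

Definition fusion3 X Y Z l (x : tens (tens X Y) Z) : tens (tens X Y) Z :=
  fusion (tensm X Y) Z l (dyn Z (fun c => fusion X Y (wsub l c)) x).

Lemma fusion3_linear X Y Z l : torus l -> linear (@fusion3 X Y Z l).
Proof.
move=> tl; apply: (lin_comp (@fusion_linear (tensO X Y) Z l tl)).
by apply: dyn_lin => c tc; apply: fusion_linear; exact: torusB.
Qed.

Lemma fusion3_inj X Y Z l : torus l -> injective (@fusion3 X Y Z l).
Proof.
move=> tl x y /(@fusion_inj (tensO X Y) Z l tl); apply: dyn_inj => c tc.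
- by apply: fusion_linear; exact: torusB.
- by apply: (fusion_bij X Y _).1; exact: torusB.
- by apply: (fusion_bij X Y _).2; exact: torusB.
Qed.

Lemma fusion3E X Y Z l c (x : tens X Y) (z : Z) : torus l -> torus c -> wspace Z c z ->
  fusion3 l (x \ox z) = fusion (tensm X Y) Z l (fusion X Y (wsub l c) x \ox z).
Proof.
move=> tl tc wz; rewrite /fusion3 (dynE (c := c)) // => d td.
by apply: fusion_linear; exact: torusB.
Qed.

Variables (Q : set (wfun A)) (l : wfun A).
Hypotheses (tQ : forall a, Q a -> torus a) (Gl : good Q l).

Let tl : torus l := Gl.1.
Let irr1 a : Q a -> irr (wsub l a).
Proof. by move=> Qa; apply: good_irr; exact: (good_sub tQ Gl Qa). Qed.
Let irr2 a b : Q a -> Q b -> irr (wsub (wsub l a) b).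
Proof. by move=> Qa Qb; apply: good_irr; apply: (good_sub tQ _ Qb); exact: good_sub. Qed.
Let irr3 a b c : Q a -> Q b -> Q c -> irr (wsub (wsub (wsub l a) b) c).
Proof.
move=> Qa Qb Qc; apply: good_irr; apply: (good_sub tQ _ Qc).
by apply: (good_sub tQ _ Qb); exact: good_sub.
Qed.

Lemma fusion_cocycle X Y Z (x : tens (tens X Y) Z) : wtens3 Q X Y Z x ->
  tassoc (fusion3 l x) = fusion X (tensm Y Z) l (tmap idfun (fusion Y Z l) (tassoc x)).
Proof.
have l1 := @fusion3_linear X Y Z l tl; have l2 := @fusion_linear Y Z l tl.
have l3 := @fusion_linear X (tensO Y Z) l tl.
rewrite /wtens3; move: x; apply: span_eq.
- exact: (lin_comp (@tassoc_linear _ _ _ _) l1).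
- by apply: (lin_comp l3); lin.
move=> _ [a [b [c [v [w [u [Qa Qb Qc [wv ww wu ->]]]]]]]].
rewrite (@fusion3E X Y Z l c) // ?tassocE ?tmapE //; last exact: tQ.
by apply: (cocycle_pure (a := a) (b := b) (c := c)); auto.
Qed.

(* The triple fusion matrix intertwines exchange matrices with braidings, so that the
   dynamical Yang-Baxter equation becomes the braid relation. *)
Lemma fusion3_exchange12 X Y Z (x : tens (tens X Y) Z) : wtens3 Q X Y Z x ->
  fusion3 l (dyn Z (fun c => exchange Rm X Y (wsub l c)) x) =
  tmap (@braid _ _ Rm Y X) idfun (fusion3 l (swap12 x)).
Proof.
have lb := @braid_linear _ _ Rm Y X.
have le c : torus c -> linear (exchange Rm X Y (wsub l c) : tens X Y -> tens X Y).
  by move=> tc; apply: exchange_linear; exact: torusB.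
rewrite /wtens3; move: x; apply: span_eq.
- exact: (lin_comp (@fusion3_linear X Y Z l tl) (dyn_lin le)).
- apply: (lin_comp (tmap_linear lb (@id_linear _ _))).
  exact: (lin_comp (@fusion3_linear Y X Z l tl) (@swap12_linear _ _ _ _)).
move=> _ [a [b [c [v [w [u [Qa Qb Qc [wv ww wu ->]]]]]]]].
have [ta tb tc] : [/\ torus a, torus b & torus c] by split; exact: tQ.
have tm := torusB tl tc.
rewrite (dynE (c := c)) // (@fusion3E X Y Z l c) // swap12E (@fusion3E Y X Z l c) //.
rewrite exchangeP // tswapE.
have fd : fusion_defined Y X (wsub l c) b a by apply: fusion_ok; auto.
have ws := fusion_weight (@o_diag _ _ Y) (@o_diag _ _ X) tm tb ta ww wv fd.
have ir : irr (wsub (wsub l c) (wadd a b)) by rewrite wsubDA; auto.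
have tab := torusD ta tb.
apply: (@fusion_natural1 _ _ (tensO Y X) (tensO X Y) Z (@braid _ _ Rm Y X) l (wadd a b) c) => //.
- exact: braid_hom.
- by apply: fusion_ok; auto.
- by apply: fusion_ok; auto.
Qed.

(** J R = beta J^21 holds in the last two factors, and naturality of the outer fusion matrix in its
    second argument lets the homomorphism beta pass through it. *)
Lemma fusion_exchange23 X Y Z (x : tens (tens X Y) Z) : wtens3 Q X Y Z x ->
  fusion X (tensm Y Z) l (tmap idfun (fusion Y Z l) (tmap idfun (exchange Rm Y Z l) (tassoc x))) =
  tmap idfun (@braid _ _ Rm Z Y)
    (fusion X (tensm Z Y) l (tmap idfun (fusion Z Y l) (tassoc (perm132 x)))).
Proof.
have lb := @braid_linear _ _ Rm Z Y; have le := @exchange_linear Y Z l tl.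
have l1 := @fusion_linear Y Z l tl; have l2 := @fusion_linear Z Y l tl.
have l3 := @fusion_linear X (tensO Y Z) l tl; have l4 := @fusion_linear X (tensO Z Y) l tl.
have lp := @perm132_linear K X Y Z.
rewrite /wtens3; move: x; apply: span_eq.
- by apply: (lin_comp l3); lin.
- by apply: (lin_comp (tmap_linear (@id_linear _ _) lb)); apply: (lin_comp l4); lin.
move=> _ [a [b [c [v [w [u [Qa Qb Qc [wv ww wu ->]]]]]]]].
have [ta tb tc] : [/\ torus a, torus b & torus c] by split; exact: tQ.
rewrite perm132E !tassocE !tmapE // exchangeP // tswapE.
have fd : fusion_defined Z Y l c b by apply: fusion_ok; auto.
have ws := fusion_weight (@o_diag _ _ Z) (@o_diag _ _ Y) tl tc tb wu ww fd.
have tbc := torusD tb tc.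
have ir : irr (wsub l (wadd b c)) by rewrite wsubDA; auto.
have ir' : irr (wsub (wsub l (wadd b c)) a) by rewrite wsubDA; auto.
apply: (@fusion_natural2 _ _ X (tensO Z Y) (tensO Y Z) (@braid _ _ Rm Z Y) l a (wadd b c)) => //.
- exact: braid_hom.
- by apply: fusion_ok; auto.
- by apply: fusion_ok; auto.
Qed.

Lemma wtens3_swap12 X Y Z x : wtens3 Q X Y Z x -> wtens3 Q Y X Z (swap12 x).
Proof.
rewrite /wtens3; move: x; apply: span_map; first exact: swap12_linear.
move=> _ [a [b [c [v [w [u [Qa Qb Qc [wv ww wu ->]]]]]]]]; rewrite swap12E.
by apply: span_gen; exists b, a, c, w, v, u.
Qed.

Lemma wtens3_perm132 X Y Z x : wtens3 Q X Y Z x -> wtens3 Q X Z Y (perm132 x).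
Proof.
rewrite /wtens3; move: x; apply: span_map; first exact: perm132_linear.
move=> _ [a [b [c [v [w [u [Qa Qb Qc [wv ww wu ->]]]]]]]]; rewrite perm132E.
by apply: span_gen; exists a, c, b, v, u, w.
Qed.

Lemma act2_Qtens X Y d x : stable Q X -> stable Q Y -> @Qtens _ _ Q X Y x ->
  @Qtens _ _ Q X Y (act2 d x).
Proof.
move=> sX sY; rewrite {1}/Qtens; move: x; apply: span_sub => [|_ [b [a [v [w [Qb Qa wv ww ->]]]]]].
  by apply: (submod_pre ((act2_bilinear X Y).2 d)); exact: span_submod.
have lt : linear (fun d : tens A A => act2 d (v \ox w) : tens X Y) by lin.
rewrite /=; move: d; apply: tens_ind => [|d e].
  by apply: (submod_pre lt); exact: span_submod.
rewrite act2E.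
have Qv := sX d v (Qpart_gen Qb wv); have Qw := sY e w (Qpart_gen Qa ww).
apply: (span_pure2 (span_submod _) _ Qv Qw) => {wv ww}v' w' [b' Qb' wv] [a' Qa' ww].
by apply: span_gen; exists b', a', v', w'.
Qed.

(** The braiding preserves the Q-part because A does, and J maps the Q-part onto itself; by
    injectivity of J the preimage found there is the value of the exchange matrix. *)
Lemma exchange_Qtens X Y m x : stable Q X -> stable Q Y -> good Q m ->
  @Qtens _ _ Q X Y x -> @Qtens _ _ Q X Y (exchange Rm X Y m x).
Proof.
move=> sX sY Gm hx; have tm : torus m := Gm.1.
have tG a : good Q a -> torus a by case.
have fQ X' Y' : stable Q X' -> stable Q Y' -> _ :=
  fun s s' => @fusion_Q _ _ Q (good Q) tQ tG (@good_irr _ _ Q)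
    (fun l a => @good_sub _ _ Q l a tQ) X' Y' m s s' Gm.
have swQ (X' Y' : amod A) z : @Qtens _ _ Q X' Y' z -> @Qtens _ _ Q Y' X' (tswap z).
  rewrite /Qtens; move: z; apply: span_map; first exact: tswap_linear.
  move=> _ [b [a [v [w [Qb Qa wv ww ->]]]]]; rewrite tswapE.
  by apply: span_gen; exists a, b, w, v.
have h1 := (fQ _ _ sY sX).1 _ (swQ _ _ _ hx).
have h2 : @Qtens _ _ Q X Y (braid Rm (fusion Y X m (tswap x))).
  apply: swQ; have /eventually_ex [n <-] := cactE Rm (fusion Y X m (tswap x) : tens Y X).
  exact: act2_Qtens.
have [z hz e] := (fQ _ _ sX sY).2 _ h2.
suff -> : exchange Rm X Y m x = z by [].
by apply: (fusion_inj tm); rewrite exchangeP.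
Qed.

Lemma wtens3_dyn X Y Z x : stable Q X -> stable Q Y ->
  wtens3 Q X Y Z x -> wtens3 Q X Y Z (dyn Z (fun c => exchange Rm X Y (wsub l c)) x).
Proof.
move=> sX sY.
have le c : torus c -> linear (exchange Rm X Y (wsub l c) : tens X Y -> tens X Y).
  by move=> tc; apply: exchange_linear; exact: torusB.
rewrite /wtens3; move: x; apply: span_map; first exact: dyn_lin.
move=> _ [a [b [c [v [w [u [Qa Qb Qc [wv ww wu ->]]]]]]]].
rewrite (dynE (c := c)) //; last exact: tQ.
have hx : @Qtens _ _ Q X Y (v \ox w) by apply: span_gen; exists a, b, v, w.
have := exchange_Qtens sX sY (good_sub tQ Gl Qc) hx; rewrite /Qtens.
move: (exchange _ _ _ _ _) => y; move: (y : tens X Y).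
apply: span_map; first by lin.
move=> _ [a' [b' [v' [w' [Qa' Qb' wv' ww' ->]]]]].
by apply: span_gen; exists a', b', c, v', w', u.
Qed.

Lemma wtens3_map23 X Y Z x : stable Q Y -> stable Q Z ->
  wtens3 Q X Y Z x -> wtens3 Q X Y Z (map23 (exchange Rm Y Z l) x).
Proof.
move=> sY sZ; have le := @exchange_linear Y Z l tl; rewrite /map23.
rewrite /wtens3; move: x; apply: span_map; first by lin.
move=> _ [a [b [c [v [w [u [Qa Qb Qc [wv ww wu ->]]]]]]]].
rewrite tassocE tmapE //.
have hx : @Qtens _ _ Q Y Z (w \ox u) by apply: span_gen; exists b, c, w, u.
have := exchange_Qtens sY sZ Gl hx; rewrite /Qtens.
move: (exchange _ _ _ _ _) => y; move: (y : tens Y Z).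
apply: span_map; first by lin.
move=> _ [b' [c' [w' [u' [Qb' Qc' ww' wu' ->]]]]]; rewrite tassocVE.
by apply: span_gen; exists a, b', c', v, w', u'.
Qed.

Lemma fusion3_exchange23 X Y Z (x : tens (tens X Y) Z) : stable Q Y -> stable Q Z ->
  wtens3 Q X Y Z x -> fusion3 l (map23 (exchange Rm Y Z l) x) =
  tassocV (tmap idfun (@braid _ _ Rm Z Y) (tassoc (fusion3 l (perm132 x)))).
Proof.
move=> sY sZ hx; rewrite (fusion_cocycle (wtens3_perm132 hx)) -fusion_exchange23 //.
rewrite -[LHS]tassocK (fusion_cocycle (wtens3_map23 sY sZ hx)).
by rewrite /map23 tassocVK.
Qed.

Lemma qdybe V W U (x : tens (tens V W) U) : stable Q V -> stable Q W -> stable Q U ->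
  wtens3 Q V W U x ->
  dyn U (fun c => exchange Rm V W (wsub l c))
    (op13 (tmap (exchange Rm V U l) idfun)
      (op23 (dyn V (fun a => exchange Rm W U (wsub l a))) x))
  = op23 (tmap (exchange Rm W U l) idfun)
      (op13 (dyn W (fun b => exchange Rm V U (wsub l b)))
        (tmap (exchange Rm V W l) idfun x)).
Proof.
move=> sV sW sU hx.
have [eVU eWU eVW] : [/\ linear (exchange Rm V U l), linear (exchange Rm W U l)
  & linear (exchange Rm V W l)] by split; exact: exchange_linear.
(* All three exchange matrices are brought to adjacent factors, at the price of the permutations
   [swap12] and [perm132]. *)
rewrite (op23_map _ eWU) {1}/op23 (op13_map _ eVU) tswap_tassoc /op13.
have hy0 : wtens3 Q W U V (perm132 (swap12 x)) by apply: wtens3_perm132; exact: wtens3_swap12.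
have hy := wtens3_dyn sW sU hy0; have fy := fusion3_exchange12 hy0.
(* Of the intermediate vectors y, p and z only two facts are kept: they lie in the Q-part, where the
   cocycle condition is available, and an equation recording how they arise (for y and z, the value
   of J(l)). *)
move: (dyn V _ _) hy fy => y hy fy.
have e := map12_map23 x eVW; move: (perm132 (tmap _ _ x)) e => p e.
have hq : wtens3 Q U V W (swap12 (perm132 x)) by apply: wtens3_swap12; exact: wtens3_perm132.
have hp : wtens3 Q V U W p.
  by rewrite -[p]swap12K e; apply: wtens3_swap12; exact: wtens3_map23.
have hz := wtens3_dyn sV sU hp; have fz := fusion3_exchange12 hp.
rewrite e (fusion3_exchange23 sV sW hq) swap12_perm132 in fz.
move: (dyn W _ _) hz fz => z hz fz.
have hpy := wtens3_perm132 hy; have hpz := wtens3_perm132 hz.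
apply: (@fusion3_inj V W U l tl).
rewrite fusion3_exchange12; last by apply: wtens3_swap12; exact: wtens3_map23.
rewrite swap12K (fusion3_exchange23 sV sU hpy) perm132K fy.
rewrite (fusion3_exchange23 sW sU hpz) perm132K fz.
(* On both sides what remains is J(l) of the tensor in reversed order, in U (x) W (x) V, under three
   braidings. *)
move: (fusion3 l (swap12 _)) => j.
rewrite -(@braid_tens _ _ Rm U W V j hR).
(* The braid relation: exchanging U and W commutes with moving V past their tensor product, and the
   hexagon splits that move into two braidings. *)
have bn := @braid_natural _ _ Rm (tensO U W) V (tensO W U) V (@braid _ _ Rm U W) idfun j
  (braid_hom _ _ hR) (@id_hom _ _ _).
by rewrite -bn (@braid_tens _ _ Rm W U V _ hR) tassocK.
Qed.

End Exchange.

Theorem theorem14 (R : realType) (A : polarized R[i]) (hA : nondegenerate_polarized A)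
    (Rm : ctens A) (hR : quasitriangular Rm) (V W U : catO A)
    (P : set (wfun A)) (hP : countable P) :
  generic (fun l : wfun A => forall x : tens (tens V W) U, wtens3 P V W U x ->
    (* 2-cocycle condition *)
    tassoc (fusion (tensm V W) U l
              (dyn U (fun c => fusion V W (wsub l c)) x))
      = fusion V (tensm W U) l (tmap idfun (fusion W U l) (tassoc x))
    /\
    (* quantum dynamical Yang-Baxter equation *)
    dyn U (fun c => exchange Rm V W (wsub l c))
      (op13 (tmap (exchange Rm V U l) idfun)
        (op23 (dyn V (fun a => exchange Rm W U (wsub l a))) x))
      = op23 (tmap (exchange Rm W U l) idfun)
          (op13 (dyn W (fun b => exchange Rm V U (wsub l b)))
            (tmap (exchange Rm V W l) idfun x))).
Proof.
(* The three modules are listed as a sequence that is constantly U from the third term on, so that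
   one set Q is stable for all of them. *)
have [Q [cQ tQ PQ sQ]] := countable_closure (fun i => if i is i'.+1 then
  (if i' is _.+1 then U else W) else V) hP.
have [sV [sW sU]] := (sQ 0%N, (sQ 1%N, sQ 2%N)).
apply: (generic_imp _ (generic_good hA cQ tQ)) => l _ Gl x Px.
suff Qx : wtens3 Q V W U x by split; [exact: (fusion_cocycle tQ Gl Qx)|exact: (qdybe hR tQ Gl sV sW sU Qx)].
move: Px; rewrite /wtens3; move: x; apply: span_mono.
move=> _ [a [b [c [v [w [u [Pa Pb Pc [wv ww wu ->]]]]]]]].
(* P may contain functions that are not characters, and the zero vector has every weight. Nonzero
   vectors force their weights into T and hence into Q. *)
have [v0|nv] := pselect (v = 0).
  have -> : v \ox w \ox u = 0 by rewrite v0 (linear_mk0 (f := fun v => v \ox w \ox u)) //; lin.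
  exact: span0.
have [w0|nw] := pselect (w = 0).
  have -> : v \ox w \ox u = 0 by rewrite w0 (linear_mk0 (f := fun w => v \ox w \ox u)) //; lin.
  exact: span0.
have [u0|nu] := pselect (u = 0).
  have -> : v \ox w \ox u = 0 by rewrite u0 (linear_mk0 (f := fun u => v \ox w \ox u)) //; lin.
  exact: span0.
apply: span_gen; exists a, b, c, v, w, u; split=> //.
- by apply: PQ => //; exact: wspace_torus wv nv.
- by apply: PQ => //; exact: wspace_torus ww nw.
- by apply: PQ => //; exact: wspace_torus wu nu.
Qed.
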